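(* Let $k \geq 1$ be an integer and let $\lambda>0$ be real with $\lambda - k - \tfrac12 > -1$. Then for any $z>1$, $$G_{\lambda,\mu_{\lambda-(1/2),\,\lambda-(1/2)-k}}(z) = \frac{[G_{\mathrm W}(z)]^{\lambda-(k/2)}}{(1+z)^{k/2}}\; {}_2F_1\!\left(1-k,\,k,\,2\lambda-k+1;\ \frac{G_{\mathrm W}(z)}{G_{\mathrm W}(z)+2}\right).$$ Moreover, the equality extends analytically to $z\in\mathbb{C}\setminus(-\infty,1]$.
   Context: For $\gamma,\beta>-1$, $\mu_{\gamma,\beta}$ is the beta distribution on $[-1,1]$ given by $\mu_{\gamma,\beta}(dx) = \frac{\Gamma(\gamma+\beta+2)}{2^{\gamma+\beta+1}\Gamma(\gamma+1)\Gamma(\beta+1)}(1-x)^{\gamma}(1+x)^{\beta}\mathbf{1}_{[-1,1]}(x)\,dx$. For $\lambda>0$ and a probability measure $\mu$ on $[-1,1]$, the generalized Stieltjes transform is $G_{\lambda,\mu}(z) := \int \frac{1}{(z-x)^{\lambda}}\,\mu(dx)$ for $z\in\mathbb{C}\setminus(-\infty,1]$, with the principal branch of the power. $G_{\mathrm W}$ is the Stieltjes transform of the Wigner distribution: $G_{\mathrm W}(z) = \int_{-1}^1 \frac{1}{z-x}\,\frac{2\sqrt{1-x^2}}{\pi}\,dx = \frac{2}{z+\sqrt{z^2-1}}$, where $\sqrt{z^2-1}$ is the branch analytic on $\mathbb{C}\setminus[-1,1]$ that is positive for $z>1$. Powers of $G_{\mathrm W}(z)$ and of $1+z$ are principal powers.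 ${}_2F_1(a,b,c;u) = \sum_{n\ge0}\frac{(a)_n(b)_n}{(c)_n}\frac{u^n}{n!}$ is the Gauss hypergeometric function, with $(a)_n = a(a+1)\cdots(a+n-1)$, $(a)_0=1$; here the series terminates. *)

(* Defs.v *)
From HB Require Import structures.
From mathcomp Require Import all_boot all_order all_algebra.
From mathcomp Require Import all_classical all_reals all_analysis measurable_realfun.
From mathcomp Require complex.

Set Implicit Arguments.
Unset Strict Implicit.
Unset Printing Implicit Defensive.

Import Order.TTheory GRing.Theory Num.Theory.
Import numFieldNormedType.Exports complex.

Local Open Scope classical_set_scope.
Local Open Scope ring_scope.
Local Open Scope complex_scope.

Section principal_power.
Context {R : realType}.
Implicit Types (z : R[i]) (a : R).

(* Principal argument, with values in ]-pi, pi] for z != 0. *)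
Definition carg z : R :=
  let t := acos (Re z / Normc.normc z) in
  if 0 <= Im z then t else - t.

Definition clog z : R[i] := ln (Normc.normc z) +i* carg z.

Definition cexp z : R[i] :=
  (expR (Re z) * cos (Im z)) +i* (expR (Re z) * sin (Im z)).

(* Only meaningful for z != 0. *)
Definition cpow z a : R[i] := cexp (a%:C * clog z).

Definition slit_plane (c : R) : set R[i] :=
  [set z | ~ (Im z = 0 /\ Re z <= c)].

(* For an open set U; derivability along 1 is over the field R[i], so this is
   complex differentiability. *)
Definition holomorphic_on (U : set R[i]) (f : R[i] -> R[i]) :=
  forall z, U z -> derivable (f : R[i]^o -> R[i]^o) z 1.

End principal_power.

Definition cintegral d (T : measurableType d) (R : realType)
    (mu : {measure set T -> \bar R}) (f : T -> R[i]) : R[i] :=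
  (\int[mu]_(x in setT) Re (f x)) +i* (\int[mu]_(x in setT) Im (f x)).

Section density.
Context {R : realType}.
Variable f : R -> R.
Hypothesis f_ge0 : forall x, 0 <= f x.
Hypothesis mf : measurable_fun [set: R] f.

Definition density_measure (A : set R) : \bar R :=
  (\int[lebesgue_measure]_(x in A) (f x)%:E)%E.

Lemma density_measure0 : density_measure set0 = 0%E.
Proof. by rewrite /density_measure integral_set0. Qed.

Lemma density_measure_ge0 A : (0 <= density_measure A)%E.
Proof. by apply: integral_ge0 => x _; rewrite lee_fin. Qed.

Lemma density_measure_sigma_additive : semi_sigma_additive density_measure.
Proof.
move=> /= F mF tF mUF; rewrite /density_measure; apply: cvg_toP.
  apply: ereal_nondecreasing_is_cvgn => m n mn.
  apply: lee_sum_nneg_natr => // k _ _; apply: integral_ge0 => /= x Fkx.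
  by rewrite lee_fin.
rewrite ge0_integral_bigcup//=.
- exact/measurable_EFinP/measurable_funTS.
- by move=> x _; rewrite lee_fin.
Qed.

End density.

Section beta_distribution.
Context {R : realType}.
Variables gamma beta : R.

Definition Gamma_fun (s : R) : R :=
  \int[lebesgue_measure]_(x in `]0, +oo[) (x `^ (s - 1) * expR (- x)).

Lemma Gamma_fun_ge0 s : 0 <= Gamma_fun s.
Proof.
by apply: Rintegral_ge0 => x _; rewrite mulr_ge0 ?powR_ge0 ?expR_ge0.
Qed.

Definition betaN11_pdf : R -> R :=
  (fun x => Gamma_fun (gamma + beta + 2) /
     (2 `^ (gamma + beta + 1) * Gamma_fun (gamma + 1) * Gamma_fun (beta + 1)) *
     (1 - x) `^ gamma * (1 + x) `^ beta) \_ `[-1, 1].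

Lemma betaN11_pdf_ge0 x : 0 <= betaN11_pdf x.
Proof.
apply: restrict_ge0 => {}x _.
by rewrite !mulr_ge0 ?powR_ge0// ?invr_ge0 ?mulr_ge0 ?powR_ge0 ?Gamma_fun_ge0.
Qed.

Lemma measurable_betaN11_pdf : measurable_fun [set: R] betaN11_pdf.
Proof.
apply/measurable_restrict => //; apply: measurable_funTS.
apply: measurable_funM; first apply: measurable_funM => //.
  apply: (measurableT_comp (measurable_powR gamma)).
  exact: measurable_funB.
apply: (measurableT_comp (measurable_powR beta)).
exact: measurable_funD.
Qed.

Definition betaN11 : set R -> \bar R := density_measure betaN11_pdf.

HB.instance Definition _ := isMeasure.Build _ _ _ betaN11
  (density_measure0 _) (density_measure_ge0 betaN11_pdf_ge0)
  (density_measure_sigma_additive betaN11_pdf_ge0 measurable_betaN11_pdf).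

End beta_distribution.

Section wigner_distribution.
Context {R : realType}.

Definition wigner_pdf : R -> R :=
  (fun x => 2 * Num.sqrt (1 - x ^+ 2) / pi) \_ `[-1, 1].

Lemma wigner_pdf_ge0 x : 0 <= wigner_pdf x.
Proof.
by apply: restrict_ge0 => {}x _; rewrite divr_ge0 ?mulr_ge0 ?sqrtr_ge0 ?pi_ge0.
Qed.

Lemma measurable_wigner_pdf : measurable_fun [set: R] wigner_pdf.
Proof.
apply/measurable_restrict => //; apply: measurable_funTS.
apply: continuous_measurable_fun => x.
apply: cvgM; last exact: cvg_cst.
apply: cvgM; first exact: cvg_cst.
apply: (@continuous_comp _ _ _ (fun x : R => 1 - x ^+ 2)).
  by apply: cvgB; [exact: cvg_cst|exact: exprn_continuous].
exact: sqrt_continuous.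
Qed.

Definition wigner : set R -> \bar R := density_measure wigner_pdf.

HB.instance Definition _ := isMeasure.Build _ _ _ wigner
  (density_measure0 _) (density_measure_ge0 wigner_pdf_ge0)
  (density_measure_sigma_additive wigner_pdf_ge0 measurable_wigner_pdf).

End wigner_distribution.

Section transforms.
Context {R : realType}.

Definition gstieltjes (lambda : R) (mu : {measure set R -> \bar R})
    (z : R[i]) : R[i] :=
  cintegral mu (fun x => (cpow (z - x%:C) lambda)^-1).

Definition G_W (z : R[i]) : R[i] :=
  cintegral (@wigner R) (fun x => (z - x%:C)^-1).

Definition pochhammer (a : R[i]) (n : nat) : R[i] := \prod_(i < n) (a + i%:R).

Definition hyp2F1 (a b c u : R[i]) : R[i] :=
  limn (series (fun n : nat =>
    pochhammer a n * pochhammer b n / pochhammer c n * (u ^+ n / n`!%:R))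
    : nat -> R[i]^o).

End transforms.

(* Main.v *)
Require Import Defs.
From mathcomp Require Import all_boot all_order all_algebra.
From mathcomp Require Import all_classical all_reals all_analysis measurable_realfun.
From mathcomp Require complex.
From mathcomp Require Import ring lra.
Import Order.TTheory GRing.Theory Num.Theory.
Import numFieldNormedType.Exports complex Normc.
Local Open Scope classical_set_scope.
Local Open Scope ring_scope.
Local Open Scope complex_scope.
Set Implicit Arguments.
Unset Strict Implicit.
Unset Printing Implicit Defensive.

(** Both sides are functions of one better coordinate. For z off the ray
]-oo, 1], let w be the root of modulus < 1 of w^2 - 2 z w + 1 = 0, the inverse
Joukowski image of z. Then 2 w (z - x) = 1 - 2 x w + w^2, the generating kernel
of the Gegenbauer polynomials (written gker x w below), and, for x = -1,
2 w (1 + z) = (1 + w)^2. Since 2 w and z - x lie in opposite half planes, their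
principal powers multiply (cpow_gker_jouk), so that no branch appears any more:
G_W z = 2 w (G_WE), the left-hand side is
  (2 w)^lambda C int_{-1}^1 (1 - x)^(lambda - 1/2) (1 + x)^(lambda - 1/2 - k)
    gker(x, w)^(-lambda) dx
with C the normalizing constant of the beta distribution, and the right-hand
side is (2 w)^lambda (1 + w)^(-k) 2F1 (1 - k, k; 2 lambda - k + 1; w / (1 + w)).

There remains an identity on the unit disc (jtransE), where the integral is
evaluated by induction on k, two steps at a time.
- For k = 0 the integral does not depend on w (gegen_const): its derivative is
  a multiple of the moment M(w) of w - x against gker^(-lambda-1), and an
  integration by parts shows that t^(2 lambda + 1) M(t w) is constant in t;
  letting t tend to 0 gives M = 0.
- For k = 1 the two facts about k = 0, at lambda - 1, determine the integral
  (gegen_shift).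
- Integrating the x-derivative of
  (1 - x)^(lambda + 1/2) (1 + x)^(b + 1) gker^(1 - lambda) over ]-1, 1[ gives a
  linear relation between the integrals for three consecutive exponents b of
  1 + x (jtrans_rec). The hypergeometric polynomials satisfy the matching
  contiguous relation (heval_rec).

The factor left over is the total mass of the weight, the value at w = 0; that
it is the inverse of C is the beta integral, obtained from the Gamma
integrals by Tonelli's theorem (gamma_beta_tonelli). The form of the right-hand
side in terms of w is holomorphic because principal powers are holomorphic on
the slit plane (derivable_cpow), and the left-hand side is holomorphic because
it is equal to it. *)

(** * Principal powers *)
Section complex_basics.
Context {R : realType}.
Implicit Types (u v z : R[i]) (a s x y : R).

Lemma ReD u v : Re (u + v) = Re u + Re v. Proof. by case: u; case: v. Qed.
Lemma ImD u v : Im (u + v) = Im u + Im v. Proof. by case: u; case: v. Qed.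
Lemma ReN u : Re (- u) = - Re u. Proof. by case: u. Qed.
Lemma ImN u : Im (- u) = - Im u. Proof. by case: u. Qed.
Lemma ReM u v : Re (u * v) = Re u * Re v - Im u * Im v.
Proof. by case: u; case: v. Qed.
Lemma ImM u v : Im (u * v) = Re u * Im v + Im u * Re v.
Proof. by case: u; case: v. Qed.
Lemma Re_real x : Re x%:C = x. Proof. by []. Qed.
Lemma Im_real x : Im x%:C = 0. Proof. by []. Qed.
Lemma Re1 : Re (1 : R[i]) = 1. Proof. by []. Qed.
Lemma Im1 : Im (1 : R[i]) = 0. Proof. by []. Qed.
Lemma Re0 : Re (0 : R[i]) = 0. Proof. by []. Qed.
Lemma Im0 : Im (0 : R[i]) = 0. Proof. by []. Qed.
(** The Re and Im projections compute on literals x +i* y, but simplifying would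
also unfold any opaque complex number that has been defined; these rules push
them through the operations without unfolding anything. *)
Definition ReImE := (ReD, ImD, ReN, ImN, ReM, ImM, Re_real, Im_real, Re1, Im1, Re0, Im0).

Lemma complex_ext u v : Re u = Re v -> Im u = Im v -> u = v.
Proof. by case: u; case: v => /= ? ? ? ? -> ->. Qed.

Lemma normcE2 z : normc z = Num.sqrt (Re z ^+ 2 + Im z ^+ 2).
Proof. by case: z. Qed.

Lemma sqr_normcE z : normc z ^+ 2 = Re z ^+ 2 + Im z ^+ 2.
Proof. by rewrite normcE2 sqr_sqrtr// addr_ge0// sqr_ge0. Qed.

Lemma normc_ge0 z : 0 <= normc z. Proof. by rewrite normcE2 sqrtr_ge0. Qed.

Lemma normc_eq0 z : (normc z == 0) = (z == 0).
Proof. by apply/eqP/eqP => [/eq0_normc//|->]; rewrite normc0. Qed.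

Lemma normc_gt0 z : (0 < normc z) = (z != 0).
Proof. by rewrite lt_neqAle normc_ge0 andbT eq_sym normc_eq0. Qed.

Lemma ler_Re_normc z : `|Re z| <= normc z.
Proof.
by rewrite -sqrtr_sqr normcE2 ler_wsqrtr// lerDl sqr_ge0.
Qed.

Lemma ler_Im_normc z : `|Im z| <= normc z.
Proof.
by rewrite -sqrtr_sqr normcE2 ler_wsqrtr// lerDr sqr_ge0.
Qed.

Lemma normc_le_ReIm z : normc z <= `|Re z| + `|Im z|.
Proof.
rewrite -(@ler_pXn2r _ 2)// ?nnegrE ?normc_ge0 ?addr_ge0//.
rewrite sqr_normcE sqrrD !real_normK ?num_real// addrAC lerDl.
by rewrite mulrn_wge0// mulr_ge0.
Qed.

Lemma normc_real x : normc x%:C = `|x|.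
Proof. by rewrite normcE2/= expr0n addr0 sqrtr_sqr. Qed.

Lemma normrE z : `|z| = (normc z)%:C.
Proof. by rewrite normc_def normcE2. Qed.

(** An open condition in place of the negated conjunction: the slit is exactly
where Re z = - normc z. *)
Lemma slit_gtP z : slit_plane 0 z <-> 0 < normc z + Re z.
Proof.
have h : 0 <= normc z + Re z.
  have := ler_Re_normc z; have := normc_ge0 z; have := ler_norm (- Re z).
  by rewrite normrN; lra.
rewrite /slit_plane/=; split => [zP|zP [i0 r0]].
  rewrite lt_neqAle h andbT eq_sym; apply/eqP => e; apply: zP.
  have e2 : normc z = - Re z by lra.
  have r0 : Re z <= 0 by have := normc_ge0 z; lra.
  split => //; have := sqr_normcE z; rewrite e2 sqrrN => e3.
  by apply/eqP; rewrite -sqrf_eq0; apply/eqP; lra.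
have : normc z = `|Re z| by rewrite normcE2 i0 expr0n addr0 sqrtr_sqr.
by rewrite ler0_norm// => e; lra.
Qed.

Lemma slit_neq0 z : slit_plane 0 z -> z != 0.
Proof. by move=> zP; apply/eqP => z0; apply: zP; rewrite z0. Qed.

Lemma slit_Re_gt0 z : 0 < Re z -> slit_plane 0 z.
Proof. by move=> z0 [_]; rewrite leNgt z0. Qed.

Lemma cexpD u v : cexp (u + v) = cexp u * cexp v.
Proof.
case: u v => [a b] [c d]; rewrite /cexp/= expRD cosD sinD.
by apply: complex_ext => /=; ring.
Qed.

Lemma cexp0 : cexp 0 = 1 :> R[i].
Proof. by rewrite /cexp/= expR0 cos0 sin0 mulr1 mulr0. Qed.

Lemma normc_cexp u : normc (cexp u) = expR (Re u).
Proof.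
rewrite normcE2/= !exprMn -mulrDr cos2Dsin2 mulr1 sqrtr_sqr.
by rewrite ger0_norm// expR_ge0.
Qed.

Lemma cexp_neq0 u : cexp u != 0.
Proof. by rewrite -normc_gt0 normc_cexp expR_gt0. Qed.

Lemma cexpN u : cexp (- u) = (cexp u)^-1.
Proof.
apply: (mulfI (cexp_neq0 u)).
by rewrite -cexpD subrr cexp0 mulfV// cexp_neq0.
Qed.

Lemma cpowE z a : cpow z a =
  (expR (a * ln (normc z)) * cos (a * carg z)) +i*
  (expR (a * ln (normc z)) * sin (a * carg z)).
Proof. by rewrite /cpow /cexp/= !mul0r subr0 addr0. Qed.

Lemma normc_cpow z a : normc (cpow z a) = expR (a * ln (normc z)).
Proof. by rewrite /cpow normc_cexp/= mul0r subr0. Qed.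

Lemma cpowD z a b : cpow z (a + b) = cpow z a * cpow z b.
Proof. by rewrite /cpow rmorphD/= mulrDl cexpD. Qed.

Lemma cpow0 z : cpow z 0 = 1.
Proof. by rewrite /cpow mul0r cexp0. Qed.

Lemma cpowN z a : cpow z (- a) = (cpow z a)^-1.
Proof. by rewrite /cpow rmorphN/= mulNr cexpN. Qed.

Lemma cpowB z a b : cpow z (a - b) = cpow z a / cpow z b.
Proof. by rewrite cpowD cpowN. Qed.

Lemma ReV1_bound z : -1 <= Re z / normc z <= 1.
Proof.
have [->|z0] := eqVneq z 0; first by rewrite mul0r lerN10 ler01.
have n0 : 0 < normc z by rewrite normc_gt0.
have := ler_Re_normc z; rewrite ler_norml => /andP[h1 h2].
by rewrite ler_pdivlMr// ler_pdivrMr// mulN1r mul1r h1.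
Qed.

Lemma clog_cexp u : - pi < Im u < pi -> clog (cexp u) = u.
Proof.
move=> /andP[u1 u2]; rewrite /clog normc_cexp expRK.
suff -> : carg (cexp u) = Im u by case: u {u1 u2}.
rewrite /carg normc_cexp /=.
have e0 := expR_gt0 (Re u).
rewrite mulrAC divff ?gt_eqF// mul1r pmulr_rge0//.
have [u0|u0] := leP 0 (Im u).
  by rewrite sin_ge0_pi ?cosK ?in_itv/= ?u0 ?ltW.
rewrite -[Im u]opprK sinN cosN oppr_ge0 leNgt.
by rewrite sin_gt0_pi ?cosK ?in_itv/=//; lra.
Qed.

(** The sign convention of carg is what makes the sine of the argument come out
with the sign of Im z; the square root in sin (acos t) is |Im z| / |z|. *)
Lemma cexp_clog z : z != 0 -> cexp (clog z) = z.
Proof.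
move=> z0; have n0 : 0 < normc z by rewrite normc_gt0.
have zb := ReV1_bound z.
rewrite /cexp/= lnK//.
have ci : normc z * cos (carg z) = Re z.
  rewrite /carg; case: ifP => _; rewrite ?cosN acosK ?in_itv//.
    by rewrite mulrC divfK// gt_eqF.
  by rewrite mulrC divfK// gt_eqF.
apply: complex_ext => //=.
have sq : Num.sqrt (1 - (Re z / normc z) ^+ 2) = `|Im z| / normc z.
  rewrite -[RHS]ger0_norm ?divr_ge0 ?normc_ge0//.
  rewrite -sqrtr_sqr !expr_div_n; congr Num.sqrt.
  rewrite real_normK ?num_real//.
  have := sqr_normcE z => h; apply: (mulIf (x:= normc z ^+ 2)).
    by rewrite expf_eq0/= gt_eqF.
  by rewrite mulrBl !divfK ?expf_eq0/= ?gt_eqF// h; ring.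
rewrite /carg; case: ifPn => [i0|].
  by rewrite sin_acos// sq ger0_norm// mulrC divfK// gt_eqF.
rewrite -ltNge => i0.
by rewrite sinN sin_acos// sq ltr0_norm// mulNr opprK mulrC divfK// gt_eqF.
Qed.

(** Every branch computation reduces to this: a logarithm with imaginary part in
]-pi, pi[ is the principal one. *)
Lemma clog_uniq z u : cexp u = z -> - pi < Im u < pi -> clog z = u.
Proof. by move=> <-; exact: clog_cexp. Qed.

Lemma cpow1r z : z != 0 -> cpow z 1 = z.
Proof. by move=> z0; rewrite /cpow mul1r cexp_clog. Qed.

Lemma cpow_nat z n : z != 0 -> cpow z n%:R = z ^+ n.
Proof.
move=> z0; elim: n => [|n ih]; first by rewrite cpow0 expr0.
by rewrite -natr1 cpowD ih cpow1r// exprSr.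
Qed.

Lemma clog1 : clog 1 = 0 :> R[i].
Proof. by rewrite -cexp0 clog_cexp//= oppr_lt0 pi_gt0. Qed.

Lemma cpow1l a : cpow 1 a = 1 :> R[i].
Proof. by rewrite /cpow clog1 mulr0 cexp0. Qed.

Lemma carg_Im_gt0 z : 0 < Im z -> 0 < carg z < pi.
Proof.
move=> i0; have z0 : z != 0 by apply: contraTneq i0 => ->; rewrite ltxx.
have n0 : 0 < normc z by rewrite normc_gt0.
have zb := ReV1_bound z; rewrite /carg (ltW i0).
have lt : `|Re z| < normc z.
  rewrite -(@ltr_pXn2r _ 2)// ?nnegrE ?normc_ge0//.
  by rewrite sqr_normcE real_normK ?num_real// ltrDl exprn_gt0.
move: lt; rewrite ltr_norml => /andP[h1 h2].
rewrite acos_gt0 ?acos_ltpi//.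
  by rewrite ltr_pdivlMr// mulN1r h1; case/andP: zb.
by rewrite ltr_pdivrMr// mul1r h2 andbT; case/andP: zb.
Qed.

Lemma carg_Im_lt0 z : Im z < 0 -> - pi < carg z < 0.
Proof.
move=> i0.
have : 0 < Im z^*%C by case: z i0 => a b /=; rewrite oppr_gt0.
move=> /[dup] i0' /carg_Im_gt0; rewrite /carg (ltW i0') leNgt i0/=.
have -> : Re z^*%C = Re z by case: z {i0 i0'}.
have -> : normc z^*%C = normc z by case: z {i0 i0'} => a b /=; rewrite sqrrN.
lra.
Qed.

Lemma carg_pos z : Im z = 0 -> 0 < Re z -> carg z = 0.
Proof.
move=> i0 r0; rewrite /carg i0 lexx normcE2 i0 expr0n addr0 sqrtr_sqr.
by rewrite gtr0_norm// divff ?gt_eqF// acos1.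
Qed.

Lemma carg_slit z : slit_plane 0 z -> - pi < carg z < pi.
Proof.
have p0 := @pi_gt0 R.
move=> zP; have [/carg_Im_gt0|/carg_Im_lt0|/esym i0] := ltgtP 0 (Im z); [lra|lra|].
have [r0|r0] := ltP 0 (Re z); last by case: zP.
by rewrite carg_pos//; lra.
Qed.

(** The cosine of the argument is Re z / |z|, and the cosine is nonpositive on
[pi/2, pi[. *)
Lemma carg_Re_gt0 z : 0 < Re z -> - (pi / 2) < carg z < pi / 2.
Proof.
have p0 := @pi_gt0 R.
move=> r0; have z0 : z != 0 by apply: contraTneq r0 => ->; rewrite ltxx.
have n0 : 0 < normc z by rewrite normc_gt0.
have c0 : 0 < cos (carg z).
  have := congr1 (@complex.Re R) (cexp_clog z0); rewrite /cexp/= lnK// => h.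
  by rewrite -(pmulr_rgt0 _ n0) h.
have /andP[h1 h2] := carg_slit (slit_Re_gt0 r0).
have hN (t : R) : pi / 2 <= t -> t < pi -> cos t <= 0.
  move=> t1 t2; rewrite -[t](subrK (pi/2)) cosDpihalf oppr_le0.
  by apply: sin_ge0_pi; lra.
apply/andP; split; rewrite ltNge; apply/negP => h.
  by have := hN (- carg z); rewrite cosN; lra.
by have := hN (carg z); lra.
Qed.

Lemma clogM u v : u != 0 -> v != 0 -> - pi < carg u + carg v < pi ->
  clog (u * v) = clog u + clog v.
Proof.
move=> u0 v0 h; apply: clog_uniq; last by rewrite ImD.
by rewrite cexpD !cexp_clog.
Qed.

Lemma cpowM_carg u v a : u != 0 -> v != 0 -> - pi < carg u + carg v < pi ->
  cpow (u * v) a = cpow u a * cpow v a.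
Proof. by move=> u0 v0 h; rewrite /cpow clogM// mulrDr cexpD. Qed.

(** The arguments of u and v then have opposite signs (or both vanish), so their
sum stays in ]-pi, pi[ and no branch is crossed when u and v are multiplied. *)
Definition opp_halves u v :=
  [\/ 0 < Im u /\ Im v < 0, Im u < 0 /\ 0 < Im v |
   [/\ Im u = 0, Im v = 0, 0 < Re u & 0 < Re v]].

Lemma cpowM_opp u v a : opp_halves u v -> cpow (u * v) a = cpow u a * cpow v a.
Proof.
have p0 := @pi_gt0 R.
have nz t : 0 < Im t -> t != 0 by apply: contraTneq => ->; rewrite ltxx.
have nz' t : Im t < 0 -> t != 0 by apply: contraTneq => ->; rewrite ltxx.
have nz'' t : 0 < Re t -> t != 0 by apply: contraTneq => ->; rewrite ltxx.
case=> [[u0 v0]|[u0 v0]|[u0 v0 ru rv]]; apply: cpowM_carg.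
- exact: nz.
- exact: nz'.
- by have := carg_Im_gt0 u0; have := carg_Im_lt0 v0; lra.
- exact: nz'.
- exact: nz.
- by have := carg_Im_gt0 v0; have := carg_Im_lt0 u0; lra.
- exact: nz''.
- exact: nz''.
- by rewrite !carg_pos//; lra.
Qed.

Lemma cpow_sqr_half u a : 0 < Re u -> cpow (u ^+ 2) (a / 2) = cpow u a.
Proof.
move=> r0; have /slit_neq0 u0 := slit_Re_gt0 r0.
have h := carg_Re_gt0 r0.
rewrite expr2 cpowM_carg//; last by lra.
by rewrite -cpowD -splitr.
Qed.

(** The principal argument is twice the argument of |z| + z, whose real part is
positive on the whole slit plane: the half-angle formula. Unlike the definition
by acos, which splits on the sign of Im z, it can be differentiated across the
positive real axis. *)
Lemma clogE z : slit_plane 0 z ->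
  clog z = ln (normc z) +i* (2 * atan (Im z / (normc z + Re z))).
Proof.
move=> /[dup] /slit_neq0 z0 /slit_gtP p0.
have n0 : 0 < normc z by rewrite normc_gt0.
have h2 := sqr_normcE z.
set t := Im z / _; have c2 : cos (atan t) ^+ 2 = (1 + t ^+ 2)^-1.
  by rewrite cos_atan exprVn sqr_sqrtr// addr_ge0// sqr_ge0.
have ca : cos (atan t) != 0.
  by rewrite cos_atan invr_neq0// sqrtr_eq0 -ltNge ltr_wpDr// sqr_ge0.
have sa : sin (atan t) = t * cos (atan t).
  by have := atanK t; rewrite /tan => /(canRL (divfK ca)).
have t1 : 1 + t ^+ 2 = 2 * normc z / (normc z + Re z).
  rewrite /t expr_div_n; apply: (mulIf (x := (normc z + Re z) ^+ 2)).
    by rewrite expf_eq0/= gt_eqF.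
  rewrite mulrDl divfK ?expf_eq0/= ?gt_eqF//.
  have -> : Im z ^+ 2 = normc z ^+ 2 - Re z ^+ 2 by lra.
  by field; rewrite gt_eqF.
apply: clog_uniq; last first.
  by have := atan_gtNpi2 t; have := atan_ltpi2 t => /=; lra.
rewrite /cexp/= lnK// mulr_natl cos_mulr2n sin_mulr2n sa mulrCA -expr2 c2 t1.
have r0 : normc z != 0 by rewrite gt_eqF.
have p0' : normc z + Re z != 0 by rewrite gt_eqF.
apply: complex_ext => /=.
  by field; rewrite r0 p0'.
by rewrite /t; field; rewrite r0 p0'.
Qed.
End complex_basics.

(** * Derivatives along paths in the complex plane *)
Section path_derivative.
Context {R : realType}.
Implicit Types (p q : R -> R[i]) (f g : R -> R) (t x a : R) (l m z : R[i]).

Lemma divcE l z : l / z =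
  ((Re l * Re z + Im l * Im z) / normc z ^+ 2) +i*
  ((Im l * Re z - Re l * Im z) / normc z ^+ 2).
Proof.
rewrite sqr_normcE; case: l z => [a b] [c d].
by apply: complex_ext => /=; ring.
Qed.

Lemma is_derive1_eq f t (a b : R) : is_derive t 1 f a -> a = b -> is_derive t 1 f b.
Proof. by move=> h <-. Qed.

Lemma is_derive1_add f g t (a b : R) : is_derive t 1 f a -> is_derive t 1 g b ->
  is_derive t 1 (fun t => f t + g t) (a + b).
Proof. by move=> ? ?; exact: is_deriveD. Qed.

Lemma is_derive1_opp f t (a : R) : is_derive t 1 f a ->
  is_derive t 1 (fun t => - f t) (- a).
Proof. by move=> ?; exact: is_deriveN. Qed.

Lemma is_derive1_mul f g t (a b : R) : is_derive t 1 f a -> is_derive t 1 g b ->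
  is_derive t 1 (fun t => f t * g t) (a * g t + f t * b).
Proof.
move=> fa gb; apply: (is_derive1_eq (is_deriveM fa gb)).
by rewrite /GRing.scale/= addrC mulrC.
Qed.

Lemma is_derive1_scale f t (a k : R) : is_derive t 1 f a ->
  is_derive t 1 (fun t => k * f t) (k * a).
Proof. by move=> ?; exact: is_deriveZ. Qed.

Lemma is_derive1_chain f g t (a b : R) : is_derive (g t) 1 f a ->
  is_derive t 1 g b -> is_derive t 1 (fun t => f (g t)) (a * b).
Proof. by move=> ? ?; exact: is_derive1_comp. Qed.

Lemma is_derive1_inv f t (a : R) : f t != 0 -> is_derive t 1 f a ->
  is_derive t 1 (fun t => (f t)^-1) (- a / f t ^+ 2).
Proof.
move=> f0 fa; apply: (is_derive1_eq (is_deriveV f0 fa)).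
by rewrite /GRing.scale/= mulrC mulrN mulNr.
Qed.

Lemma is_derive1_sqrt_comp f t (a : R) : 0 < f t -> is_derive t 1 f a ->
  is_derive t 1 (fun t => Num.sqrt (f t)) (a / (2 * Num.sqrt (f t))).
Proof.
move=> f0 fa.
have h := is_derive1_chain (is_derive1_sqrt f0) fa.
by apply: (is_derive1_eq h); rewrite mulrC.
Qed.

Lemma is_derive1_cvg f t (a : R) : is_derive t 1 f a -> {for t, continuous f}.
Proof.
by move=> fa; apply/differentiable_continuous/derivable1_diffP; exact: ex_derive.
Qed.

(** Componentwise, so that the real differential calculus applies to each part. *)
Definition is_cderive p t l :=
  is_derive t 1 (fun t => Re (p t)) (Re l) /\
  is_derive t 1 (fun t => Im (p t)) (Im l).

Lemma is_cderive_eq p t l m : is_cderive p t l -> l = m -> is_cderive p t m.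
Proof. by move=> h <-. Qed.

Lemma is_cderive_cst t m : is_cderive (fun=> m) t 0.
Proof. by split; exact: is_derive_cst. Qed.

Lemma is_cderive_real f t (a : R) : is_derive t 1 f a ->
  is_cderive (fun t => (f t)%:C) t a%:C.
Proof. by move=> fa; split => //=; exact: is_derive_cst. Qed.

Lemma is_cderive_add p q t l m : is_cderive p t l -> is_cderive q t m ->
  is_cderive (fun t => p t + q t) t (l + m).
Proof.
move=> [p1 p2] [q1 q2]; split.
  under eq_fun do rewrite ReD; rewrite ReD; exact: is_derive1_add.
under eq_fun do rewrite ImD; rewrite ImD; exact: is_derive1_add.
Qed.

Lemma is_cderive_opp p t l : is_cderive p t l -> is_cderive (fun t => - p t) t (- l).
Proof.
move=> [p1 p2]; split.
  under eq_fun do rewrite ReN; rewrite ReN; exact: is_derive1_opp.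
under eq_fun do rewrite ImN; rewrite ImN; exact: is_derive1_opp.
Qed.

Lemma is_cderive_mul p q t l m : is_cderive p t l -> is_cderive q t m ->
  is_cderive (fun t => p t * q t) t (l * q t + p t * m).
Proof.
move=> [p1 p2] [q1 q2]; split.
  under eq_fun do rewrite ReM.
  apply: is_derive1_eq (is_derive1_add (is_derive1_mul p1 q1)
    (is_derive1_opp (is_derive1_mul p2 q2))) _.
  by rewrite !ReImE; ring.
under eq_fun do rewrite ImM.
apply: is_derive1_eq (is_derive1_add (is_derive1_mul p1 q2)
  (is_derive1_mul p2 q1)) _.
by rewrite !ReImE; ring.
Qed.

Lemma is_cderive_scale p t l m : is_cderive p t l ->
  is_cderive (fun t => m * p t) t (m * l).
Proof.
move=> h; apply: is_cderive_eq (is_cderive_mul (is_cderive_cst t m) h) _.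
by rewrite mul0r add0r.
Qed.

Lemma is_cderive_cexp p t l : is_cderive p t l ->
  is_cderive (fun t => cexp (p t)) t (l * cexp (p t)).
Proof.
move=> [p1 p2].
have e := is_derive1_chain (is_derive_expR (Re (p t))) p1.
have c := is_derive1_chain (is_derive_cos (Im (p t))) p2.
have s := is_derive1_chain (is_derive_sin (Im (p t))) p2.
split.
  by apply: is_derive1_eq (is_derive1_mul e c) _; rewrite ReM/=; ring.
by apply: is_derive1_eq (is_derive1_mul e s) _; rewrite ImM/=; ring.
Qed.

Lemma is_cderive_normc p t l : p t != 0 -> is_cderive p t l ->
  is_derive t 1 (fun t => normc (p t))
    ((Re (p t) * Re l + Im (p t) * Im l) / normc (p t)).
Proof.
move=> p0 [p1 p2].
under eq_fun do rewrite normcE2 !expr2.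
have n0 : 0 < normc (p t) by rewrite normc_gt0.
have h0 : 0 < Re (p t) * Re (p t) + Im (p t) * Im (p t).
  by rewrite -!expr2 -sqr_normcE exprn_gt0.
have d := is_derive1_add (is_derive1_mul p1 p1) (is_derive1_mul p2 p2).
apply: is_derive1_eq (is_derive1_sqrt_comp (f := fun s =>
  Re (p s) * Re (p s) + Im (p s) * Im (p s)) h0 d) _.
rewrite -!expr2 -normcE2; field; by rewrite gt_eqF.
Qed.

Lemma near_slit_path p t l : is_cderive p t l -> slit_plane 0 (p t) ->
  \forall s \near t, slit_plane 0 (p s).
Proof.
move=> pl /[dup] /slit_neq0 p0 /slit_gtP h.
have c : {for t, continuous (fun t => normc (p t) + Re (p t))}.
  apply: is_derive1_cvg.
  by apply: is_derive1_add (is_cderive_normc p0 pl) _; case: pl => h1 _; exact: h1.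
near=> s; apply/slit_gtP; near: s; exact: (cvgr_gt _ c).
Unshelve. all: by end_near.
Qed.

(** Differentiating the half-angle form of the argument, valid near p t, and
using |p|^2 = (Re p)^2 + (Im p)^2. *)
Lemma is_cderive_clog p t l : is_cderive p t l -> slit_plane 0 (p t) ->
  is_cderive (fun t => clog (p t)) t (l / p t).
Proof.
move=> pl ps; have nps := near_slit_path pl ps.
have p0 := slit_neq0 ps; have n0 : 0 < normc (p t) by rewrite normc_gt0.
have /slit_gtP s0 := ps.
have dn := is_cderive_normc p0 pl; have [d1 d2] := pl.
have n2 := sqr_normcE (p t).
have lE := divcE l (p t).
split.
  have dl := is_derive1_chain (is_derive1_ln n0) dn.
  apply: is_derive1_eq dl _; rewrite lE/=; field; by rewrite gt_eqF.
have den : normc (p t) + Re (p t) != 0 by rewrite gt_eqF.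
have dt := is_derive1_mul d2 (is_derive1_inv (f := fun s => normc (p s) + Re (p s))
  den (is_derive1_add dn d1)).
have da := is_derive1_scale 2 (is_derive1_chain (g := fun s =>
  Im (p s) / (normc (p s) + Re (p s))) (is_derive1_atan _) dt).
apply: (@near_eq_is_derive _ _ _
   (fun s => 2 * atan (Im (p s) / (normc (p s) + Re (p s))))).
  by apply: filterS nps => s /clogE ->.
apply: is_derive1_eq da _.
rewrite lE/=.
have t1 : 1 + (Im (p t) / (normc (p t) + Re (p t))) ^+ 2 =
    2 * normc (p t) / (normc (p t) + Re (p t)).
  rewrite expr_div_n; apply: (mulIf (x := (normc (p t) + Re (p t)) ^+ 2)).
    by rewrite expf_eq0/=.
  rewrite mulrDl divfK ?expf_eq0/=//.
  have -> : Im (p t) ^+ 2 = normc (p t) ^+ 2 - Re (p t) ^+ 2 by lra.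
  by field.
rewrite t1.
have i2 : Im (p t) ^+ 2 = normc (p t) ^+ 2 - Re (p t) ^+ 2 by lra.
have nn0 : normc (p t) != 0 by rewrite gt_eqF.
move: nn0 den i2; move: (normc (p t)) (Re (p t)) (Im (p t)) (Re l) (Im l) => n a b c d.
move=> nn0 den i2.
transitivity (((d * n * (n + a) - b * (a * c + b * d + c * n))) / (n ^+ 2 * (n + a))).
  by field; rewrite nn0 den.
transitivity (((d * n * (n + a) - b * (a * c + c * n) - b ^+ 2 * d)) / (n ^+ 2 * (n + a))).
  by congr (_ / _); ring.
by rewrite i2; field; rewrite nn0 den.
Qed.

Lemma is_cderive_cpow p t l a : is_cderive p t l -> slit_plane 0 (p t) ->
  is_cderive (fun t => cpow (p t) a) t (a%:C * l * cpow (p t) (a - 1)).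
Proof.
move=> pl ps; have p0 := slit_neq0 ps.
apply: is_cderive_eq (is_cderive_cexp (is_cderive_scale a%:C
  (is_cderive_clog pl ps))) _.
rewrite -/(cpow (p t) a) cpowB cpow1r//; ring.
Qed.

End path_derivative.

(** * Holomorphy of principal powers *)
Section complex_topology.
Context {R : realType}.
Local Notation C := (R[i]^o).
Implicit Types (z : C) (a s : R).

Lemma near_normc z (e : R) : 0 < e -> \forall t \near z, normc (z - t) < e.
Proof.
move=> e0; have e0' : (0 : R[i]) < e%:C by rewrite ltcR.
have : \forall t \near z, `|z - t| < e%:C.
  exact: (@cvgr_dist_lt _ _ _ (nbhs z) _ id z cvg_id).
by apply: filterS => t; rewrite normrE ltcR.
Qed.

Lemma continuous_normc_lip (f : C -> R) z :
  (forall t, `|f z - f t| <= normc (z - t)) -> {for z, continuous f}.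
Proof.
move=> h; apply/(@cvgrPdist_lt _ _ _ (nbhs z)) => e e0; near=> t.
by apply: le_lt_trans (h t) _; near: t; exact: near_normc.
Unshelve. all: by end_near. Qed.

Lemma continuous_Re z : {for z, continuous (@complex.Re R : C -> R)}.
Proof.
apply: continuous_normc_lip => t; rewrite -ReN -ReD; exact: ler_Re_normc.
Qed.

Lemma continuous_Im z : {for z, continuous (@complex.Im R : C -> R)}.
Proof.
apply: continuous_normc_lip => t; rewrite -ImN -ImD; exact: ler_Im_normc.
Qed.

(** The inequality le_normcD is stated on Rcomplex R, the complex numbers as a real
normed space; this moves it to R[i]. *)
Lemma ler_normcD (u v : R[i]) : normc (u + v) <= normc u + normc v.
Proof. exact: le_normcD. Qed.

Lemma normcB (u v : R[i]) : normc (u - v) = normc (v - u).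
Proof. by rewrite -opprB normcN. Qed.

Lemma continuous_normc z : {for z, continuous (@normc R : C -> R)}.
Proof.
apply: continuous_normc_lip => t; rewrite ler_norml; apply/andP; split.
  have := ler_normcD (t - z) z; rewrite subrK normcB; lra.
by have := ler_normcD (z - t) t; rewrite subrK; lra.
Qed.

Lemma near_slit z : slit_plane 0 z -> \forall t \near z, slit_plane 0 t.
Proof.
move=> /slit_gtP h; near=> t; apply/slit_gtP; near: t.
apply: (cvgr_gt (normc z + Re z)) => //.
by apply: cvgD; [exact: continuous_normc|exact: continuous_Re].
Unshelve. all: by end_near. Qed.

Lemma cvg_complex (f : C -> C) z (l : C) :
  Re (f t) @[t --> z] --> Re l -> Im (f t) @[t --> z] --> Im l ->
  f t @[t --> z] --> l.
Proof.
move=> fr fi; apply/(@cvgrPdist_lt _ _ _ (nbhs z)) => e e0.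
have er : e = (Re e)%:C by move: e0; case: e => a b; rewrite ltcE/= => /andP[/eqP -> _].
have e0' : 0 < Re e by move: e0; rewrite ltcE => /andP[].
near=> t; rewrite normrE er ltcR.
apply: le_lt_trans (normc_le_ReIm _) _; rewrite !(ReD, ImD, ReN, ImN).
rewrite [ltRHS]splitr ltrD//; near: t.
  by apply: cvgr_dist_lt => //; rewrite divr_gt0.
by apply: cvgr_dist_lt => //; rewrite divr_gt0.
Unshelve. all: by end_near. Qed.

Lemma continuous_cpow z a : slit_plane 0 z ->
  {for z, continuous (fun t : C => cpow t a : C)}.
Proof.
move=> zs; have z0 := slit_neq0 zs; have n0 : 0 < normc z by rewrite normc_gt0.
have /slit_gtP d0 := zs.
have cln : ln (normc t) @[t --> z] --> ln (normc z).
  by apply: continuous_comp; [exact: continuous_normc|exact: continuous_ln].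
have carg_ : carg t @[t --> z] --> carg z.
  have near_arg : \forall t \near z, 2 * atan (Im t / (normc t + Re t)) = carg t.
    apply: filterS (near_slit zs) => t /clogE/(congr1 (@complex.Im R)).
    by rewrite /clog.
  apply: (cvg_trans (near_eq_cvg near_arg)).
  have <- : 2 * atan (Im z / (normc z + Re z)) = carg z.
    by have := clogE zs => /(congr1 (@complex.Im R)); rewrite /clog.
  apply: cvgM; first exact: cvg_cst.
  apply: (continuous_comp (f := fun t : C => Im t / (normc t + Re t)));
    last exact: continuous_atan.
  have h1 : Im t @[t --> z] --> Im z by exact: continuous_Im.
  have h2 : (normc t + Re t)^-1 @[t --> z] --> (normc z + Re z)^-1.
    have dn : normc z + Re z != 0 by rewrite gt_eqF.
    have ds : (normc t + Re t) @[t --> z] --> normc z + Re z.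
      exact: (@cvgD _ _ _ _ _ _ _ _ _ (@continuous_normc z) (@continuous_Re z)).
    exact: (cvgV dn ds).
  exact: (cvgM h1 h2).
have ce : expR (a * ln (normc t)) @[t --> z] --> expR (a * ln (normc z)).
  apply: (continuous_comp (f := fun t : C => a * ln (normc t)));
    last exact: continuous_expR.
  exact: (@cvgM _ _ _ _ _ _ _ _ (cvg_cst a) cln).
have ca : a * carg t @[t --> z] --> a * carg z.
  exact: (@cvgM _ _ _ _ _ _ _ _ (cvg_cst a) carg_).
have cc : cos (a * carg t) @[t --> z] --> cos (a * carg z).
  apply: (@continuous_comp _ _ _ (fun t : C => a * carg t)) => //.
  exact: continuous_cos.
have cs : sin (a * carg t) @[t --> z] --> sin (a * carg z).
  apply: (@continuous_comp _ _ _ (fun t : C => a * carg t)) => //.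
  exact: continuous_sin.
apply: cvg_complex.
  rewrite cpowE; under eq_fun do rewrite cpowE.
  exact: (@cvgM _ _ _ _ _ _ _ _ ce cc).
rewrite cpowE; under eq_fun do rewrite cpowE.
exact: (@cvgM _ _ _ _ _ _ _ _ ce cs).
Qed.

(** The mean value theorem for each component; the factor 2 comes from bounding
the modulus by the sum of the absolute values of the two parts. *)
Lemma cMVT (p dp : R -> R[i]) (M : R) :
  (forall t : R, 0 <= t <= 1 -> is_cderive p t (dp t)) ->
  (forall t : R, 0 < t < 1 -> normc (dp t) <= M) ->
  normc (p 1 - p 0) <= 2 * M.
Proof.
move=> pd pM; apply: le_trans (normc_le_ReIm _) _.
have mv (f df : R -> R) : (forall t : R, 0 <= t <= 1 -> is_derive t 1 f (df t)) ->
    (forall t : R, 0 < t < 1 -> `|df t| <= M) -> `|f 1 - f 0| <= M.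
  move=> fd fM; have [||c] := @MVT R f df 0 1 ltr01.
  - by move=> x; rewrite in_itv/= => /andP[? ?]; apply: fd; rewrite !ltW.
  - apply: continuous_in_subspaceT => x; rewrite inE/= in_itv/= => x01.
    by apply: is_derive1_cvg; exact: fd.
  by rewrite in_itv/= => c01 ->; rewrite subr0 mulr1 fM.
rewrite mulr_natl mulr2n lerD// !(ReD, ReN, ImD, ImN).
  apply: (mv (fun t => Re (p t)) (fun t => Re (dp t))) => t t01.
    by have [] := pd t t01.
  exact: le_trans (ler_Re_normc _) (pM _ t01).
apply: (mv (fun t => Im (p t)) (fun t => Im (dp t))) => t t01.
  by have [] := pd t t01.
exact: le_trans (ler_Im_normc _) (pM _ t01).
Qed.

(** The difference quotient minus the expected derivative g z is p 1 - p 0 for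
p t = cpow (z + t h) a / h - t g z, whose derivative g (z + t h) - g z is small
by continuity of g; conclude by the mean value inequality along the segment. *)
Lemma derivable_cpow z a : slit_plane 0 z ->
  derivable (fun t : C => cpow t a : C) z 1.
Proof.
move=> zs; apply/cvg_ex; exists (a%:C * cpow z (a - 1) : C).
apply/(@cvgrPdist_lt _ _ _ (0^')) => e e0.
have er : e = (Re e)%:C by move: e0; case: e => x b; rewrite ltcE/= => /andP[/eqP -> _].
have e0' : 0 < Re e by move: e0; rewrite ltcE => /andP[].
pose g (t : C) : C := a%:C * cpow t (a - 1).
have cg : {for z, continuous g}.
  exact: (@cvgM _ _ _ _ _ _ _ _ (cvg_cst _) (continuous_cpow (a := a - 1) zs)).
have : \forall t \near z, slit_plane 0 t /\ normc (g t - g z) < Re e / 3.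
  near=> t; split; first by near: t; exact: near_slit.
  rewrite normcB -ltcR -normrE; near: t.
  apply: (@cvgr_dist_lt _ _ _ (nbhs z) _ g (g z) cg).
  by rewrite ltcR divr_gt0.
move=> /nbhs_ballP[d d0 dP]; rewrite /mkset in d0.
have dr : d = (Re d)%:C by move: d0; case: d {dP} => x b; rewrite ltcE/= => /andP[/eqP -> _].
near=> h.
have h0 : h != 0 by near: h; exact: nbhs_dnbhs_neq.
have hd : `|h| < d.
  near: h; apply: dnbhs0_lt; exact: d0.
pose p (t : R) : R[i] := h^-1 * cpow (z + t%:C * h) a - t%:C * g z.
have inb (t : R) : 0 <= t <= 1 -> slit_plane 0 (z + t%:C * h) /\
    normc (g (z + t%:C * h) - g z) < Re e / 3.
  move=> /andP[t0 t1]; apply: dP; rewrite -ball_normE/= opprD addNKr normrN.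
  rewrite normrM; apply: le_lt_trans hd.
  by rewrite ler_piMl// normrE normc_real ger0_norm// lecR.
have pd (t : R) : 0 <= t <= 1 -> is_cderive p t (g (z + t%:C * h) - g z).
  move=> /inb[ts _].
  have idd : is_cderive (fun t : R => t%:C) t 1.
    by apply: is_cderive_real; exact: is_derive_id.
  have d1 : is_cderive (fun t : R => z + t%:C * h) t h.
    apply: is_cderive_eq (is_cderive_add (is_cderive_cst t z)
      (is_cderive_mul idd (is_cderive_cst t h))) _.
    by rewrite add0r mul1r mulr0 addr0.
  apply: is_cderive_eq (is_cderive_add (is_cderive_scale h^-1
    (is_cderive_cpow a d1 ts)) (is_cderive_opp (is_cderive_mul idd
      (is_cderive_cst t (g z))))) _.
  by rewrite mul1r mulr0 addr0 /g; congr (_ - _); field.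
have /(cMVT pd) : forall t : R, 0 < t < 1 -> normc (g (z + t%:C * h) - g z) <= Re e / 3.
  by move=> t /andP[t0 t1]; apply/ltW; case: (inb t) => //; rewrite !ltW.
rewrite normrE er ltcR => H; rewrite normcB.
apply: le_lt_trans (_ : 2 * (Re e / 3) < _); last by lra.
suff <- : p 1 - p 0 = h^-1 *: (cpow (h *: 1 + z) a - cpow z a : C) - a%:C * cpow z (a - 1).
  exact: H.
rewrite /p /g /= !mul1r !mul0r addr0 subr0.
rewrite /GRing.scale/= mulr1 [h + z]addrC; ring.
Unshelve. all: by end_near. Qed.

End complex_topology.

(** * Integration of complex functions over an open interval *)
Section improper_FTC.
Context {R : realType}.
Local Notation mu := (@lebesgue_measure R).

Lemma is_derive0_const_oo (f : R -> R) (a b : R) :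
  (forall x, a < x < b -> is_derive x 1 f 0) ->
  forall x y, a < x < b -> a < y < b -> f x = f y.
Proof.
move=> f0; suff H x y : a < x < b -> a < y < b -> x < y -> f x = f y.
  move=> x y xab yab; have [xy|yx|->//] := ltgtP x y; first exact: H.
  by apply/esym; exact: H.
move=> /andP[ax xb] /andP[ay yb] xy.
have [||c _] := @MVT R f (fun=> 0) x y xy.
- by move=> t; rewrite in_itv/= => /andP[xt ty]; apply: f0; lra.
- apply: continuous_in_subspaceT => t; rewrite inE/= in_itv/= => /andP[xt ty].
  by apply: is_derive1_cvg; apply: f0; lra.
by rewrite mul0r => /eqP; rewrite subr_eq0 => /eqP.
Qed.

(** The integrand may blow up at the end points. On the open interval F differs
by a constant from the integral of f from a, whose one-sided limits are known. *)
Lemma FTC_oo (f F : R -> R) (a b la lb : R) : a < b ->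
  mu.-integrable `]a, b[ (EFin \o f) ->
  (forall x, a < x < b -> is_derive x 1 F (f x)) ->
  (forall x, a < x < b -> {for x, continuous f}) ->
  F x @[x --> a^'+] --> la -> F x @[x --> b^'-] --> lb ->
  \int[mu]_(x in `]a, b[) f x = lb - la.
Proof.
move=> ab intf dF cf Fa Fb.
pose g := f \_ `]a, b[.
have gE x : a < x < b -> g x = f x.
  by move=> xab; rewrite /g patchE mem_set//= in_itv/=.
have intg : mu.-integrable `[a, b] (EFin \o g).
  rewrite /g -restrict_EFin; apply/integrable_restrict => //=.
  rewrite (_ : _ `&` _ = `]a, b[%classic)//.
  rewrite setIC setIidl//; exact: subset_itv_oo_cc.
pose G x := \int[mu]_(t in `[a, x]) g t.
have GbE : G b = \int[mu]_(x in `]a, b[) f x.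
  rewrite /G Rintegral_mkcond [RHS]Rintegral_mkcond.
  apply: eq_Rintegral => x _; rewrite /g !patchE.
  have [xI|xI] := boolP (x \in `]a, b[%classic).
    by rewrite mem_set//; apply: subset_itv_oo_cc; exact: set_mem.
  by case: ifP.
have dG x : a < x < b -> is_derive x 1 G (f x).
  move=> /[dup] xab /andP[ax xb].
  have cg : {for x, continuous g}.
    have e : {near x, f =1 g}.
      near=> t; rewrite gE//; apply/andP; split; near: t.
        exact: (cvgr_gt x).
      exact: (cvgr_lt x).
    rewrite /prop_for /continuous_at gE//.
    apply: cvg_trans (cf _ xab); apply: near_eq_cvg.
    by apply: filterS e => t ->.
  have [dd dv] := continuous_FTC1_closed xb intg ax cg.
  apply: DeriveDef => //; rewrite -derive1E.
  by rewrite dv gE.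
have dH x : a < x < b -> is_derive x 1 (fun x => F x + - G x) 0.
  move=> xab; apply: is_derive1_eq (is_derive1_add (dF x xab)
    (is_derive1_opp (dG x xab))) _.
  by rewrite subrr.
have cH := is_derive0_const_oo dH.
pose m := (a + b) / 2; have mab : a < m < b by rewrite /m midf_lt //= midf_lt.
have FE x : a < x < b -> F m - G m + G x = F x.
  by move=> xab; rewrite (cH m x mab xab) subrK.
have Ga : G x @[x --> a^'+] --> 0.
  by apply: cvg_at_right_filter; exact: parameterized_integral_cvg_left intg.
have Gb : G x @[x --> b^'-] --> G b.
  exact: parameterized_integral_cvg_at_left intg.
have e1 : la = F m - G m + 0.
  apply: (@cvg_unique _ (@Rhausdorff R) (F x @[x --> a^'+])) => //.
  apply: cvg_trans (cvgD (cvg_cst (F m - G m)) Ga).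
  apply: near_eq_cvg; near=> x.
  have xab : a < x < b.
    by apply/andP; split; near: x; [exact: nbhs_right_gt|exact: nbhs_right_lt].
  by rewrite -(FE x xab).
have e2 : lb = F m - G m + G b.
  apply: (@cvg_unique _ (@Rhausdorff R) (F x @[x --> b^'-])) => //.
  apply: cvg_trans (cvgD (cvg_cst (F m - G m)) Gb).
  apply: near_eq_cvg; near=> x.
  have xab : a < x < b.
    by apply/andP; split; near: x; [exact: nbhs_left_gt|exact: nbhs_left_lt].
  by rewrite -(FE x xab).
by rewrite -GbE e1 e2; ring.
Unshelve. all: by end_near. Qed.

End improper_FTC.

Section complex_integral.
Context {R : realType}.
Local Notation mu := (@lebesgue_measure R).
Local Notation I := (`]-1, 1[%classic : set R).
Implicit Types (f g : R -> R[i]) (x t : R) (c : R[i]) (rho : R -> R).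

(** Everything below is integrated over the open interval ]-1, 1[, where the
weights and the kernel are smooth. *)
Definition cintegrable f :=
  mu.-integrable I (EFin \o (fun x => Re (f x))) /\
  mu.-integrable I (EFin \o (fun x => Im (f x))).

Definition cint f : R[i] :=
  (\int[mu]_(x in I) Re (f x)) +i* (\int[mu]_(x in I) Im (f x)).

Definition ccont f :=
  forall x, -1 < x < 1 -> {for x, continuous (fun x => Re (f x))} /\
                          {for x, continuous (fun x => Im (f x))}.

Lemma integrable_add (f g : R -> R) : mu.-integrable I (EFin \o f) ->
  mu.-integrable I (EFin \o g) ->
  mu.-integrable I (EFin \o (fun x => f x + g x)).
Proof.
move=> fi gi; have mI : measurable (I : set (measurableTypeR R)) by [].
by have := integrableD mI fi gi; exact: eq_integrable.
Qed.

Lemma integrable_scale (f : R -> R) (k : R) : mu.-integrable I (EFin \o f) ->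
  mu.-integrable I (EFin \o (fun x => k * f x)).
Proof.
move=> fi; have mI : measurable (I : set (measurableTypeR R)) by [].
by have := integrableZl mI k fi; exact: eq_integrable.
Qed.

Lemma integrable_eq_oo (f g : R -> R) : (forall x, -1 < x < 1 -> f x = g x) ->
  mu.-integrable I (EFin \o f) -> mu.-integrable I (EFin \o g).
Proof.
move=> fg; apply: eq_integrable => // x; rewrite inE/= in_itv/= => xI.
by rewrite fg.
Qed.

Lemma eq_cint f g : (forall x, -1 < x < 1 -> f x = g x) -> cint f = cint g.
Proof.
by move=> fg; apply: complex_ext; apply: eq_Rintegral => x;
  rewrite inE/= in_itv/= => xI; rewrite fg.
Qed.

Lemma eq_cintegrable f g : (forall x, -1 < x < 1 -> f x = g x) ->
  cintegrable f -> cintegrable g.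
Proof.
by move=> fg [f1 f2]; split; [move: f1|move: f2]; apply: eq_integrable => // x;
  rewrite inE/= in_itv/= => xI; rewrite fg.
Qed.

Lemma cintegrableD f g : cintegrable f -> cintegrable g ->
  cintegrable (fun x => f x + g x).
Proof.
move=> [f1 f2] [g1 g2]; split.
  by apply: integrable_eq_oo (integrable_add f1 g1) => x _; rewrite ReD.
by apply: integrable_eq_oo (integrable_add f2 g2) => x _; rewrite ImD.
Qed.

Lemma cintD f g : cintegrable f -> cintegrable g ->
  cint (fun x => f x + g x) = cint f + cint g.
Proof.
move=> [f1 f2] [g1 g2]; apply: complex_ext; rewrite ?ReD ?ImD /cint/=.
  by rewrite -RintegralD//; apply: eq_Rintegral => x _; rewrite ReD.
by rewrite -RintegralD//; apply: eq_Rintegral => x _; rewrite ImD.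
Qed.

Lemma cintegrableZ f c : cintegrable f -> cintegrable (fun x => c * f x).
Proof.
move=> [f1 f2]; split.
  apply: integrable_eq_oo (integrable_add (integrable_scale (Re c) f1)
    (integrable_scale (- Im c) f2)) => x _.
  by rewrite ReM mulNr.
apply: integrable_eq_oo (integrable_add (integrable_scale (Re c) f2)
    (integrable_scale (Im c) f1)) => x _.
by rewrite ImM.
Qed.

Lemma cintZ f c : cintegrable f -> cint (fun x => c * f x) = c * cint f.
Proof.
move=> [f1 f2]; apply: complex_ext; rewrite ?ReM ?ImM /cint/= -!RintegralZl//.
  rewrite -RintegralB; [|by []|exact: integrable_scale|exact: integrable_scale].
  by apply: eq_Rintegral => x _; rewrite ReM.
rewrite -RintegralD; [|by []|exact: integrable_scale|exact: integrable_scale].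
by apply: eq_Rintegral => x _; rewrite ImM.
Qed.

Lemma is_cderive_ccont f (f' : R -> R[i]) :
  (forall x, -1 < x < 1 -> is_cderive f x (f' x)) -> ccont f.
Proof.
move=> h x xI; have [h1 h2] := h x xI.
by split; [exact: is_derive1_cvg h1|exact: is_derive1_cvg h2].
Qed.

Lemma for_continuous_eq (k l : R -> R) x : (forall y, k y = l y) ->
  {for x, continuous k} -> {for x, continuous l}.
Proof. by move=> /funext ->. Qed.

Lemma ccontM f g : ccont f -> ccont g -> ccont (fun x => f x * g x).
Proof.
move=> cf cg x xI; have [f1 f2] := cf x xI; have [g1 g2] := cg x xI; split.
  by apply: for_continuous_eq (cvgB (cvgM f1 g1) (cvgM f2 g2)) => y; rewrite ReM.
by apply: for_continuous_eq (cvgD (cvgM f1 g2) (cvgM f2 g1)) => y; rewrite ImM.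
Qed.

Lemma ccontD f g : ccont f -> ccont g -> ccont (fun x => f x + g x).
Proof.
move=> cf cg x xI; have [f1 f2] := cf x xI; have [g1 g2] := cg x xI; split.
  by apply: for_continuous_eq (cvgD f1 g1) => y; rewrite ReD.
by apply: for_continuous_eq (cvgD f2 g2) => y; rewrite ImD.
Qed.

Lemma ccont_real rho : (forall x, -1 < x < 1 -> {for x, continuous rho}) ->
  ccont (fun x => (rho x)%:C).
Proof. by move=> h x xI; split; [exact: h|exact: cvg_cst]. Qed.

Lemma ccont_measurable f : ccont f ->
  measurable_fun I (fun x => Re (f x)) /\ measurable_fun I (fun x => Im (f x)).
Proof.
move=> cf; by split; apply: open_continuous_measurable_fun => // x;
  rewrite inE/= in_itv/= => /cf[].
Qed.

(** The singular factor is kept apart as a real weight rho, because the other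
factor of every integrand in use is bounded. *)
Lemma cintegrable_bounded rho f (M : R) :
  (forall x, 0 <= rho x) -> mu.-integrable I (EFin \o rho) ->
  (forall x, -1 < x < 1 -> {for x, continuous rho}) ->
  ccont f -> (forall x, -1 < x < 1 -> normc (f x) <= M) ->
  cintegrable (fun x => (rho x)%:C * f x).
Proof.
move=> r0 ri rc fc fM.
have [m1 m2] := ccont_measurable (ccontM (ccont_real rc) fc).
have ri' := integrable_scale M ri.
split; apply: (le_integrable _ _ _ ri') => //.
- exact/measurable_EFinP.
- move=> x; rewrite /= in_itv/= => xI; rewrite lee_fin ReM/= mul0r subr0.
  rewrite !normrM mulrC ler_wpM2r// (le_trans (ler_Re_normc _))//.
  by rewrite (le_trans (fM _ xI))// ler_norm.
- exact/measurable_EFinP.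
- move=> x; rewrite /= in_itv/= => xI; rewrite lee_fin ImM/= mul0r addr0.
  rewrite !normrM mulrC ler_wpM2r// (le_trans (ler_Im_normc _))//.
  by rewrite (le_trans (fM _ xI))// ler_norm.
Qed.

(** The boundary terms of the fundamental theorem vanish: B dominates the primitive
and tends to 0 at both ends. *)
Lemma cint_FTC0 (F f : R -> R[i]) (B : R -> R) : cintegrable f -> ccont f ->
  (forall x, -1 < x < 1 -> is_cderive F x (f x)) ->
  (forall x, -1 < x < 1 -> normc (F x) <= B x) ->
  B x @[x --> (-1)^'+] --> 0 -> B x @[x --> 1^'-] --> 0 ->
  cint f = 0.
Proof.
move=> [f1 f2] fc dF FB Ba Bb.
have lt11 : (-1 : R) < 1 by lra.
have sq (H : R -> R) : (forall x, -1 < x < 1 -> `|H x| <= B x) ->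
    H x @[x --> (-1)^'+] --> 0 /\ H x @[x --> 1^'-] --> 0.
  move=> HB; split.
    apply: (@squeeze_cvgr _ _ _ _ (fun x => - B x) B) => //.
      near=> x; rewrite -ler_norml; apply: HB; apply/andP; split; near: x.
        exact: nbhs_right_gt.
      exact: nbhs_right_lt.
    by rewrite -oppr0; exact: cvgN.
  apply: (@squeeze_cvgr _ _ _ _ (fun x => - B x) B) => //.
    near=> x; rewrite -ler_norml; apply: HB; apply/andP; split; near: x.
      exact: nbhs_left_gt.
    exact: nbhs_left_lt.
  by rewrite -oppr0; exact: cvgN.
have [r1 r2] : (fun x => Re (F x)) x @[x --> (-1)^'+] --> 0 /\
               (fun x => Re (F x)) x @[x --> 1^'-] --> 0.
  by apply: sq => x xI; exact: le_trans (ler_Re_normc _) (FB _ xI).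
have [i1 i2] : (fun x => Im (F x)) x @[x --> (-1)^'+] --> 0 /\
               (fun x => Im (F x)) x @[x --> 1^'-] --> 0.
  by apply: sq => x xI; exact: le_trans (ler_Im_normc _) (FB _ xI).
apply: complex_ext; rewrite /cint/=.
  rewrite (FTC_oo (la := 0) (lb := 0) lt11 f1 _ _ r1 r2) ?subr0// => x xI.
    by have [] := dF x xI.
  by have [] := fc x xI.
rewrite (FTC_oo (la := 0) (lb := 0) lt11 f2 _ _ i1 i2) ?subr0// => x xI.
  by have [] := dF x xI.
by have [] := fc x xI.
Unshelve. all: by end_near. Qed.

(** Differentiation under the integral sign, dominated by M1 * rho; it is the
real theorem applied to the real and imaginary parts. *)
Lemma is_cderive_cint rho (h h1 : R -> R -> R[i]) (M M1 u v a : R) :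
  (forall x, 0 <= rho x) -> mu.-integrable I (EFin \o rho) ->
  (forall x, -1 < x < 1 -> {for x, continuous rho}) ->
  (forall t, u < t < v -> ccont (h t)) ->
  (forall t x, u < t < v -> -1 < x < 1 -> normc (h t x) <= M) ->
  (forall t x, u < t < v -> -1 < x < 1 -> is_cderive (h^~ x) t (h1 t x)) ->
  (forall t x, u < t < v -> -1 < x < 1 -> normc (h1 t x) <= M1) ->
  u < a < v ->
  is_cderive (fun t => cint (fun x => (rho x)%:C * h t x)) a
    (cint (fun x => (rho x)%:C * h1 a x)).
Proof.
move=> r0 ri rc hc hM hd h1M auv.
have M10 : 0 <= M1.
  by apply: le_trans (normc_ge0 (h1 a 0)) (h1M _ _ auv _); lra.
have hI t : u < t < v -> cintegrable (fun x => (rho x)%:C * h t x).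
  by move=> tuv; apply: (cintegrable_bounded (M := M)) => //;
    [exact: hc|move=> x; exact: hM].
have main (k k1 : R -> R -> R) :
    (forall t, u < t < v -> mu.-integrable I (EFin \o (fun x => rho x * k t x))) ->
    (forall t x, u < t < v -> -1 < x < 1 -> is_derive t 1 (k^~ x) (k1 t x)) ->
    (forall t x, u < t < v -> -1 < x < 1 -> `|k1 t x| <= M1) ->
    is_derive a 1 (fun t => \int[mu]_(x in I) (rho x * k t x))
      (\int[mu]_(x in I) (rho x * k1 a x)).
  move=> ki kd k1M.
  have dk (t x : R) : u < t < v -> -1 < x < 1 ->
      is_derive t 1 (fun t => rho x * k t x) (rho x * k1 t x).
    by move=> tuv xI; apply: is_derive1_scale; exact: kd.
  pose f (t x : R) := rho x * k t x.
  have fI t : `]u, v[%classic t -> mu.-integrable I (EFin \o f t).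
    by rewrite /= in_itv/= => tuv; exact: ki.
  have fd t y : `]u, v[%classic t -> I y -> derivable (f^~ y) t 1.
    by rewrite /= !in_itv/= => tuv yI; apply: ex_derive; exact: dk.
  have fE (t y : R) : u < t < v -> -1 < y < 1 -> partial1of2 f t y = rho y * k1 t y.
    by move=> tuv yI; rewrite partial1of2E; apply: derive_val; exact: dk.
  pose G y := M1 * rho y.
  have G0 y : 0 <= G y by rewrite mulr_ge0.
  have GI : mu.-integrable I (EFin \o G).
    exact: integrable_scale.
  have fG t y : `]u, v[%classic t -> I y -> `|partial1of2 f t y| <= G y.
    rewrite /= !in_itv/= => tuv yI; rewrite fE// normrM (ger0_norm (r0 y)).
    by rewrite mulrC ler_wpM2r// k1M.
  have aI : `]u, v[%classic a by rewrite /= in_itv.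
  have mI : measurable (I : set (measurableTypeR R)) by [].
  have dd := derivable_under_integral mI aI fI fd G0 GI fG.
  have de := differentiation_under_integral mI aI fI fd G0 GI fG.
  apply: DeriveDef => //; rewrite -derive1E de.
  by apply: eq_Rintegral => x; rewrite inE/= in_itv/= => xI; rewrite fE.
split; rewrite /cint/=.
  rewrite (_ : \int[mu]_(x in I) _ = \int[mu]_(x in I) (rho x * Re (h1 a x))); last first.
    by apply: eq_Rintegral => x _; rewrite ReM/= mul0r subr0.
  rewrite (_ : (fun _ => _) = fun t => \int[mu]_(x in I) (rho x * Re (h t x))); last first.
    by apply/funext => t; apply: eq_Rintegral => x _; rewrite ReM/= mul0r subr0.
  apply: (main (fun t x => Re (h t x)) (fun t x => Re (h1 t x))).
  - move=> t tuv; have [+ _] := hI t tuv; apply: eq_integrable => // x _.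
    by rewrite /= ReM/= mul0r subr0.
  - by move=> t x tuv xI; have [] := hd t x tuv xI.
  - by move=> t x tuv xI; exact: le_trans (ler_Re_normc _) (h1M _ _ tuv xI).
rewrite (_ : \int[mu]_(x in I) _ = \int[mu]_(x in I) (rho x * Im (h1 a x))); last first.
  by apply: eq_Rintegral => x _; rewrite ImM/= mul0r addr0.
rewrite (_ : (fun _ => _) = fun t => \int[mu]_(x in I) (rho x * Im (h t x))); last first.
  by apply/funext => t; apply: eq_Rintegral => x _; rewrite ImM/= mul0r addr0.
apply: (main (fun t x => Im (h t x)) (fun t x => Im (h1 t x))).
- move=> t tuv; have [_ +] := hI t tuv; apply: eq_integrable => // x _.
  by rewrite /= ImM/= mul0r addr0.
- by move=> t x tuv xI; have [] := hd t x tuv xI.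
- by move=> t x tuv xI; exact: le_trans (ler_Im_normc _) (h1M _ _ tuv xI).
Qed.

End complex_integral.

(** * The Gamma integral *)
Section affine_substitution.
Context {R : realType}.
Local Notation mu := (@lebesgue_measure R).
Variables (c d : R).
Hypothesis c0 : 0 < c.

Let phi (x : measurableTypeR R) : measurableTypeR R := c * x + d.

Let mphi : measurable_fun [set: measurableTypeR R] phi.
Proof.
apply: measurable_funD; last exact: measurable_cst.
by apply: measurable_funM => //; exact: measurable_cst.
Qed.

(** The image of the Lebesgue measure by an increasing affine map is a multiple
of the Lebesgue measure, since the two agree on intervals. *)
Lemma ge0_integral_affine (f : R -> \bar R) : measurable_fun [set: R] f ->
  (forall x, 0 <= f x)%E ->
  (\int[mu]_x f x = c%:E * \int[mu]_x f (c * x + d)%R)%E.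
Proof.
move=> mf f0; have c0' : 0 <= c by exact: ltW.
pose nu := mscale (NngNum c0') (pushforward mu phi).
transitivity (\int[nu mphi]_x f x)%E.
  apply: eq_measure_integral => A mA _.
  apply: lebesgue_measure_unique => // X [[u v] /= _ <-].
  rewrite /nu /mscale /pushforward /= lebesgue_measure_itv/=.
  have -> : pushforward mu phi `]u, v] = mu `]((u - d) / c), ((v - d) / c)]%classic.
    rewrite /pushforward; congr (mu _).
    apply/seteqP; split => x /=; rewrite !in_itv/= /phi;
    by rewrite ltr_pdivrMr// ler_pdivlMr// ltrBlDr lerBrDr [x * c]mulrC.
  rewrite lebesgue_measure_itv/= !lte_fin ltr_pM2r ?invr_gt0// ltrD2r.
  case: ifPn => uv; last by rewrite mule0.
  by rewrite -!EFinB -EFinM; congr EFin; field; rewrite gt_eqF.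
rewrite ge0_integral_mscale//; congr (_ * _)%E.
rewrite (@ge0_integral_pushforward _ _ _ _ _ phi)//.
Qed.

End affine_substitution.

Lemma is_derive1_powR {R : realType} (p x : R) : 0 < x ->
  is_derive x 1 (fun x : R => x `^ p) (p * x `^ (p - 1)).
Proof.
move=> x0; have xI : x \in `]0, +oo[ by rewrite in_itv/= x0.
apply: DeriveDef; first exact: derivable_powR.
by rewrite -derive1E powR_derive1.
Qed.

Section gamma_function.
Context {R : realType}.
Local Notation mu := (@lebesgue_measure R).
Implicit Types (a b s x y : R).

(** Extended by 0 to the whole line, so that integrals can be translated and
exchanged without following the domain. *)
Definition gamma_kernel a : R -> R :=
  (fun x => x `^ (a - 1) * expR (- x)) \_ `]0, +oo[.

Lemma gamma_kernelE a x : 0 < x -> gamma_kernel a x = x `^ (a - 1) * expR (- x).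
Proof. by move=> x0; rewrite /gamma_kernel patchE mem_set//= in_itv/= x0. Qed.

Lemma gamma_kernel0 a x : x <= 0 -> gamma_kernel a x = 0.
Proof.
move=> x0; rewrite /gamma_kernel patchE memNset//=.
by rewrite in_itv/= andbT; apply/negP; rewrite -leNgt.
Qed.

Lemma gamma_kernel_ge0 a x : 0 <= gamma_kernel a x.
Proof.
have [x0|x0] := leP x 0; first by rewrite gamma_kernel0.
by rewrite gamma_kernelE// mulr_ge0 ?powR_ge0 ?expR_ge0.
Qed.

Lemma measurable_gamma_kernel a : measurable_fun [set: R] (gamma_kernel a).
Proof.
apply/measurable_restrict => //; apply: measurable_funTS.
apply: measurable_funM; first exact: measurable_powR.
by apply: measurableT_comp; [exact: measurable_expR|exact: oppr_measurable].
Qed.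

(** The Gamma integral before it is known to be finite, as needed for
Tonelli. *)
Definition Gammae a : \bar R := (\int[mu]_x (gamma_kernel a x)%:E)%E.

Lemma fine_Gammae a : Gamma_fun a = fine (Gammae a).
Proof.
rewrite /Gamma_fun /Rintegral /Gammae integral_mkcond; congr fine.
by apply: eq_integral => x _; rewrite /gamma_kernel !patchE; case: ifP.
Qed.

Lemma Gammae_gt0 a : (0 < Gammae a)%E.
Proof.
pose m := expR (- `|a - 1| - 2).
apply: (@lt_le_trans _ _ (\int[mu]_(x in `[1%R, 2%R]) m%:E)%E).
  rewrite integral_cst//= lebesgue_measure_itv/= lte_fin ltr1n -EFinB -EFinM.
  by rewrite lte_fin mulr_gt0 ?expR_gt0//; lra.
apply: (@le_trans _ _ (\int[mu]_(x in `[1%R, 2%R]) (gamma_kernel a x)%:E)%E).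
  apply: ge0_le_integral => //.
  - by move=> x _; rewrite lee_fin expR_ge0.
  - by apply/measurable_EFinP/measurable_funTS; exact: measurable_gamma_kernel.
  - move=> x /=; rewrite in_itv/= => /andP[x1 x2].
    have x0 : 0 < x by lra.
    rewrite lee_fin gamma_kernelE// /powR gt_eqF// -expRD ler_expR.
    have l0 : 0 <= ln x by rewrite ln_ge0.
    have l1 : ln x <= 1.
      have := @le_ln1Dx R (x - 1); rewrite subrKC; lra.
    have : - `|a - 1| <= (a - 1) * ln x.
      rewrite lerNl; apply: le_trans (ler_norm _) _.
      rewrite normrN normrM ler_piMr// ger0_norm//.
    lra.
apply: ge0_subset_integral => //.
- by apply/measurable_EFinP; exact: measurable_gamma_kernel.
- by move=> x _; rewrite lee_fin gamma_kernel_ge0.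
Qed.

(** On [1/(n+1), 1] the integral is at most 1/a, uniformly in n, by the
primitive x^a / a. *)
Lemma integral_powR_fin a : 0 < a ->
  (\int[mu]_(x in `]0%R, 1%R]) (x `^ (a - 1))%:E < +oo)%E.
Proof.
move=> a0; pose F (n : nat) := `[(n.+1%:R)^-1, 1 : R]%classic.
have mpow : measurable_fun [set: R] (fun x : R => (x `^ (a - 1))%:E).
  by apply/measurable_EFinP; exact: measurable_powR.
have UF : \bigcup_i F i = `]0, 1]%classic.
  apply/seteqP; split => [x [n _]|x]; rewrite /F /= !in_itv/=.
    by move=> /andP[nx ->]; rewrite andbT (lt_le_trans _ nx)// invr_gt0.
  move=> /andP[x0 x1]; exists (Num.truncn x^-1) => //=.
  rewrite in_itv/= x1 andbT -[leRHS]invrK lef_pV2 ?posrE ?invr_gt0//.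
  by apply/ltW; rewrite truncnS_gt.
rewrite -UF; apply: (@le_lt_trans _ _ (a^-1)%:E); last by rewrite ltry.
have F_homo : {homo F : n m / (n <= m)%N >-> (n <= m)%O}.
  move=> n m nm; apply/subsetPset; rewrite /F => x /=; rewrite !in_itv/= => /andP[h ->].
  by rewrite andbT (le_trans _ h)// lef_pV2 ?posrE// ler_nat ltnS.
have := @ge0_nondecreasing_set_cvg_integral _ (measurableTypeR R) R F
  (fun x => (x `^ (a - 1))%:E) mu F_homo.
have mF i : measurable (F i : set (measurableTypeR R)) by exact: measurable_itv.
have mfF i : measurable_fun (F i : set (measurableTypeR R)) (fun x : R => (x `^ (a - 1))%:E).
  exact: measurable_funTS.
have f0 (i : nat) (x : R) : F i x -> (0%R <= (x `^ (a - 1))%:E)%E.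
  by move=> _; rewrite lee_fin powR_ge0.
move=> /(_ mF mfF f0) cv.
rewrite -(cvg_lim _ cv)//; apply: lime_le; first by apply/cvg_ex; eexists; exact: cv.
near=> n.
have e0 : 0 < n.+1%:R^-1 :> R by rewrite invr_gt0.
have [e1|e1] := ltP (n.+1%:R^-1 : R) 1; last first.
  move: e1; rewrite le_eqVlt => /predU1P[e1|e1].
    by rewrite /F -e1 set_itv1 integral_set1 lee_fin invr_ge0 ltW.
  by rewrite /F set_itv_ge ?bnd_simp -?ltNge// integral_set0 lee_fin invr_ge0 ltW.
have dp (x : R) : 0 < x -> is_derive x 1 (fun x : R => a^-1 * x `^ a) (x `^ (a - 1)).
  move=> x0; apply: is_derive1_eq (is_derive1_scale a^-1 (is_derive1_powR a x0)) _.
  by rewrite mulrA mulVf ?mul1r// gt_eqF.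
rewrite (@continuous_FTC2 _ _ (fun x : R => a^-1 * x `^ a))//.
- rewrite -EFinB lee_fin powR1 mulr1 gerBl mulr_ge0 ?powR_ge0//.
  by rewrite invr_ge0 ltW.
- apply: continuous_in_subspaceT => x; rewrite inE/= in_itv/= => /andP[ex _].
  apply: is_derive1_cvg; apply: is_derive1_powR; exact: lt_le_trans ex.
- split.
  + by move=> x; rewrite in_itv/= => /andP[ex _]; apply: ex_derive; apply: dp; exact: lt_trans ex.
  + exact: (cvg_at_right_filter (is_derive1_cvg (dp _ e0))).
  + exact: (cvg_at_left_filter (is_derive1_cvg (dp _ ltr01))).
- move=> x; rewrite in_itv/= => /andP[ex _]; rewrite derive1E.
  by apply: derive_val; apply: dp; exact: lt_trans ex.
Unshelve. all: by end_near. Qed.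

(** Near 0 the power dominates. On x > 1 the bound x^(a-1) <= C exp (x / 2) follows
from ln x <= x / m + |ln m| with m = 2 (|a - 1| + 1). *)
Lemma gamma_kernel_dominated a : exists C : R, 0 <= C /\ forall x,
  gamma_kernel a x <= ((fun x => x `^ (a - 1)) \_ `]0, 1]) x +
    C * exponential_pdf (2^-1) x.
Proof.
pose k := `|a - 1|; have k0 : 0 <= k by exact: normr_ge0.
pose m := 2 * (k + 1); have m0 : 0 < m by rewrite /m; lra.
exists (2 * expR (k * `|ln m|)); split; first by rewrite mulr_ge0 ?expR_ge0.
move=> x; have [x0|x0] := leP x 0.
  rewrite gamma_kernel0// addr_ge0//.
    by apply: restrict_ge0 => y _; exact: powR_ge0.
  by rewrite mulr_ge0 ?mulr_ge0 ?expR_ge0 ?exponential_pdf_ge0.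
have e0 : 0 <= exponential_pdf 2^-1 x by apply: exponential_pdf_ge0; lra.
have [x1|x1] := leP x 1.
  rewrite [X in _ <= X + _]patchE mem_set/=; last by rewrite in_itv/= x0.
  rewrite gamma_kernelE// ler_wpDr ?mulr_ge0 ?expR_ge0//.
  by rewrite ler_piMr ?powR_ge0// -expR0 ler_expR; lra.
rewrite [X in _ <= X + _]patchE memNset/=; last first.
  by rewrite in_itv/= => /andP[_]; rewrite leNgt x1.
rewrite add0r /exponential_pdf patchE mem_set/=; last by rewrite in_itv/= andbT ltW.
rewrite gamma_kernelE// mulrACA mulfV// mul1r -expRD.
rewrite /powR gt_eqF// -expRD ler_expR.
have l1 : ln x <= x / m + `|ln m|.
  have -> : ln x = ln (x / m) + ln m.
    by rewrite -lnM ?posrE ?divr_gt0// divfK// gt_eqF.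
  have := @le_ln1Dx R (x / m - 1); rewrite subrKC => h.
  have : ln (x / m) <= x / m - 1 by apply: h; have := divr_gt0 x0 m0; lra.
  have := ler_norm (ln m); lra.
have l0 : 0 <= ln x by rewrite ln_ge0// ltW.
have h1 : (a - 1) * ln x <= k * ln x by rewrite ler_wpM2r// ler_norm.
have h2 : k * ln x <= k * (x / m + `|ln m|) by rewrite ler_wpM2l.
have h3 : k * (x / m) <= x / 2.
  rewrite mulrA ler_pdivrMr// /m; nra.
rewrite mulrDr in h2; lra.
Qed.

Lemma Gammae_lty a : 0 < a -> (Gammae a < +oo)%E.
Proof.
move=> a0; have [C [C0 CP]] := gamma_kernel_dominated a.
pose h1 : R -> R := (fun x => x `^ (a - 1)) \_ `]0, 1].
have mh1 : measurable_fun [set: R] h1.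
  by apply/measurable_restrict => //; apply: measurable_funTS; exact: measurable_powR.
have mexp : measurable_fun [set: R] (exponential_pdf (2^-1 : R)).
  exact: measurable_exponential_pdf.
have e0 x : 0 <= exponential_pdf (2^-1 : R) x by apply: exponential_pdf_ge0; lra.
have h10 x : 0 <= h1 x by apply: restrict_ge0 => y _; exact: powR_ge0.
apply: (@le_lt_trans _ _
  (\int[mu]_x ((h1 x)%:E + C%:E * (exponential_pdf (2^-1) x)%:E))%E).
  apply: ge0_le_integral => //.
  - by move=> x _; rewrite lee_fin gamma_kernel_ge0.
  - by apply/measurable_EFinP; exact: measurable_gamma_kernel.
  - apply/measurable_EFinP; apply: measurable_funD => //.
    by apply: measurable_funM => //; exact: measurable_cst.
  - by move=> x _; rewrite -EFinM -EFinD lee_fin; exact: CP.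
rewrite ge0_integralD//; last 4 first.
- by move=> x _; rewrite lee_fin.
- exact/measurable_EFinP.
- by move=> x _; rewrite -EFinM lee_fin mulr_ge0.
- by apply/measurable_EFinP; apply: measurable_funM => //; exact: measurable_cst.
rewrite ge0_integralZl_EFin//; last 2 first.
- by move=> x _; rewrite lee_fin.
- exact/measurable_EFinP.
rewrite integral_exponential_pdf ?invr_gt0// mule1 lte_add_pinfty ?ltry//.
have e : (\int[mu]_(x in `]0%R, 1%R]) (x `^ (a - 1))%:E = \int[mu]_x (h1 x)%:E)%E.
  rewrite integral_mkcond; apply: eq_integral => x _.
  by rewrite /h1 !patchE; case: ifP.
by rewrite -e; exact: integral_powR_fin.
Qed.

End gamma_function.

(** * Jacobi weights and the beta integral *)

Lemma is_derive1_onem {R : realType} (x : R) : is_derive x 1 (fun x => 1 - x) (-1).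
Proof.
apply: is_derive1_eq (is_derive1_add (is_derive_cst (1 : R) x 1)
  (is_derive1_opp (is_derive_id x (1 : R)))) _.
by rewrite add0r.
Qed.

Lemma is_derive1_onep {R : realType} (x : R) : is_derive x 1 (fun x => 1 + x) 1.
Proof.
apply: is_derive1_eq (is_derive1_add (is_derive_cst (1 : R) x 1)
  (is_derive_id x (1 : R))) _.
by rewrite add0r.
Qed.

Section jacobi_weight.
Context {R : realType}.
Local Notation mu := (@lebesgue_measure R).
Local Notation I := (`]-1, 1[%classic : set R).
Implicit Types (a b p q s x y : R).

Definition jacobi_weight p q x : R := (1 - x) `^ p * (1 + x) `^ q.
Local Notation W := jacobi_weight.

Lemma jacobi_weight_ge0 p q x : 0 <= W p q x.
Proof. by rewrite mulr_ge0 ?powR_ge0. Qed.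

Lemma measurable_jacobi_weight p q : measurable_fun [set: R] (W p q).
Proof.
apply: measurable_funM.
  apply: (measurableT_comp (measurable_powR p)); exact: measurable_funB.
apply: (measurableT_comp (measurable_powR q)); exact: measurable_funD.
Qed.

Lemma jacobi_weightSl p q x : -1 < x < 1 -> W (p + 1) q x = (1 - x) * W p q x.
Proof.
move=> /andP[x1 x2]; rewrite /W powRD; last by apply/implyP => _; lra.
rewrite powRr1; last by lra.
by ring.
Qed.

Lemma jacobi_weightSr p q x : -1 < x < 1 -> W p (q + 1) x = (1 + x) * W p q x.
Proof.
move=> /andP[x1 x2]; rewrite /W powRD; last by apply/implyP => _; lra.
rewrite powRr1; last by lra.
by ring.
Qed.

(** The derivative is kept as a multiple of the weight with both exponents
lowered, the form in which integration by parts uses it. *)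
Lemma is_derive_jacobi_weight p q x : -1 < x < 1 ->
  is_derive x 1 (W (p + 1) (q + 1))
    (W p q x * ((q + 1) * (1 - x) - (p + 1) * (1 + x))).
Proof.
move=> /[dup] xI /andP[x1 x2].
have d1 := is_derive1_onem x.
have d2 := is_derive1_onep x.
have e1 := is_derive1_chain (g := fun x => 1 - x)
  (@is_derive1_powR R (p + 1) (1 - x) ltac:(lra)) d1.
have e2 := is_derive1_chain (g := fun x => 1 + x)
  (@is_derive1_powR R (q + 1) (1 + x) ltac:(lra)) d2.
apply: is_derive1_eq (is_derive1_mul e1 e2) _.
rewrite !addrK /W (powRD (x := 1 - x)); last by apply/implyP => _; lra.
rewrite (powRD (x := 1 + x)); last by apply/implyP => _; lra.
rewrite !powRr1; [ring|lra|lra].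
Qed.

Lemma continuous_jacobi_weight p q x : -1 < x < 1 ->
  {for x, continuous (W p q)}.
Proof.
move=> xI; have := is_derive_jacobi_weight (p - 1) (q - 1) xI.
by rewrite !subrK; exact: is_derive1_cvg.
Qed.

(** The substitution x = y (1 + v) / 2 in the convolution of two Gamma kernels
produces these powers of y / 2. *)
Lemma powR_halves a b y (e : R) : 0 < y ->
  y / 2 * ((y / 2) `^ (a - 1) * (y / 2) `^ (b - 1) * e) =
  2 `^ (1 - a - b) * (y `^ (a + b - 1) * e).
Proof.
move=> y0; have y2 : 0 < y / 2 by rewrite divr_gt0.
have ye : y = 2 * (y / 2) by field.
have -> : y `^ (a + b - 1) = 2 `^ (a + b - 1) * (y / 2) `^ (a + b - 1).
  by rewrite {1}ye powRM//; lra.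
have t1 : y / 2 = (y / 2) `^ 1 by rewrite powRr1// ltW.
have t2 : 2 `^ (1 - a - b) * 2 `^ (a + b - 1) = 1 :> R.
  rewrite -powRD; last by apply/implyP => _; lra.
  by rewrite (_ : _ + _ = 0) ?powRr0//; ring.
have t3 : (y / 2) `^ 1 * (y / 2) `^ (a - 1) * (y / 2) `^ (b - 1) =
    (y / 2) `^ (a + b - 1).
  rewrite -!powRD; [|by apply/implyP => _; lra|by apply/implyP => _; lra].
  by congr powR; ring.
rewrite -t3 -t1.
transitivity ((2 `^ (1 - a - b) * 2 `^ (a + b - 1)) *
  (y / 2 * (y / 2) `^ (a - 1) * (y / 2) `^ (b - 1)) * e); last by ring.
by rewrite t2; ring.
Qed.

Lemma integral_gamma_kernelZ a (k : \bar R) : (0 <= k)%E ->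
  (\int[mu]_x (k * (gamma_kernel a x)%:E) = k * Gammae a)%E.
Proof.
move=> k0; rewrite /Gammae ge0_integralZl//.
  by apply/measurable_EFinP; exact: measurable_gamma_kernel.
by move=> x _; rewrite lee_fin gamma_kernel_ge0.
Qed.

(** Exchange the order of integration in the double integral of
gamma_kernel a x * gamma_kernel b (y - x). In one order it is the product of the
two Gamma integrals; in the other the inner integral, after x = y (1 + v) / 2, is
the beta integral times the Gamma kernel of a + b. It is an identity of
extended reals, from which the finiteness of the beta integral is deduced. *)
Lemma gamma_beta_tonelli a b : (Gammae a * Gammae b =
  (2 `^ (1 - a - b))%:E * (\int[mu]_(x in I) (W (b - 1) (a - 1) x)%:E) *
    Gammae (a + b))%E.
Proof.
set B := (\int[mu]_(x in I) _)%E.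
have B0 : (0 <= B)%E by apply: integral_ge0 => x _; rewrite lee_fin jacobi_weight_ge0.
have mg s : measurable_fun [set: R] (fun x => (gamma_kernel s x)%:E).
  by apply/measurable_EFinP; exact: measurable_gamma_kernel.
have G0 s : (0 <= Gammae s)%E by exact/ltW/Gammae_gt0.
pose f (z : measurableTypeR R * measurableTypeR R) : \bar R :=
  (gamma_kernel a z.1 * gamma_kernel b (z.2 - z.1))%:E.
have mf : measurable_fun setT f.
  apply/measurable_EFinP; apply: measurable_funM.
    by apply: measurableT_comp; [exact: measurable_gamma_kernel|exact: measurable_fst].
  apply: measurableT_comp; first exact: measurable_gamma_kernel.
  by apply: measurable_funB; [exact: measurable_snd|exact: measurable_fst].
have f0 z : (0 <= f z)%E by rewrite lee_fin mulr_ge0 ?gamma_kernel_ge0.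
have := @fubini_tonelli _ _ _ _ _ mu mu f mf f0.
have -> : (\int[mu]_x \int[mu]_y f (x, y) = Gammae a * Gammae b)%E.
  transitivity (\int[mu]_x (Gammae b * (gamma_kernel a x)%:E))%E.
    apply: eq_integral => x _; rewrite /f /=.
    under eq_integral do rewrite EFinM.
    rewrite ge0_integralZl_EFin//; last 3 first.
    - by move=> y _; rewrite lee_fin gamma_kernel_ge0.
    - apply/measurable_EFinP; apply: measurableT_comp.
        exact: measurable_gamma_kernel.
      exact: measurable_funB.
    - exact: gamma_kernel_ge0.
    rewrite [RHS]muleC; congr (_ * _)%E.
    rewrite [RHS](@ge0_integral_affine _ 1 (- x) ltr01)//; last first.
      by move=> y; rewrite lee_fin gamma_kernel_ge0.
    by rewrite mul1e; apply: eq_integral => y _; rewrite mul1r.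
  exact: etrans (integral_gamma_kernelZ a (G0 b)) (muleC _ _).
move=> ->.
transitivity (\int[mu]_y ((2 `^ (1 - a - b))%:E * B * (gamma_kernel (a + b) y)%:E))%E.
  apply: eq_integral => y _; rewrite /f /=.
  have [y0|y0] := leP y 0.
    rewrite gamma_kernel0// mule0 integral0_eq// => x _.
    have [x0|x0] := leP x 0; first by rewrite gamma_kernel0// mul0r.
    by rewrite (@gamma_kernel0 _ b) ?mulr0//; lra.
  pose F x := (gamma_kernel a x * gamma_kernel b (y - x))%:E.
  have mF : measurable_fun [set: R] F.
    apply/measurable_EFinP; apply: measurable_funM.
      exact: measurable_gamma_kernel.
    apply: measurableT_comp; first exact: measurable_gamma_kernel.
    exact: measurable_funB.
  have F0 x : (0 <= F x)%E by rewrite lee_fin mulr_ge0 ?gamma_kernel_ge0.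
  have y2 : 0 < y / 2 by rewrite divr_gt0.
  rewrite -/(F _) (ge0_integral_affine (y / 2) y2 mF F0).
  pose K := (y / 2) `^ (a - 1) * (y / 2) `^ (b - 1) * expR (- y).
  have K0 : 0 <= K by rewrite !mulr_ge0 ?powR_ge0 ?expR_ge0.
  have -> : (\int[mu]_x F (y / 2 * x + y / 2)%R = K%:E * B)%E.
    rewrite /B -ge0_integralZl_EFin//; last 2 first.
    - by move=> x _; rewrite lee_fin jacobi_weight_ge0.
    - apply/measurable_EFinP/measurable_funTS; exact: measurable_jacobi_weight.
    rewrite [RHS]integral_mkcond; apply: eq_integral => v _.
    rewrite patchE; case: ifPn => [/set_mem|/negP vI].
      rewrite /= in_itv/= => /andP[v1 v2].
      have e1 : y / 2 * v + y / 2 = y / 2 * (1 + v) by ring.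
      have e2 : y - (y / 2 * v + y / 2) = y / 2 * (1 - v) by field.
      rewrite /F e2 e1 !gamma_kernelE ?mulr_gt0//; [|lra|lra].
      have y20 := ltW y2; have v10 : 0 <= 1 + v by lra.
      have v20 : 0 <= 1 - v by lra.
      rewrite (powRM _ y20 v10) (powRM _ y20 v20).
      have eE : expR (- y) = expR (- (y / 2 * (1 + v))) * expR (- (y / 2 * (1 - v))).
        by rewrite -expRD; congr expR; field.
      rewrite /K /jacobi_weight eE -EFinM; congr EFin.
      move: (expR _) (expR _) (powR _ _) (powR _ _) (powR _ _) (powR _ _) => *.
      ring.
    rewrite /F; have [v1|v1] := leP v (-1).
      rewrite gamma_kernel0 ?mul0r//; nra.
    have [v2|v2] := leP 1 v.
      rewrite (@gamma_kernel0 _ b) ?mulr0//; nra.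
    by exfalso; apply: vI; apply/mem_set; rewrite /= in_itv/= v1 v2.
  rewrite gamma_kernelE// muleA -EFinM [RHS]muleAC -EFinM; congr (_%:E * _)%E.
  by apply: powR_halves.
apply: integral_gamma_kernelZ.
by rewrite mule_ge0// lee_fin powR_ge0.
Qed.

Lemma Gammae_fin_num a : 0 < a -> Gammae a \is a fin_num.
Proof.
by move=> a0; rewrite ge0_fin_numE ?Gammae_lty//; exact/ltW/Gammae_gt0.
Qed.

Lemma GammaeE a : 0 < a -> Gammae a = (Gamma_fun a)%:E.
Proof. by move=> a0; rewrite fine_Gammae fineK// Gammae_fin_num. Qed.

Lemma Gamma_fun_gt0 a : 0 < a -> 0 < Gamma_fun a.
Proof.
move=> a0; rewrite fine_Gammae fine_gt0//.
by rewrite Gammae_gt0 Gammae_lty.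
Qed.

(** The beta integral is a factor of a product that Tonelli shows to be finite,
and the other factors are positive. *)
Lemma integrable_jacobi_weight p q : -1 < p -> -1 < q ->
  mu.-integrable I (EFin \o W p q).
Proof.
move=> p1 q1; apply/integrableP; split.
  by apply/measurable_EFinP/measurable_funTS; exact: measurable_jacobi_weight.
have -> : (\int[mu]_(x in I) `|(EFin \o W p q) x| =
    \int[mu]_(x in I) (W p q x)%:E)%E.
  by apply: eq_integral => x _; rewrite /= ger0_norm ?jacobi_weight_ge0.
have := gamma_beta_tonelli (q + 1) (p + 1); rewrite !addrK.
set B := (\int[mu]_(x in I) _)%E => h.
have B0 : (0 <= B)%E by apply: integral_ge0 => x _; rewrite lee_fin jacobi_weight_ge0.
rewrite ltey; apply/eqP => By; move: h; rewrite By.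
have c0 : 0 < 2 `^ (1 - (q + 1) - (p + 1)) :> R by rewrite powR_gt0.
rewrite gt0_muley ?lte_fin// gt0_mulye ?Gammae_gt0//.
have : (Gammae (q + 1) * Gammae (p + 1))%E \is a fin_num.
  by rewrite fin_numM// Gammae_fin_num//; lra.
by move=> /[swap] ->.
Qed.

Lemma Rintegral_jacobi_weight p q : -1 < p -> -1 < q ->
  Gamma_fun (p + q + 2) * \int[mu]_(x in I) W p q x =
  2 `^ (p + q + 1) * Gamma_fun (p + 1) * Gamma_fun (q + 1).
Proof.
move=> p1 q1.
have t2 : 2 `^ (p + q + 1) * 2 `^ (1 - (q + 1) - (p + 1)) = 1 :> R.
  rewrite -powRD; last by apply/implyP => _; lra.
  by rewrite (_ : _ + _ = 0) ?powRr0//; ring.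
have pq0 : 0 < q + 1 + (p + 1) by lra.
have p0 : 0 < p + 1 by lra.
have q0 : 0 < q + 1 by lra.
have mI : measurable (I : set (measurableTypeR R)) by [].
have BE : (\int[mu]_(x in I) (W p q x)%:E = (\int[mu]_(x in I) W p q x)%:E)%E.
  by rewrite fineK// (integrable_fin_num mI (integrable_jacobi_weight p1 q1)).
have := gamma_beta_tonelli (q + 1) (p + 1).
rewrite !addrK BE (GammaeE pq0) (GammaeE p0) (GammaeE q0).
have -> : q + 1 + (p + 1) = p + q + 2 by ring.
move: (Gamma_fun _) (Gamma_fun (q + 1)) (Gamma_fun _) (\int[mu]_(x in I) _) t2.
move=> g1 g2 g3 B t2 [h].
by rewrite -mulrA [g1 * g3]mulrC h !mulrA t2 mul1r mulrC.
Qed.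

End jacobi_weight.

(** * The Gegenbauer kernel *)
Section kernel.
Context {R : realType}.
Local Notation W := (@jacobi_weight R).
Implicit Types (p q s l x t : R) (w : R[i]).

(** The generating kernel of the Gegenbauer polynomials: gker x w ^ (- l) is the
sum of C_n^(l) (x) w^n. *)
Definition gker x w : R[i] := 1 - 2 * x%:C * w + w ^+ 2.

(** The two roots in w are the points exp (i t), exp (- i t) with x = cos t, hence
of modulus 1; the kernel is bounded away from 0 inside the unit disc. *)
Lemma gker_factor x w : -1 < x < 1 ->
  let e := x +i* Num.sqrt (1 - x ^+ 2) in
  [/\ normc e = 1, normc e^*%C = 1 & gker x w = (w - e) * (w - e^*%C)].
Proof.
move=> /andP[x1 x2] e; have x20 : 0 <= 1 - x ^+ 2.
  by rewrite (_ : _ - _ = (1 - x) * (1 + x)) ?mulr_ge0//; [lra|lra|ring].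
have ss : Num.sqrt (1 - x ^+ 2) ^+ 2 = 1 - x ^+ 2 by rewrite sqr_sqrtr.
split.
- by rewrite normcE2/= ss subrKC sqrtr1.
- by rewrite normcE2/= sqrrN ss subrKC sqrtr1.
- case: w => a b; rewrite /gker /e; apply: complex_ext => /=.
    transitivity (1 - 2 * x * a + a * a - b * b); first by ring.
    transitivity ((a - x) * (a - x) - b * b + Num.sqrt (1 - x ^+ 2) ^+ 2); last by ring.
    by rewrite ss; ring.
  by ring.
Qed.

Lemma normc_gker_ge x w : -1 < x < 1 -> normc w <= 1 ->
  (1 - normc w) ^+ 2 <= normc (gker x w).
Proof.
move=> xI w1; have [e1 e2 ->] := gker_factor w xI.
have h (e : R[i]) : normc e = 1 -> 1 - normc w <= normc (w - e).
  by move=> en; have := ler_normcD w (e - w); rewrite subrKC en normcB; lra.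
by rewrite normcM expr2 ler_pM ?subr_ge0// h.
Qed.

Lemma normc_gker_le x w : -1 < x < 1 -> normc w <= 1 -> normc (gker x w) <= 4.
Proof.
move=> xI w1; have [e1 e2 ->] := gker_factor w xI.
have h (e : R[i]) : normc e = 1 -> normc (w - e) <= 2.
  by move=> en; have := ler_normcD w (- e); rewrite normcN en; lra.
rewrite normcM (_ : 4 = 2 * 2); last by ring.
by rewrite ler_pM ?normc_ge0// h.
Qed.

(** The imaginary part is 2 (a - x) b for w = a + i b. It vanishes for a = x, where
the real part is 1 - a^2 - b^2, or for b = 0, where it is
(a - x)^2 + 1 - x^2: positive in both cases. *)
Lemma slit_gker x w : -1 < x < 1 -> normc w < 1 -> slit_plane 0 (gker x w).
Proof.
move=> /andP[x1 x2]; have := sqr_normcE w; case: w => a b; rewrite [complex.Re _]/= [complex.Im _]/=.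
move=> h n1; have n2 : a ^+ 2 + b ^+ 2 < 1.
  by rewrite -h exprn_ilt1// normc_ge0.
have Ri : Re (gker x (a +i* b)) = 1 - 2 * x * a + a ^+ 2 - b ^+ 2.
  by rewrite /gker /=; ring.
have Ii : Im (gker x (a +i* b)) = 2 * (a - x) * b by rewrite /gker /=; ring.
move=> [i0 r0]; move: i0 r0; rewrite Ri Ii => /eqP.
rewrite !mulf_eq0 pnatr_eq0/= => /orP[/eqP ax|/eqP ->].
  have -> : x = a by lra.
  nra.
have h1 : 0 < (1 - x) * (1 + x) by rewrite mulr_gt0//; lra.
have h2 := sqr_ge0 (a - x).
nra.
Qed.

(** From (1 - r)^2 <= |gker x w| <= 4 for |w| <= r, uniformly in x. *)
Definition cpow_bound r s : R := expR (`|s| * (ln 4 - 2 * ln (1 - r))).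

Lemma normc_cpow_gker x w r s : -1 < x < 1 -> normc w <= r -> r < 1 ->
  normc (cpow (gker x w) s) <= cpow_bound r s.
Proof.
move=> xI wr r1; have w1 : normc w <= 1 by lra.
have n0 := normc_ge0 w.
rewrite normc_cpow ler_expR; apply: le_trans (ler_norm _) _.
rewrite normrM ler_wpM2l//.
have g1 : (1 - r) ^+ 2 <= normc (gker x w).
  apply: le_trans (normc_gker_ge xI w1).
  by rewrite ler_pXn2r// ?nnegrE; lra.
have g2 := normc_gker_le xI w1.
have p0 : 0 < (1 - r) ^+ 2 by rewrite exprn_gt0// subr_gt0.
have g0 := lt_le_trans p0 g1.
have l1 : ln (1 - r) *+ 2 <= ln (normc (gker x w)).
  by rewrite -lnXn ?subr_gt0// ler_ln ?posrE.
have l2 : ln (normc (gker x w)) <= ln 4 by rewrite ler_ln ?posrE.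
have l3 : ln (1 - r) <= 0 by rewrite ln_le0//; lra.
have l4 : 0 <= ln 4 :> R by rewrite ln_ge0// ler1n.
rewrite -mulr_natl in l1.
by rewrite ler_norml; apply/andP; split; lra.
Qed.

Lemma cpow_pred (z : R[i]) s : z != 0 -> cpow z (s - 1) * z = cpow z s.
Proof. by move=> z0; rewrite cpowB cpow1r// divfK. Qed.

Lemma is_cderive_id_real t : is_cderive (fun t : R => t%:C) t 1.
Proof. by apply: is_cderive_real; exact: is_derive_id. Qed.

Lemma is_cderive_gker_x x w : is_cderive (gker^~ w) x (- (2 * w)).
Proof.
have h := is_cderive_add (is_cderive_cst x (1 + w ^+ 2))
  (is_cderive_scale (- (2 * w)) (is_cderive_id_real x)).
have -> : gker^~ w = (fun x => 1 + w ^+ 2 + - (2 * w) * x%:C).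
  by apply/funext => y; rewrite /gker; ring.
by apply: is_cderive_eq h _; rewrite add0r mulr1.
Qed.

Lemma is_cderive_gker_t x t w :
  is_cderive (fun t => gker x (t%:C * w)) t (w * (2 * (t%:C * w) - 2 * x%:C)).
Proof.
have dt := is_cderive_mul (is_cderive_id_real t) (is_cderive_cst t w).
have h := is_cderive_add (is_cderive_add (is_cderive_cst t (1 : R[i]))
  (is_cderive_scale (- (2 * x%:C)) dt)) (is_cderive_mul dt dt).
have -> : (fun t => gker x (t%:C * w)) =
    (fun t => 1 + - (2 * x%:C) * (t%:C * w) + (t%:C * w) * (t%:C * w)).
  by apply/funext => y; rewrite /gker; ring.
by apply: is_cderive_eq h _; ring.
Qed.

Lemma ccont_cpow_gker w s : normc w < 1 -> ccont (fun x => cpow (gker x w) s).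
Proof.
move=> w1; apply: is_cderive_ccont => x xI.
exact: is_cderive_cpow (is_cderive_gker_x x w) (slit_gker xI w1).
Qed.

Lemma ccont_cst (c : R[i]) : ccont (fun=> c : R[i]).
Proof. by move=> x xI; split; exact: cvg_cst. Qed.

Lemma ccont_id : ccont (fun x => x%:C : R[i]).
Proof. by apply: is_cderive_ccont => x _; exact: is_cderive_id_real. Qed.

Lemma normc_real_le1 x : -1 < x < 1 -> normc x%:C <= 1.
Proof. by move=> xI; rewrite normc_real ler_norml; lra. Qed.

(** The admissible factors of the Jacobi weight; the closure lemmas below prove
integrability from the shape of the integrand. *)
Definition tame (g : R -> R[i]) :=
  ccont g /\ exists M : R, forall x, -1 < x < 1 -> normc (g x) <= M.

Lemma tame_cst (c : R[i]) : tame (fun=> c).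
Proof. by split; [exact: ccont_cst|exists (normc c)]. Qed.

Lemma tame_id : tame (fun x => x%:C).
Proof. by split; [exact: ccont_id|exists 1; exact: normc_real_le1]. Qed.

Lemma tameD g h : tame g -> tame h -> tame (fun x => g x + h x).
Proof.
move=> [gc [M gM]] [hc [N hN]]; split; first exact: ccontD.
exists (M + N) => x xI; apply: le_trans (ler_normcD _ _) _.
by rewrite lerD ?gM ?hN.
Qed.

Lemma tameM g h : tame g -> tame h -> tame (fun x => g x * h x).
Proof.
move=> [gc [M gM]] [hc [N hN]]; split; first exact: ccontM.
by exists (M * N) => x xI; rewrite normcM ler_pM ?normc_ge0 ?gM ?hN.
Qed.

Lemma tame_cpow_gker w s : normc w < 1 -> tame (fun x => cpow (gker x w) s).
Proof.
move=> w1; split; first exact: ccont_cpow_gker.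
by exists (cpow_bound (normc w) s) => x xI; exact: normc_cpow_gker.
Qed.

Lemma tame_gker w : tame (gker^~ w).
Proof.
have -> : gker^~ w = (fun x => (1 + w ^+ 2) + - (2 * w) * x%:C).
  by apply/funext => x; rewrite /gker; ring.
apply: tameD; first exact: tame_cst.
by apply: tameM; [exact: tame_cst|exact: tame_id].
Qed.

Lemma cintegrable_tame p q (g : R -> R[i]) : -1 < p -> -1 < q -> tame g ->
  cintegrable (fun x => (W p q x)%:C * g x).
Proof.
move=> p1 q1 [cg [M gM]]; apply: (cintegrable_bounded (M := M)) => //.
- by move=> x; exact: jacobi_weight_ge0.
- exact: integrable_jacobi_weight.
- by move=> x; exact: continuous_jacobi_weight.
Qed.

Lemma cvg_jacobi_weight0 p q : 0 < p -> 0 < q ->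
  W p q x @[x --> (-1)^'+] --> 0 /\ W p q x @[x --> 1^'-] --> 0.
Proof.
move=> p0 q0.
have shift1 : (1 + x) @[x --> (-1 : R)^'+] --> (0 : R)^'+.
  move=> P [e /= e0 eP]; exists e => //= x /= xe x1; apply: eP => /=.
    by rewrite (_ : 0 - (1 + x) = -1 - x)//; ring.
  by rewrite -ltrBlDl sub0r.
have shift2 : (1 - x) @[x --> (1 : R)^'-] --> (0 : R)^'+.
  move=> P [e /= e0 eP]; exists e => //= x /= xe x1; apply: eP => /=.
    by rewrite (_ : 0 - (1 - x) = - (1 - x)) ?normrN//; ring.
  by rewrite subr_gt0.
have c1 r : 0 < r -> (1 + x) `^ r @[x --> (-1 : R)^'+] --> 0.
  by move=> r0; exact: cvg_comp shift1 (powR_cvg0 r0).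
have c2 r : 0 < r -> (1 - x) `^ r @[x --> (1 : R)^'-] --> 0.
  by move=> r0; exact: cvg_comp shift2 (powR_cvg0 r0).
have d1 r : (1 - x) `^ r @[x --> (-1 : R)^'+] --> (1 - (-1 : R)) `^ r.
  apply: cvg_at_right_filter.
  have h : is_derive (1 - (-1) : R) 1 (fun y => y `^ r) (r * (1 - (-1)) `^ (r - 1)).
    by apply: is_derive1_powR; lra.
  exact: is_derive1_cvg (is_derive1_chain (g := fun x => 1 - x) h (is_derive1_onem _)).
have d2 r : (1 + x) `^ r @[x --> (1 : R)^'-] --> (1 + 1 : R) `^ r.
  apply: cvg_at_left_filter.
  have h : is_derive (1 + 1 : R) 1 (fun y => y `^ r) (r * (1 + 1) `^ (r - 1)).
    by apply: is_derive1_powR; lra.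
  exact: is_derive1_cvg (is_derive1_chain (g := fun x => 1 + x) h (is_derive1_onep _)).
split.
  by rewrite -(mulr0 ((1 - (-1 : R)) `^ p)); exact: cvgM (d1 p) (c1 q q0).
by rewrite -(mul0r ((1 + 1 : R) `^ q)); exact: cvgM (c2 p p0) (d2 q).
Qed.

(** The integrand is the derivative of W (p + 1) (q + 1) * gker^s, which vanishes
at both end points because p + 1 and q + 1 are positive. All recurrences below
are instances of this relation. *)
Lemma cint_master p q s w : -1 < p -> -1 < q -> normc w < 1 ->
  cint (fun x => (W p q x)%:C *
    (((((q + 1) * (1 - x) - (p + 1) * (1 + x))%:C * gker x w
       - 2 * s%:C * w * (1 - x ^+ 2)%:C) * cpow (gker x w) (s - 1)))) = 0.
Proof.
move=> p1 q1 w1.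
pose f1 x : R[i] := ((q + 1) * (1 - x) - (p + 1) * (1 + x))%:C.
have tf1 : tame f1.
  have -> : f1 = (fun x => (q - p)%:C + (- (p + q + 2))%:C * x%:C).
    by apply/funext => x; rewrite /f1 -rmorphM -rmorphD/=; congr (_%:C); ring.
  by apply: tameD; [exact: tame_cst|apply: tameM; [exact: tame_cst|exact: tame_id]].
pose f2 x : R[i] := (1 - x ^+ 2)%:C.
have tf2 : tame f2.
  have -> : f2 = (fun x => 1 + (- 1) * (x%:C * x%:C)).
    by apply/funext => x; rewrite /f2 rmorphB rmorphXn/=; ring.
  apply: tameD; [exact: tame_cst|apply: tameM; first exact: tame_cst].
  exact: tameM tame_id tame_id.
pose g x := f1 x * gker x w + - (2 * s%:C * w) * f2 x.
have tg : tame (fun x => g x * cpow (gker x w) (s - 1)).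
  apply: tameM (tame_cpow_gker _ w1).
  exact: (tameD (tameM tf1 (tame_gker w)) (tameM (tame_cst _) tf2)).
have gI := cintegrable_tame p1 q1 tg.
have [W1 W2] := cvg_jacobi_weight0 (p := p + 1) (q := q + 1) ltac:(lra) ltac:(lra).
pose B0 := cpow_bound (normc w) s.
pose F x : R[i] := (W (p + 1) (q + 1) x)%:C * cpow (gker x w) s.
transitivity (cint (fun x => (W p q x)%:C * (g x * cpow (gker x w) (s - 1)))).
  by apply: eq_cint => x _; rewrite /g /f1 /f2; ring.
apply: (cint_FTC0 (F := F) (B := fun x => W (p + 1) (q + 1) x * B0) gI).
- apply: ccontM; last by case: tg.
  by apply: ccont_real => x; exact: continuous_jacobi_weight.
- move=> x xI; rewrite /F.
  have d1 := is_cderive_real (is_derive_jacobi_weight p q xI).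
  have d2 := is_cderive_cpow s (is_cderive_gker_x x w) (slit_gker xI w1).
  apply: is_cderive_eq (is_cderive_mul d1 d2) _.
  have cpE : cpow (gker x w) s = cpow (gker x w) (s - 1) * gker x w.
    by rewrite cpow_pred// slit_neq0//; exact: slit_gker.
  rewrite cpE jacobi_weightSl// jacobi_weightSr//.
  rewrite /g /f1 /f2 !(rmorphM, rmorphB, rmorphD, rmorphXn, rmorph1)/=.
  by ring.
- move=> x xI; rewrite normcM normc_real ger0_norm ?jacobi_weight_ge0//.
  by rewrite ler_wpM2l ?jacobi_weight_ge0// normc_cpow_gker.
- by rewrite -(mul0r B0); apply: cvgM W1 (cvg_cst _).
- by rewrite -(mul0r B0); apply: cvgM W2 (cvg_cst _).
Qed.

End kernel.

(** * Equal exponents and exponents differing by one *)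
Section gegenbauer.
Context {R : realType}.
Local Notation mu := (@lebesgue_measure R).
Local Notation I := (`]-1, 1[%classic : set R).
Local Notation W := (@jacobi_weight R).
Implicit Types (p q s l x t : R) (w : R[i]).

Lemma is_cderive0_const (f : R -> R[i]) (a b : R) :
  (forall x, a < x < b -> is_cderive f x 0) ->
  forall x y, a < x < b -> a < y < b -> f x = f y.
Proof.
move=> f0 x y xab yab; apply: complex_ext.
  by apply: (is_derive0_const_oo (f := fun x => Re (f x)) _ xab yab) => t /f0[].
by apply: (is_derive0_const_oo (f := fun x => Im (f x)) _ xab yab) => t /f0[].
Qed.

Lemma cintB (f g : R -> R[i]) : cintegrable f -> cintegrable g ->
  cint (fun x => f x - g x) = cint f - cint g.
Proof.
move=> fi gi; rewrite -mulN1r -cintZ// -cintD//; last exact: cintegrableZ.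
by apply: eq_cint => x _; rewrite mulN1r.
Qed.

Lemma cint_real (f : R -> R) :
  cint (fun x => (f x)%:C) = (\int[mu]_(x in I) f x)%:C.
Proof.
by apply: complex_ext => //=; rewrite /Rintegral integral0_eq.
Qed.

Lemma normc_scale_lt t T w : -T < t < T -> normc (t%:C * w) <= T * normc w.
Proof.
move=> tT; rewrite normcM normc_real ler_wpM2r ?normc_ge0//.
by rewrite ler_norml; lra.
Qed.

(** Leaves room beyond the segment from 0 to w: the paths t w below are
differentiated on an open interval that contains both t = 0 and t = 1. *)
Lemma dilation w : normc w < 1 -> exists T : R, 1 < T /\ T * normc w < 1.
Proof.
move=> w1; have w0 := normc_ge0 w; exists (2 / (1 + normc w)); split.
  by rewrite ltr_pdivlMr//; lra.
by rewrite mulrAC ltr_pdivrMr//; lra.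
Qed.

(** Up to the factor - 2 l, the derivative in w of the integral of gker^(-l)
against the ultraspherical weight. *)
Definition gegen_moment l w : R[i] :=
  cint (fun x => (W (l - 1 / 2) (l - 1 / 2) x)%:C *
    ((w - x%:C) * cpow (gker x w) (- l - 1))).

(** The integrand of the moment along the ray t w, and its derivative in t. *)
Let v w s t x : R[i] := (t%:C * w - x%:C) * cpow (gker x (t%:C * w)) s.

Let dv w s t x : R[i] :=
  w * cpow (gker x (t%:C * w)) s +
  (t%:C * w - x%:C) * (s%:C * (w * (2 * (t%:C * w) - 2 * x%:C)) *
     cpow (gker x (t%:C * w)) (s - 1)).

Let ccont_lin w : ccont (fun x => w - x%:C).
Proof.
have -> : (fun x => w - x%:C) = (fun x => w + (-1) * x%:C).
  by apply/funext => x; rewrite mulN1r.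
by apply: ccontD; [exact: ccont_cst|apply: ccontM; [exact: ccont_cst|exact: ccont_id]].
Qed.

Let lin_bound w x : normc w < 1 -> -1 < x < 1 -> normc (w - x%:C) <= 2.
Proof.
move=> w1 xI; apply: le_trans (ler_normcD _ _) _; rewrite normcN.
have := normc_real_le1 xI; lra.
Qed.

Lemma is_cderive_gegen_moment l w T t : -1 / 2 < l -> 1 < T ->
  T * normc w < 1 -> -T < t < T ->
  is_cderive (fun t => gegen_moment l (t%:C * w)) t
    (cint (fun x => (W (l - 1 / 2) (l - 1 / 2) x)%:C * dv w (- l - 1) t x)).
Proof.
move=> l0 T1 Tw tT.
pose s := - l - 1; pose r := T * normc w.
have tw1 u : -T < u < T -> normc (u%:C * w) < 1.
  by move=> uT; apply: le_lt_trans (normc_scale_lt w uT) Tw.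
pose M1 := normc w * cpow_bound r s +
  2 * (`|s| * (normc w * 4) * cpow_bound r (s - 1)).
apply: (is_cderive_cint (h := v w s) (h1 := dv w s)
   (M := 2 * cpow_bound r s) (M1 := M1) (u := - T) (v := T)).
- by move=> x; exact: jacobi_weight_ge0.
- by apply: integrable_jacobi_weight; lra.
- by move=> x; exact: continuous_jacobi_weight.
- move=> u uT; apply: ccontM; first exact: ccont_lin.
  by apply: ccont_cpow_gker; exact: tw1.
- move=> u x uT xI; rewrite /v normcM ler_pM ?normc_ge0//.
    by apply: lin_bound => //; exact: tw1.
  by apply: normc_cpow_gker => //; exact: normc_scale_lt.
- move=> u x uT xI; rewrite /v /dv.
  have d1 : is_cderive (fun t => t%:C * w - x%:C) u w.
    have dt := is_cderive_mul (is_cderive_id_real u) (is_cderive_cst u w).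
    apply: is_cderive_eq (is_cderive_add dt (is_cderive_cst u (- x%:C))) _.
    by rewrite mul1r mulr0 !addr0.
  have d2 := is_cderive_cpow s (is_cderive_gker_t x u w) (slit_gker xI (tw1 u uT)).
  exact: is_cderive_mul d1 d2.
- move=> u x uT xI; rewrite /dv; apply: le_trans (ler_normcD _ _) _; rewrite lerD//.
    rewrite normcM ler_wpM2l ?normc_ge0//.
    by apply: normc_cpow_gker => //; exact: normc_scale_lt.
  have b1 := lin_bound (tw1 u uT) xI.
  rewrite normcM ler_pM ?normc_ge0//.
  rewrite normcM ler_pM ?normc_ge0//; last first.
    by apply: normc_cpow_gker => //; exact: normc_scale_lt.
  rewrite normcM normc_real ler_wpM2l// normcM ler_wpM2l ?normc_ge0//.
  rewrite -mulrBr normcM (_ : 4 = 2 * 2); last by ring.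
  rewrite ler_pM ?normc_ge0// (_ : 2 = 2%:C) ?normc_real ?ger0_norm//.
  by rewrite rmorph_nat.
- exact: tT.
Qed.

(** The operator t d/dt + 2 l + 1 applied to the integrand is the exact
derivative of cint_master for s = - l - 1 and equal exponents. *)
Lemma gegen_moment_euler l w t : -1 / 2 < l -> normc (t%:C * w) < 1 ->
  t%:C * cint (fun x => (W (l - 1 / 2) (l - 1 / 2) x)%:C * dv w (- l - 1) t x)
  + (2 * l + 1)%:C * gegen_moment l (t%:C * w) = 0.
Proof.
move=> l0 w1; have l1 : -1 < l - 1 / 2 by lra.
set s := - l - 1; set u := t%:C * w in w1 *.
have tl : tame (fun x => u - x%:C).
  have -> : (fun x => u - x%:C) = (fun x => u + (-1) * x%:C).
    by apply/funext => x; rewrite mulN1r.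
  by apply: tameD; [exact: tame_cst|apply: tameM; [exact: tame_cst|exact: tame_id]].
have tc r : tame (fun x => cpow (gker x u) r) by exact: tame_cpow_gker.
have iv : cintegrable (fun x => (W (l - 1 / 2) (l - 1 / 2) x)%:C *
    ((u - x%:C) * cpow (gker x u) s)).
  exact: (cintegrable_tame l1 l1 (tameM tl (tc s))).
have idv : cintegrable (fun x => (W (l - 1 / 2) (l - 1 / 2) x)%:C * dv w s t x).
  apply: (cintegrable_tame l1 l1); rewrite /dv -/u.
  have -> : (fun x => w * cpow (gker x u) s + (u - x%:C) *
      (s%:C * (w * (2 * u - 2 * x%:C)) * cpow (gker x u) (s - 1))) =
    (fun x => w * cpow (gker x u) s +
      ((2 * s%:C * w) * ((u - x%:C) * (u - x%:C)) * cpow (gker x u) (s - 1))).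
    by apply/funext => x; ring.
  exact: (tameD (tameM (tame_cst _) (tc s))
    (tameM (tameM (tame_cst _) (tameM tl tl)) (tc _))).
rewrite /gegen_moment -/s -!cintZ// -cintD; [|exact: cintegrableZ|exact: cintegrableZ].
rewrite -[RHS](cint_master s l1 l1 w1); apply: eq_cint => x xI.
have g0 : gker x u != 0 by apply: slit_neq0; exact: slit_gker.
rewrite /dv -/u -(cpow_pred s g0).
have -> : (2 * l + 1)%:C = - 2 * s%:C - 1 :> R[i].
  by rewrite /s !(rmorphD, rmorphM, rmorphN, rmorph1, rmorph_nat)/=; ring.
have -> : ((l - 1 / 2 + 1) * (1 - x) - (l - 1 / 2 + 1) * (1 + x))%:C =
    (2 * s%:C + 1) * x%:C :> R[i].
  by rewrite (_ : _ - _ = (2 * s + 1) * x);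
    [rewrite !(rmorphD, rmorphM, rmorph1, rmorph_nat)|rewrite /s; field].
have -> : (1 - x ^+ 2)%:C = 1 - x%:C ^+ 2 :> R[i] by rewrite rmorphB rmorphXn rmorph1.
move: (cpow _ _) (W _ _ x)%:C => c W0.
rewrite (_ : t%:C * (W0 * _) = W0 * (u * (c * gker x u) + (u - x%:C) *
  (s%:C * (u * (2 * u - 2 * x%:C)) * c))); last by rewrite /u; ring.
rewrite /gker; ring.
Qed.

(** By the preceding relation t^(2 l + 1) * gegen_moment l (t w) has derivative 0
for t > 0. It tends to 0 with t, since 2 l + 1 > 0 and the moment is continuous
at 0; so it vanishes at t = 1. *)
Lemma gegen_moment0 l w : -1 / 2 < l -> normc w < 1 -> gegen_moment l w = 0.
Proof.
move=> l0 w1; have [T [T1 Tw]] := dilation w1.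
have tw1 u : -T < u < T -> normc (u%:C * w) < 1.
  by move=> uT; apply: le_lt_trans (normc_scale_lt w uT) Tw.
pose e := 2 * l + 1; have e0 : 0 < e by rewrite /e; lra.
pose N t : R[i] := (t `^ e)%:C * gegen_moment l (t%:C * w).
have dN t : 0 < t < T -> is_cderive N t 0.
  move=> /andP[t0 tT]; have tTT : -T < t < T by lra.
  have dM := is_cderive_gegen_moment l0 T1 Tw tTT.
  apply: is_cderive_eq (is_cderive_mul (is_cderive_real (is_derive1_powR e t0)) dM) _.
  have := gegen_moment_euler l0 (tw1 t tTT).
  have -> : t `^ e = t `^ (e - 1) * t.
    by rewrite -[X in _ * X](powRr1 (ltW t0)) -powRD ?subrK// gt_eqF ?implybT.
  rewrite !rmorphM /= -/e => h.
  transitivity ((t `^ (e - 1))%:C * (t%:C * cint (fun x =>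
    (W (l - 1 / 2) (l - 1 / 2) x)%:C * dv w (- l - 1) t x) +
    e%:C * gegen_moment l (t%:C * w))); last by rewrite h mulr0.
  by ring.
have cN := is_cderive0_const dN.
have I1 : (0 : R) < 1 < T by rewrite ltr01 T1.
have N1 : N 1 = gegen_moment l w by rewrite /N powR1 mul1r mul1r.
rewrite -N1.
have [c1 c2] := is_cderive_gegen_moment (t := 0) l0 T1 Tw ltac:(lra).
have lim (f : R -> R) : {for (0 : R), continuous f} ->
    t `^ e * f t @[t --> (0 : R)^'+] --> (0 : R).
  move=> fc.
  have h1 : f t @[t --> (0 : R)^'+] --> f 0 by apply: cvg_at_right_filter; exact: fc.
  have h2 : t `^ e @[t --> (0 : R)^'+] --> (0 : R) by exact: powR_cvg0.
  by have := cvgM h2 h1; rewrite mul0r; exact.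
apply: complex_ext.
  apply: (@cvg_unique _ (@Rhausdorff R) ((fun=> Re (N 1)) @ (0 : R)^'+)); first exact: cvg_cst.
  apply: cvg_trans (lim _ (is_derive1_cvg c1)).
  apply: near_eq_cvg; near=> t.
  have tT : 0 < t < T.
    by apply/andP; split; near: t; [exact: nbhs_right_gt|apply: nbhs_right_lt; lra].
  by rewrite (cN _ _ I1 tT) /N ReM/= mul0r subr0.
apply: (@cvg_unique _ (@Rhausdorff R) ((fun=> Im (N 1)) @ (0 : R)^'+)); first exact: cvg_cst.
apply: cvg_trans (lim _ (is_derive1_cvg c2)).
apply: near_eq_cvg; near=> t.
have tT : 0 < t < T.
  by apply/andP; split; near: t; [exact: nbhs_right_gt|apply: nbhs_right_lt; lra].
by rewrite (cN _ _ I1 tT) /N ImM/= mul0r addr0.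
Unshelve. all: by end_near. Qed.

(** The derivative along t w is a multiple of the vanishing moment, so the value
at t = 1 is the value at t = 0, where the kernel is 1. *)
Lemma gegen_const l w : -1 / 2 < l -> normc w < 1 ->
  cint (fun x => (W (l - 1 / 2) (l - 1 / 2) x)%:C * cpow (gker x w) (- l)) =
  (\int[mu]_(x in I) W (l - 1 / 2) (l - 1 / 2) x)%:C.
Proof.
move=> l0 w1; have l1 : -1 < l - 1 / 2 by lra.
have [T [T1 Tw]] := dilation w1; pose r := T * normc w.
have tw1 u : -T < u < T -> normc (u%:C * w) < 1.
  by move=> uT; apply: le_lt_trans (normc_scale_lt w uT) Tw.
pose g t x : R[i] := cpow (gker x (t%:C * w)) (- l).
pose dg t x : R[i] := (- l)%:C * (w * (2 * (t%:C * w) - 2 * x%:C)) *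
  cpow (gker x (t%:C * w)) (- l - 1).
pose M t := cint (fun x => (W (l - 1 / 2) (l - 1 / 2) x)%:C * g t x).
have dM t : -T < t < T -> is_cderive M t 0.
  move=> tT.
  have <- : cint (fun x => (W (l - 1 / 2) (l - 1 / 2) x)%:C * dg t x) = 0.
    transitivity ((- 2 * l%:C * w) * gegen_moment l (t%:C * w)); last first.
      by rewrite gegen_moment0 ?mulr0//; exact: tw1.
    rewrite -cintZ; last first.
      apply: (cintegrable_tame l1 l1).
      have -> : (fun x => (t%:C * w - x%:C) * cpow (gker x (t%:C * w)) (- l - 1)) =
          (fun x => (t%:C * w + (-1) * x%:C) * cpow (gker x (t%:C * w)) (- l - 1)).
        by apply/funext => x; rewrite mulN1r.
      apply: tameM (tame_cpow_gker _ (tw1 t tT)).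
      by apply: tameD; [exact: tame_cst|apply: tameM; [exact: tame_cst|exact: tame_id]].
    by apply: eq_cint => x _; rewrite /dg rmorphN/=; ring.
  apply: (is_cderive_cint (h := g) (h1 := dg) (M := cpow_bound r (- l))
    (M1 := `|l| * (normc w * 4) * cpow_bound r (- l - 1)) (u := - T) (v := T)).
  - by move=> x; exact: jacobi_weight_ge0.
  - exact: integrable_jacobi_weight.
  - by move=> x; exact: continuous_jacobi_weight.
  - by move=> u uT; apply: ccont_cpow_gker; exact: tw1.
  - by move=> u x uT xI; apply: normc_cpow_gker => //; exact: normc_scale_lt.
  - move=> u x uT xI.
    exact: is_cderive_cpow (is_cderive_gker_t x u w) (slit_gker xI (tw1 u uT)).
  - move=> u x uT xI; rewrite /dg normcM ler_pM ?normc_ge0//; last first.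
      by apply: normc_cpow_gker => //; exact: normc_scale_lt.
    rewrite normcM normc_real normrN ler_wpM2l// normcM ler_wpM2l ?normc_ge0//.
    rewrite -mulrBr normcM (_ : 4 = 2 * 2); last by ring.
    rewrite ler_pM ?normc_ge0// ?lin_bound// ?tw1//.
    by rewrite (_ : 2 = 2%:C) ?normc_real ?ger0_norm// rmorph_nat.
  - exact: tT.
have T1' : -T < (1 : R) < T by lra.
have T0' : -T < (0 : R) < T by lra.
have M10 := is_cderive0_const dM T1' T0'.
have <- : M 1 = cint (fun x => (W (l - 1 / 2) (l - 1 / 2) x)%:C * cpow (gker x w) (- l)).
  by apply: eq_cint => x _; rewrite /g [X in gker _ X]mul1r.
rewrite M10 /M /g.
transitivity (cint (fun x => (W (l - 1 / 2) (l - 1 / 2) x)%:C)).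
  have g1 x : cpow (gker x (0%:C * w)) (- l) = 1.
    by rewrite mul0r /gker expr0n mulr0 subr0 addr0 cpow1l.
  by apply: eq_cint => x _; rewrite g1 mulr1.
exact: cint_real.
Qed.

(** Write a and b for the integrals of gker^(-l) and x gker^(-l) against the
weight with equal exponents l - 3/2. The vanishing moment at l - 1 says b = w a;
the constant integral at l - 1 is (1 + w^2) a - 2 w b = (1 - w^2) a, since
gker^(1 - l) = gker * gker^(-l); and the integral sought is a - b = (1 - w) a. *)
Lemma gegen_shift l w : 1 / 2 < l -> normc w < 1 ->
  (1 + w) * cint (fun x => (W (l - 1 / 2) (l - 1 / 2 - 1) x)%:C * cpow (gker x w) (- l)) =
  (\int[mu]_(x in I) W (l - 1 / 2 - 1) (l - 1 / 2 - 1) x)%:C.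
Proof.
move=> l0 w1; set p := l - 1 / 2 - 1.
have p1 : -1 < p by rewrite /p; lra.
have pE : l - 1 - 1 / 2 = p by rewrite /p; ring.
have k0 := @gegen_moment0 (l - 1) w ltac:(lra) w1.
have c0 := @gegen_const (l - 1) w ltac:(lra) w1.
rewrite /gegen_moment pE in k0 c0.
have lE : - (l - 1) - 1 = - l by ring.
rewrite lE in k0.
have tc r : tame (fun x => cpow (gker x w) r) by exact: tame_cpow_gker.
pose a := cint (fun x => (W p p x)%:C * cpow (gker x w) (- l)).
pose b := cint (fun x => (W p p x)%:C * (x%:C * cpow (gker x w) (- l))).
have ia : cintegrable (fun x => (W p p x)%:C * cpow (gker x w) (- l)).
  exact: cintegrable_tame.
have ib : cintegrable (fun x => (W p p x)%:C * (x%:C * cpow (gker x w) (- l))).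
  by apply: cintegrable_tame => //; exact: tameM tame_id (tc _).
have ba : b = w * a.
  apply/eqP; rewrite -subr_eq0 -opprB oppr_eq0; apply/eqP.
  rewrite -[RHS]k0 /a /b -cintZ// -cintB; [|exact: cintegrableZ|by []].
  by apply: eq_cint => x _; ring.
have ca : (\int[mu]_(x in I) W p p x)%:C = (1 + w ^+ 2) * a - 2 * w * b.
  rewrite -[LHS]c0 /a /b -!cintZ// -cintB; [|exact: cintegrableZ..].
  apply: eq_cint => x xI.
  have g0 : gker x w != 0 by apply: slit_neq0; exact: slit_gker.
  have -> : - (l - 1) = - l + 1 by ring.
  rewrite cpowD cpow1r// /gker; ring.
rewrite ca ba.
have -> : cint (fun x => (W (l - 1 / 2) p x)%:C * cpow (gker x w) (- l)) = a - b.
  rewrite /a /b -cintB//.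
  apply: eq_cint => x xI.
  rewrite (_ : l - 1 / 2 = p + 1); last by rewrite /p; ring.
  by rewrite jacobi_weightSl// rmorphM rmorphB rmorph1/=; ring.
rewrite ba; ring.
Qed.

End gegenbauer.

(** * Contiguous hypergeometric polynomials *)
Section hypergeometric_polynomials.
Context {R : realType}.
Implicit Types (a c K q : R) (k n m : nat).

(** Real version of the rising factorial, for the order arguments on its
values. *)
Definition poch a n : R := \prod_(i < n) (a + i%:R).

Lemma poch0 a : poch a 0 = 1. Proof. by rewrite /poch big_ord0. Qed.

Lemma pochSr a n : poch a n.+1 = poch a n * (a + n%:R).
Proof. by rewrite /poch big_ord_recr. Qed.

Lemma pochSl a n : poch a n.+1 = a * poch (a + 1) n.
Proof.
rewrite /poch big_ord_recl addr0; congr (_ * _); apply: eq_bigr => i _.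
by rewrite /bump/= natrD addrA.
Qed.

Lemma poch_gt0 a n : 0 < a -> 0 < poch a n.
Proof. by move=> a0; apply: prodr_gt0 => i _; rewrite ltr_wpDr. Qed.

Lemma poch_oppn k n : (k < n)%N -> poch (- k%:R) n = 0.
Proof.
by move=> kn; rewrite /poch (bigD1 (Ordinal kn))//= addNr mul0r.
Qed.

(** Coefficient of 2F1 (1 - K, K; c; u), with K real so that the relation
below is a rational identity in K. *)
Definition hcoef K c n : R := poch (1 - K) n * poch K n / (poch c n * n`!%:R).

Lemma hcoef_eq0 k c n : (k < n)%N -> hcoef k%:R c n = 0.
Proof.
rewrite /hcoef; case: k => [|k] kn.
  by have := poch_oppn kn; rewrite oppr0 => ->; rewrite mulr0 mul0r.
rewrite (_ : 1 - k.+1%:R = - k%:R); last by rewrite -natr1; ring.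
by rewrite poch_oppn ?mul0r// ltnW.
Qed.

(** The contiguous relation between the parameters (K + 2, q), (K + 1, q + 1) and
(K, q + 2), coefficient by coefficient; pr h j is the sequence h multiplied by
the j-th power of the variable. *)
Lemma hcoef_rec K q n : 0 < q ->
  let h2 := hcoef (K + 2) q in
  let h1 := hcoef (K + 1) (q + 1) in
  let h0 := hcoef K (q + 2) in
  let kap := (q + 1 - K) * (q - K) / (q + 1) in
  let pr (h : nat -> R) j := if (n < j)%N then 0 else h (n - j)%N in
  q * (h2 n - pr h2 1) =
  q * h1 n - 2 * (2 * K + 1) * (pr h1 1 - pr h1 2) - kap * pr h0 1.
Proof.
move=> q0 h2 h1 h0 kap pr; rewrite /pr /h2 /h1 /h0 /kap /hcoef.
have q1 : q != 0 by rewrite gt_eqF.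
have q2 : q + 1 != 0 by rewrite gt_eqF; lra.
have q3 : q + 2 != 0 by rewrite gt_eqF; lra.
have q4 : q + 3 != 0 by rewrite gt_eqF; lra.
have -> : 1 - (K + 2) = -1 - K by ring.
have -> : 1 - (K + 1) = - K by ring.
(* For n < 3 some shifted terms are absent; from n = 3 on, all factors are
   expressed by the Pochhammer symbols of index n - 3. *)
case: n pr => [|[|[|m]]] _ /=.
- by rewrite !poch0 fact0; field; rewrite q2.
- by rewrite subnn !pochSr !poch0 fact0 factS fact0; field; rewrite q1 q2.
- rewrite !subSS !subn0 !pochSr !poch0 !factS fact0.
  by field; rewrite q1 q2 q3.
rewrite !subSS !subn0.
set M := m%:R : R; have M0 : 0 <= M by [].
have f1 : (m.+1)`!%:R = (M + 1) * m`!%:R :> R by rewrite factS natrM -natr1.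
have f2 : (m.+2)`!%:R = (M + 2) * ((M + 1) * m`!%:R) :> R.
  by rewrite factS natrM f1 -!natr1; congr (_ * _); rewrite /M; ring.
have f3 : (m.+3)`!%:R = (M + 3) * ((M + 2) * ((M + 1) * m`!%:R)) :> R.
  by rewrite factS natrM f2 -!natr1; congr (_ * _); rewrite /M; ring.
have S1 : m.+1%:R = M + 1 :> R by rewrite -natr1.
have S2 : m.+2%:R = M + 2 :> R by rewrite -!natr1 /M; ring.
pose A := poch (1 - K) m.
have a1 n : poch (-1 - K) n.+2 = (-1 - K) * (- K) * poch (1 - K) n.
  rewrite pochSl (_ : -1 - K + 1 = - K); last by ring.
  rewrite pochSl (_ : - K + 1 = 1 - K); last by ring.
  by rewrite mulrA.
have a2 n : poch (- K) n.+1 = - K * poch (1 - K) n.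
  by rewrite pochSl; congr (_ * poch _ _); ring.
have b1 n : poch (K + 1) n.+1 = (K + 1) * poch (K + 2) n.
  by rewrite pochSl; congr (_ * poch _ _); ring.
have b2 n : poch K n.+2 = K * (K + 1) * poch (K + 2) n.
  by rewrite pochSl b1 mulrA.
have c1 n : poch (q + 1) n.+1 = (q + 1) * poch (q + 2) n.
  by rewrite pochSl; congr (_ * poch _ _); ring.
have c2 n : poch q n.+2 = q * (q + 1) * poch (q + 2) n.
  by rewrite pochSl c1 mulrA.
rewrite !a1 !a2 !b1 !b2 !c1 !c2 f1 f2 f3 !pochSr S1 S2 -/M.
have C0 : poch (q + 2) m != 0 by rewrite gt_eqF// poch_gt0//; lra.
have F0 : m`!%:R != 0 :> R by rewrite pnatr_eq0 -lt0n fact_gt0.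
move: (poch (1 - K) m) (poch (K + 2) m) (poch (q + 2) m) (m`!%:R) C0 F0 => a b c f C0 F0.
field.
rewrite C0 F0 q1 q2 /=; apply/and5P; split; rewrite gt_eqF//; lra.
Qed.

(** The bound k + 1 on the number of terms serves for every k, k = 0 included:
the later coefficients vanish. *)
Definition hpoly k c : {poly R} := \poly_(n < k.+1) hcoef k%:R c n.

Lemma coef_hpoly k c n : (hpoly k c)`_n = hcoef k%:R c n.
Proof.
rewrite coef_poly; case: ltnP => // kn.
by rewrite hcoef_eq0.
Qed.

Lemma hpoly_rec k q : 0 < q ->
  q *: hpoly k.+2 q - q *: ('X * hpoly k.+2 q) =
  q *: hpoly k.+1 (q + 1)
  - (2 * (2 * k%:R + 1)) *: ('X * hpoly k.+1 (q + 1) - 'X^2 * hpoly k.+1 (q + 1))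
  - ((q + 1 - k%:R) * (q - k%:R) / (q + 1)) *: ('X * hpoly k (q + 2)).
Proof.
move=> q0; apply/polyP => n.
rewrite !(coefD, coefN, coefZ, coefXM, coefXnM, coef_hpoly).
have := @hcoef_rec k%:R q n q0.
have -> : k%:R + 2 = k.+2%:R :> R by rewrite -!natr1; ring.
have e1 : (n < 1)%N = (n == 0)%N by case: n.
by rewrite /= natr1 e1 subn1 => <-; rewrite mulrBr.
Qed.

Definition heval k c (u : R[i]) : R[i] := (map_poly (real_complex R) (hpoly k c)).[u].

Lemma heval_rec k q (u : R[i]) : 0 < q ->
  q%:C * (1 - u) * heval k.+2 q u =
  (q%:C - 2 * (2 * k%:R + 1) * u * (1 - u)) * heval k.+1 (q + 1) u -
  ((q + 1 - k%:R) * (q - k%:R) / (q + 1))%:C * u * heval k (q + 2) u.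
Proof.
move=> q0; set kap := (_ / _).
have := hpoly_rec k q0; rewrite -/kap.
move/(congr1 (fun p => (map_poly (real_complex R) p).[u])).
pose E (p : {poly R}) := (map_poly (real_complex R) p).[u]; rewrite -!/(E _).
have EB p r : E (p - r) = E p - E r by rewrite /E rmorphB hornerD hornerN.
have EM p r : E (p * r) = E p * E r by rewrite /E rmorphM hornerM.
have EC c : E c%:P = c%:C by rewrite /E map_polyC hornerC.
have EX : E 'X = u by rewrite /E map_polyX hornerX.
have EH k' c : E (hpoly k' c) = heval k' c u by [].
rewrite -!mul_polyC !EB !EM !EB expr2 !EM !EC !EX !EH.
rewrite (_ : (2 * (2 * k%:R + 1))%:C = 2 * (2 * k%:R + 1)); last first.
  by rewrite !(rmorphM, rmorphD, rmorph1, rmorph_nat).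
move: (heval k.+2 _ _) (heval k.+1 _ _) (heval k _ _) => a b c h.
transitivity (q%:C * a - q%:C * (u * a)); first by ring.
by rewrite h; ring.
Qed.

Lemma hevalE k c (u : R[i]) :
  heval k c u = \sum_(n < k.+1) (hcoef k%:R c n)%:C * u ^+ n.
Proof.
rewrite /heval /hpoly poly_def rmorph_sum/= horner_sum; apply: eq_bigr => n _.
by rewrite map_polyZ/= map_polyXn hornerZ hornerXn.
Qed.

Lemma hcoef0 K c : hcoef K c 0 = 1.
Proof. by rewrite /hcoef !poch0 fact0 !mul1r invr1. Qed.

Lemma heval0 c u : heval 0 c u = 1.
Proof. by rewrite hevalE big_ord_recl big_ord0 hcoef0 addr0 mul1r. Qed.

Lemma heval1 c u : heval 1 c u = 1.
Proof.
rewrite hevalE !big_ord_recl big_ord0 hcoef0 addr0 mul1r /= expr0.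
by rewrite /hcoef pochSl subrr !mul0r addr0.
Qed.

End hypergeometric_polynomials.

(** * The general integral *)

(** The algebra of the induction step for the integrals, isolated over a field: hJ
is the recurrence of the integrals, in which the two known integrals have been
replaced by their closed forms (the N are masses, the P hypergeometric values,
v = 1 + w, V a power of v), and the relations between the masses are the same
recurrence at w = 0. *)
Lemma jtrans_step (F : fieldType) (q k w v V c J2 N0 N1 N2 P0 P1 P2 : F) :
  v != 0 -> V != 0 -> c != 0 -> q + 1 != 0 -> 1 + w = v ->
  c * N2 = q * N1 -> (q - k) * N1 = (q + 1) * N0 ->
  c * v ^+ 2 * J2 + (2 * w * (2 * k + 1) - q * v ^+ 2) * (N1 / (V * v) * P1) +
    w * (q - k + 1) * (N0 / V * P0) = 0 ->
  q * (1 - w / v) * P2 = (q - 2 * (2 * k + 1) * (w / v) * (1 - w / v)) * P1 -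
    (q + 1 - k) * (q - k) / (q + 1) * (w / v) * P0 ->
  J2 = N2 / (V * v ^+ 2) * P2.
Proof.
move=> v0 V0 c0 q1 wv hN2 hN0 hJ hP.
have {}wv : w = v - 1 by rewrite -wv addrC addKr.
have N2E : N2 = q * N1 / c by rewrite -hN2 mulrAC mulfV// mul1r.
have N0E : N0 = (q - k) * N1 / (q + 1) by rewrite hN0 mulrAC mulfV// mul1r.
have qP : q * P2 = v * ((q - 2 * (2 * k + 1) * (w / v) * (1 - w / v)) * P1 -
    (q + 1 - k) * (q - k) / (q + 1) * (w / v) * P0).
  by rewrite -hP wv; field.
apply: (mulfI (mulf_neq0 c0 (expf_neq0 2 v0))).
move/eqP: hJ; rewrite -addrA addr_eq0 => /eqP ->.
transitivity (N1 / V * (q * P2)); last by rewrite N2E; field; rewrite v0 V0 c0.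
by rewrite qP N0E wv; field; rewrite v0 V0 q1.
Qed.

Section jacobi_transform.
Context {R : realType}.
Local Notation mu := (@lebesgue_measure R).
Local Notation I := (`]-1, 1[%classic : set R).
Local Notation W := (@jacobi_weight R).
Implicit Types (b l x : R) (w : R[i]) (k : nat).

Definition jtrans l b w : R[i] :=
  cint (fun x => (W (l - 1 / 2) b x)%:C * cpow (gker x w) (- l)).

Definition jmass l b : R := \int[mu]_(x in I) W (l - 1 / 2) b x.

Lemma jtrans0 l b : jtrans l b 0 = (jmass l b)%:C.
Proof.
rewrite /jmass -cint_real; apply: eq_cint => x _.
by rewrite /gker expr0n mulr0 subr0 addr0 cpow1l mulr1.
Qed.

(** This is cint_master for s = 1 - l and exponents l - 1/2 and b, with every
1 - x written as 2 - (1 + x) so that only powers of 1 + x multiply the weight. *)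
Lemma jtrans_rec l b w : -1 / 2 < l -> -1 < b -> normc w < 1 ->
  2 * (b%:C + 1) * (1 + w) ^+ 2 * jtrans l b w +
  (4 * w * (l%:C - b%:C - 2) - (l%:C + b%:C + 3 / 2) * (1 + w) ^+ 2) * jtrans l (b + 1) w +
  2 * w * (b%:C + 5 / 2) * jtrans l (b + 2) w = 0.
Proof.
move=> l0 b0 w1; have l1 : -1 < l - 1 / 2 by lra.
have b1 : -1 < b + 1 by lra.
have b2 : -1 < b + 2 by lra.
have tc : tame (fun x => cpow (gker x w) (- l)) by exact: tame_cpow_gker.
have i0 := cintegrable_tame l1 b0 tc.
have i1 := cintegrable_tame l1 b1 tc.
have i2 := cintegrable_tame l1 b2 tc.
rewrite /jtrans -!cintZ// -cintD; [|exact: cintegrableZ..].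
rewrite -cintD; [|by apply: cintegrableD; exact: cintegrableZ|exact: cintegrableZ].
rewrite -[RHS](cint_master (1 - l) l1 b0 w1); apply: eq_cint => x xI.
have -> : 1 - l - 1 = - l by ring.
have -> : b + 2 = b + 1 + 1 by ring.
rewrite !jacobi_weightSr//.
have -> : ((b + 1) * (1 - x) - (l - 1 / 2 + 1) * (1 + x))%:C =
   (b%:C + 1) * (1 - x%:C) - (l%:C + 1 / 2) * (1 + x%:C) :> R[i].
  rewrite (_ : l - 1 / 2 + 1 = l + 1 / 2); last by field.
  by rewrite !(rmorphM, rmorphB, rmorphD, rmorph1, fmorphV, rmorph_nat)/=.
have -> : (1 - x ^+ 2)%:C = 1 - x%:C ^+ 2 :> R[i] by rewrite rmorphB rmorphXn rmorph1.
have -> : (1 - l)%:C = 1 - l%:C :> R[i] by rewrite rmorphB rmorph1.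
move: (W _ _ _) (cpow _ _) => W0 c; rewrite /gker.
have e1 (y : R) : ((1 + x) * y)%:C = (1 + x%:C) * y%:C :> R[i].
  by rewrite rmorphM rmorphD rmorph1.
by rewrite !e1; field.
Qed.

(** The recurrence at w = 0. *)
Lemma jmass_rec l b : -1 / 2 < l -> -1 < b ->
  2 * (b + 1) * jmass l b = (l + b + 3 / 2) * jmass l (b + 1).
Proof.
move=> l0 b0; have := @jtrans_rec l b 0 l0 b0.
rewrite normc0 => /(_ ltr01).
rewrite !jtrans0 !mulr0 !mul0r addr0 sub0r addr0 expr1n !mulr1 mulNr => /eqP.
rewrite subr_eq0 => /eqP h; apply: (@complexI R).
rewrite !(rmorphM, rmorphD, rmorph1, fmorphV, rmorph_nat)/=.
exact: h.
Qed.

(** Induction on k in steps of two, from the two cases of the previous part.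
Raising k by one lowers the exponent b of 1 + x by one and the parameter
q = 2 l - k + 1 by one, which is how the parameters of the contiguous relation
match those of jtrans_rec. *)
Lemma jtransE k l w : -1 < l - k%:R - 1 / 2 -> normc w < 1 ->
  jtrans l (l - 1 / 2 - k%:R) w =
  (jmass l (l - 1 / 2 - k%:R))%:C / (1 + w) ^+ k *
    heval k (2 * l - k%:R + 1) (w / (1 + w)).
Proof.
move=> + w1.
have w0 : 1 + w != 0.
  apply: contraTneq w1 => /eqP; rewrite addr_eq0 => /eqP h.
  by rewrite -leNgt -normcN -h normc1.
pose P k := -1 < l - k%:R - 1 / 2 -> jtrans l (l - 1 / 2 - k%:R) w =
  (jmass l (l - 1 / 2 - k%:R))%:C / (1 + w) ^+ k *
    heval k (2 * l - k%:R + 1) (w / (1 + w)).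
suff: P k /\ P k.+1 by case.
elim: k => [|k [IH0 IH1]]; split => //.
- rewrite /P !subr0 => l0; rewrite heval0 expr0 divr1 mulr1.
  by apply: gegen_const => //; lra.
- rewrite /P => l0; rewrite heval1 expr1 mulr1.
  apply: (mulfI w0); rewrite mulrCA divff// mulr1.
  have l1 : 1 / 2 < l by lra.
  have h0 := @gegen_shift R l 0 l1 ltac:(by rewrite normc0 ltr01).
  rewrite -/(jtrans l (l - 1 / 2 - 1) 0) addr0 mul1r jtrans0 in h0.
  by rewrite h0; exact: gegen_shift.
move=> l2; set b := l - 1 / 2 - k.+2%:R.
have kE2 : k.+2%:R = k%:R + 2 :> R by rewrite -!natr1; ring.
have kE1 : k.+1%:R = k%:R + 1 :> R by rewrite -!natr1.
have k0 : 0 <= k%:R :> R by [].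
have b0 : -1 < b by move: l2; rewrite /b kE2; lra.
have l0 : -1 / 2 < l by move: l2; rewrite kE2; lra.
have {}IH0 := IH0 ltac:(move: l2; rewrite kE2; lra).
have {}IH1 := IH1 ltac:(move: l2; rewrite kE1 kE2; lra).
have b1E : l - 1 / 2 - k.+1%:R = b + 1 by rewrite /b kE1 kE2; ring.
have b2E : l - 1 / 2 - k%:R = b + 2 by rewrite /b kE2; ring.
rewrite b1E in IH1; rewrite b2E in IH0.
pose q := 2 * l - k.+2%:R + 1.
have q0 : 0 < q by move: l2; rewrite /q kE2; lra.
have q1 : 2 * l - k.+1%:R + 1 = q + 1 by rewrite /q kE1 kE2; ring.
have q2 : 2 * l - k%:R + 1 = q + 2 by rewrite /q kE2; ring.
rewrite q1 in IH1; rewrite q2 in IH0.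
have cq : 2 * (b + 1) = q - k%:R - 2 by rewrite /b /q kE2; field.
have cq1 : l + b + 3 / 2 = q by rewrite /b /q kE2; field.
have cq2 : 2 * (b + 1 + 1) = q - k%:R by rewrite /b /q kE2; field.
have cq3 : l + (b + 1) + 3 / 2 = q + 1 by rewrite /b /q kE2; field.
have cq4 : l - b - 2 = k%:R + 1 / 2 by rewrite /b kE2; field.
have cq5 : q - k%:R + 1 = 2 * (b + 5 / 2) by rewrite /b /q kE2; field.
have nz0 : q - k%:R - 2 != 0 by rewrite -cq gt_eqF//; lra.
have nz1 : q + 1 != 0 by rewrite gt_eqF//; lra.
have rec := jtrans_rec l0 b0 w1.
have m1 := jmass_rec l0 b0.
have m2 := @jmass_rec l (b + 1) l0 ltac:(lra).
have hr := @heval_rec R k q (w / (1 + w)) q0.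
have b2' : b + 1 + 1 = b + 2 by ring.
rewrite -/q; rewrite IH0 IH1 in rec.
rewrite cq cq1 in m1; rewrite cq2 cq3 b2' in m2.
clearbody b q; clear IH0 IH1 b1E b2E q1 q2.
have cR (x y : R) : x = y -> x%:C = y%:C :> R[i] by move=> ->.
have cc0 : q%:C - k%:R - 2 != 0 :> R[i].
  by apply: contra_neq nz0 => h; apply: (@complexI R);
    rewrite !(rmorphB, rmorph_nat, rmorph0).
have cc1 : q%:C + 1 != 0 :> R[i].
  by apply: contra_neq nz1 => h; apply: (@complexI R);
    rewrite !(rmorphD, rmorph1, rmorph0).
have -> : (1 + w) ^+ k.+2 = (1 + w) ^+ k * (1 + w) ^+ 2 by rewrite -exprD addn2.
apply: (jtrans_step (k := k%:R) (q := q%:C) (N0 := (jmass l (b + 2))%:C)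
  (N1 := (jmass l (b + 1))%:C) (P0 := heval k (q + 2) (w / (1 + w)))
  (P1 := heval k.+1 (q + 1) (w / (1 + w))) w0 (expf_neq0 k w0) cc0 cc1 (erefl _)).
- have := cR _ _ m1; rewrite !(rmorphM, rmorphB, rmorph_nat)/=; exact.
- have := cR _ _ m2; rewrite !(rmorphM, rmorphB, rmorphD, rmorph1, rmorph_nat)/=; exact.
- rewrite -[RHS]rec !exprSr.
  have -> : 2 * (b%:C + 1) = q%:C - k%:R - 2 :> R[i].
    by have := cR _ _ cq; rewrite !(rmorphM, rmorphB, rmorphD, rmorph1, rmorph_nat)/=.
  have -> : l%:C + b%:C + 3 / 2 = q%:C :> R[i].
    by have := cR _ _ cq1; rewrite !(rmorphM, rmorphB, rmorphD, fmorphV, rmorph1, rmorph_nat)/=.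
  have -> : 4 * w * (l%:C - b%:C - 2) = 2 * w * (2 * k%:R + 1).
    rewrite (_ : l%:C - b%:C - 2 = (k%:R + 1 / 2)); first by field.
    by move: cq4 => /cR; rewrite !(rmorphM, rmorphB, rmorphD, fmorphV, rmorph1, rmorph_nat)/=.
  have -> : 2 * w * (b%:C + 5 / 2) = w * (q%:C - k%:R + 1).
    rewrite (_ : q%:C - k%:R + 1 = 2 * (b%:C + 5 / 2)); first by ring.
    by move: cq5 => /cR; rewrite !(rmorphM, rmorphB, rmorphD, fmorphV, rmorph1, rmorph_nat)/=.
  by [].
- have := hr; rewrite !(rmorphM, rmorphB, rmorphD, fmorphV, rmorph1, rmorph_nat)/=.
  by rewrite -mulrA => ->; rewrite !mulrA.
Qed.

End jacobi_transform.

(** * Integration against a density *)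
Section density_integral.
Context {R : realType}.
Local Notation mu := (@lebesgue_measure R).
Variables (p : R -> R) (nu : {measure set R -> \bar R}).
Hypothesis p0 : forall x, 0 <= p x.
Hypothesis mp : measurable_fun [set: measurableTypeR R] p.
Hypothesis nuE : forall A, measurable A -> (nu A = \int[mu]_(x in A) (p x)%:E)%E.

Import HBNNSimple.

Let integral_density_nnsfun (h : {nnsfun R >-> R}) :
  (\int[nu]_x (h x)%:E = \int[mu]_x ((h x)%:E * (p x)%:E))%E.
Proof.
under [LHS]eq_integral do rewrite fimfunE -fsumEFin//.
rewrite [LHS]ge0_integral_fsum//; last 2 first.
  - by move=> r; exact/measurable_EFinP/measurableT_comp.
  - by move=> n x _; rewrite EFinM nnfun_muleindic_ge0.
under [RHS]eq_integral.
  move=> x xD; rewrite fimfunE -fsumEFin// ge0_mule_fsuml; last first.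
    by move=> r; rewrite EFinM nnfun_muleindic_ge0.
  over.
rewrite [RHS]ge0_integral_fsum//; last 2 first.
  - move=> r; apply: emeasurable_funM; apply/measurable_EFinP => //.
    have mA : measurable (h @^-1` [set r]) by exact: measurable_funPTI.
    by apply: measurable_funM => //; exact: (@measurable_indic _ (measurableTypeR R) R setT _ mA).
  - by move=> n x _; rewrite mule_ge0 ?lee_fin// -lee_fin EFinM nnfun_muleindic_ge0.
apply: eq_fsbigr => r _.
have mA : measurable (h @^-1` [set r]) by exact: measurable_funPTI.
rewrite integralZl_indic_nnsfun// integral_indic// setIT nuE//.
have [r0|r0] := ltP r 0.
  rewrite (_ : h @^-1` [set r] = set0); last exact: preimage_nnfun0.
  rewrite integral_set0 mule0; apply/esym; apply: integral0_eq => x _.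
  by rewrite indic0 mulr0 mul0e.
under [RHS]eq_integral do rewrite EFinM -muleA.
rewrite ge0_integralZl_EFin//; last 2 first.
- by move=> x _; rewrite mule_ge0 ?lee_fin.
- by apply: emeasurable_funM; exact/measurable_EFinP.
congr (_ * _)%E; rewrite [LHS]integral_mkcond; apply: eq_integral => x _.
rewrite patchE indicE; case: ifPn => _; first by rewrite mul1e.
by rewrite mul0e.
Qed.

(** From simple functions by monotone convergence. *)
Lemma ge0_integral_density (f : R -> \bar R) :
  measurable_fun [set: measurableTypeR R] f -> (forall x, 0 <= f x)%E ->
  (\int[nu]_x f x = \int[mu]_x (f x * (p x)%:E))%E.
Proof.
move=> mf f0; have mfR : measurable_fun [set: R] f by exact: mf.
pose f_ : {nnsfun R >-> R}^nat := nnsfun_approx measurableT mfR.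
have nd_f (x : R) a b : (a <= b)%N -> f_ a x <= f_ b x.
  by move=> ab; exact/lefP/nd_nnsfun_approx.
transitivity (limn (fun n => \int[nu]_x (f_ n x)%:E)%E).
  rewrite -monotone_convergence//=.
  - by apply: eq_integral => x _; apply/esym/cvg_lim => //=; exact: cvg_nnsfun_approx.
  - by move=> n; apply/measurable_EFinP; exact: measurable_funPT.
  - by move=> n x _; rewrite lee_fin.
  - by move=> x _ a b ab; rewrite lee_fin; exact: nd_f.
transitivity (limn (fun n => \int[mu]_x ((f_ n x)%:E * (p x)%:E))%E).
  by congr (limn _); apply/funext => n; exact: integral_density_nnsfun.
rewrite -monotone_convergence//=.
- apply: eq_integral => x _; apply/cvg_lim => //=; apply: cvgeZr => //.
  exact: cvg_nnsfun_approx.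
- move=> n; have mfn : measurable_fun [set: measurableTypeR R] (f_ n).
    exact: (measurable_funPT (f_ n)).
  by apply: emeasurable_funM; exact/measurable_EFinP.
- by move=> n x _; rewrite mule_ge0 ?lee_fin.
- move=> x _ a b ab; rewrite lee_wpmul2r ?lee_fin//.
  exact: nd_f.
Qed.

Lemma Rintegral_density (f : R -> R) :
  measurable_fun [set: measurableTypeR R] f ->
  \int[nu]_x f x = \int[mu]_x (f x * p x).
Proof.
move=> mf; rewrite /Rintegral; congr fine.
have mf' : measurable_fun [set: measurableTypeR R] (EFin \o f) by exact/measurable_EFinP.
rewrite [LHS]integralE [RHS]integralE.
have pos : (fun x => (f x * p x)%:E)^\+%E = (fun x => ((EFin \o f)^\+ x * (p x)%:E)%E).
  apply/funext => x; rewrite !funeposE /= -!EFin_max -EFinM; congr EFin.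
  by rewrite maxr_pMl// mul0r.
have neg : (fun x => (f x * p x)%:E)^\-%E = (fun x => ((EFin \o f)^\- x * (p x)%:E)%E).
  apply/funext => x; rewrite !funenegE /= -!EFin_max -EFinM; congr EFin.
  by rewrite maxr_pMl// mul0r mulNr.
rewrite pos neg; congr (_ - _)%E.
  by apply: ge0_integral_density => //; exact: measurable_funepos.
by apply: ge0_integral_density => //; exact: measurable_funeneg.
Qed.

End density_integral.

Section density_on_interval.
Context {R : realType}.
Local Notation mu := (@lebesgue_measure R).
Local Notation I := (`]-1, 1[%classic : set R).
Local Notation W := (@jacobi_weight R).

(** The end points carry no mass, so the integral over [-1, 1] against the
density becomes one over ]-1, 1[. *)
Lemma cintegral_density (nu : {measure set R -> \bar R})
    (a b c : R) (f : R -> R[i]) : 0 <= c ->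
  (forall A, measurable A -> (nu A =
     \int[mu]_(x in A) (((fun x => c * W a b x)%R \_ `[(-1)%R, 1%R]) x)%:E)%E) ->
  measurable_fun [set: measurableTypeR R] (fun x => Re (f x)) ->
  measurable_fun [set: measurableTypeR R] (fun x => Im (f x)) ->
  cintegrable (fun x => (W a b x)%:C * f x) ->
  cintegral nu f = c%:C * cint (fun x => (W a b x)%:C * f x).
Proof.
move=> c0 nuE mr mi fI.
pose p : R -> R := (fun x => c * W a b x) \_ `[-1, 1].
have p0 x : 0 <= p x.
  by apply: restrict_ge0 => y _; rewrite mulr_ge0 ?jacobi_weight_ge0.
have mW : measurable_fun [set: measurableTypeR R] (fun x => c * W a b x).
  by apply: measurable_funM => //; exact: measurable_jacobi_weight.
have mp : measurable_fun [set: measurableTypeR R] p.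
  by apply/measurable_restrict => //; exact: measurable_funTS.
have main (g : R -> R) : measurable_fun [set: measurableTypeR R] g ->
    \int[nu]_x g x = \int[mu]_(x in I) (c * (W a b x * g x)).
  move=> mg; rewrite (Rintegral_density p0 mp nuE mg).
  transitivity (\int[mu]_(x in `[-1, 1]) (c * (W a b x * g x))).
    rewrite [RHS]Rintegral_mkcond; apply: eq_Rintegral => x _.
    rewrite /p !patchE; case: ifP => _; last exact: mulr0.
    by rewrite mulrC mulrA.
  congr fine; apply: integral_itv_bndoo; apply/measurable_EFinP.
  apply: measurable_funTS.
  rewrite (_ : (fun _ => _) = (fun x => (c * W a b x) * g x)).
    exact: measurable_funM.
  by apply/funext => x; rewrite mulrA.
rewrite -cintZ//; apply: complex_ext; rewrite /cintegral/=.
  rewrite main//; apply: eq_Rintegral => x _.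
  by rewrite !ReM !ImM/= !mul0r !subr0.
rewrite main//; apply: eq_Rintegral => x _.
by rewrite !ImM !ReM/= !mul0r !addr0.
Qed.

(** By continuity on the open interval; the two end points do not affect
measurability. *)
Lemma measurable_acos : measurable_fun (`[-1, 1]%classic : set (measurableTypeR R)) (@acos R).
Proof.
apply/measurable_fun_itv_bndo_bndcP/measurable_fun_itv_obnd_cbndP.
apply: open_continuous_measurable_fun => // x; rewrite inE/= in_itv/= => xI.
exact: continuous_acos.
Qed.

Lemma measurable_normc_shift (z : R[i]) :
  measurable_fun [set: measurableTypeR R] (fun x : R => normc (z - x%:C)).
Proof.
rewrite (_ : (fun _ => _) = (fun x : R => ((Re z - x) ^+ 2 + Im z ^+ 2) `^ (2^-1))).
  apply: (measurableT_comp (measurable_powR _)).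
  apply: measurable_funD => //; apply: measurable_funX.
  exact: measurable_funB.
apply/funext => x; rewrite powR12_sqrt ?addr_ge0 ?sqr_ge0//.
by rewrite normcE2 !ReImE oppr0 addr0.
Qed.

Lemma measurable_carg_shift (z : R[i]) :
  measurable_fun [set: measurableTypeR R] (fun x : R => carg (z - x%:C)).
Proof.
have mr : measurable_fun [set: measurableTypeR R]
    (fun x : R => Re (z - x%:C) / normc (z - x%:C)).
  rewrite (_ : (fun _ => _) = (fun x : R => (Re z - x) * (normc (z - x%:C)) `^ (-1))).
    apply: measurable_funM; first exact: measurable_funB.
    exact: (measurableT_comp (measurable_powR _) (measurable_normc_shift z)).
  by apply/funext => x; rewrite powR_inv1 ?normc_ge0// !ReImE.
have ma : measurable_fun [set: measurableTypeR R]
    (fun x : R => acos (Re (z - x%:C) / normc (z - x%:C))).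
  have mI : measurable (`[-1, 1]%classic : set (measurableTypeR R)) by [].
  have sub : [set Re (z - x%:C) / normc (z - x%:C) | x in [set: R]] `<=` `[-1, 1].
    by move=> _ [x _ <-] /=; rewrite in_itv/=; exact: ReV1_bound.
  exact: (measurable_comp mI sub measurable_acos mr).
rewrite /carg; have [z0|z0] := leP 0 (Im z).
  rewrite (_ : (fun _ => _) = (fun x : R => acos (Re (z - x%:C) / normc (z - x%:C))))//.
  by apply/funext => x; rewrite !ReImE oppr0 addr0 z0.
rewrite (_ : (fun _ => _) = (fun x : R => - acos (Re (z - x%:C) / normc (z - x%:C)))).
  exact: (measurableT_comp (@oppr_measurable R setT)).
by apply/funext => x; rewrite !ReImE oppr0 addr0 leNgt z0.
Qed.

Lemma measurable_cpow_shift (z : R[i]) (s : R) :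
  measurable_fun [set: measurableTypeR R] (fun x : R => Re (cpow (z - x%:C) s)) /\
  measurable_fun [set: measurableTypeR R] (fun x : R => Im (cpow (z - x%:C) s)).
Proof.
have me : measurable_fun [set: measurableTypeR R]
    (fun x : R => expR (s * ln (normc (z - x%:C)))).
  apply: (measurableT_comp (@measurable_expR R)); apply: measurable_funM => //.
  exact: (measurableT_comp (@measurable_ln R) (measurable_normc_shift z)).
have mc : measurable_fun [set: measurableTypeR R] (fun x : R => s * carg (z - x%:C)).
  by apply: measurable_funM => //; exact: measurable_carg_shift.
split; under eq_fun do rewrite cpowE /=; apply: measurable_funM => //.
  exact: (measurableT_comp (continuous_measurable_fun (@continuous_cos R)) mc).
exact: (measurableT_comp (continuous_measurable_fun (@continuous_sin R)) mc).
Qed.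

Lemma measurable_inv_shift (z : R[i]) :
  measurable_fun [set: measurableTypeR R] (fun x : R => Re ((z - x%:C)^-1)) /\
  measurable_fun [set: measurableTypeR R] (fun x : R => Im ((z - x%:C)^-1)).
Proof.
have mn : measurable_fun [set: measurableTypeR R] (fun x : R => (normc (z - x%:C)) `^ (-2)).
  exact: (measurableT_comp (measurable_powR _) (measurable_normc_shift z)).
have nE (x : R) : (normc (z - x%:C)) `^ (-2) = (normc (z - x%:C)) ^- 2.
  by rewrite -powR_invn ?normc_ge0.
split.
  rewrite (_ : (fun _ => _) = (fun x : R => (Re z - x) * (normc (z - x%:C)) `^ (-2))).
    by apply: measurable_funM => //; exact: measurable_funB.
  apply/funext => x; rewrite nE -[_^-1]mul1r divcE /= !ReImE.
  by rewrite mul1r mul0r addr0.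
rewrite (_ : (fun _ => _) = (fun x : R => (- Im z) * (normc (z - x%:C)) `^ (-2))).
  exact: measurable_funM.
apply/funext => x; rewrite nE -[_^-1]mul1r divcE /= !ReImE.
by rewrite mul0r mul1r sub0r oppr0 addr0.
Qed.

End density_on_interval.

(** * The inverse Joukowski map *)
Section joukowski.
Context {R : realType}.
Implicit Types (x : R) (z w : R[i]).

(** Maps the plane cut along ]-oo, 1] onto the plane cut along ]-oo, 0], up to
the value 1 that is the image of infinity; its principal square root
has positive real part. *)
Definition cayley z : R[i] := (z - 1) / (z + 1).
Definition cayley_sqrt z : R[i] := cpow (cayley z) (1 / 2).
(** The half plane of the square root is sent to the unit disc. This gives a
branch-free description of the root w of w^2 - 2 z w + 1 with |w| < 1, that is
w = z - sqrt (z^2 - 1). *)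
Definition jouk z : R[i] := (1 - cayley_sqrt z) / (1 + cayley_sqrt z).

Lemma slit1E z : slit_plane 1 z <-> slit_plane 0 (z - 1).
Proof.
by rewrite /slit_plane; split => h; apply: contra_not h; rewrite !ReImE;
  rewrite oppr0 addr0 subr_le0.
Qed.

Lemma slit1_shift z x : -1 <= x <= 1 -> slit_plane 1 z -> slit_plane 0 (z - x%:C).
Proof.
move=> xI; rewrite /slit_plane => h; apply: contra_not h; rewrite !ReImE.
by rewrite oppr0 addr0 => -[-> h]; split => //; lra.
Qed.

Lemma slit1_addr z : slit_plane 1 z -> slit_plane 0 (1 + z).
Proof.
have -> : 1 + z = z - (-1)%:C by rewrite rmorphN rmorph1 opprK addrC.
by apply: slit1_shift; lra.
Qed.

Lemma slit1_addr_neq0 z : slit_plane 1 z -> z + 1 != 0.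
Proof. by move=> /slit1_addr/slit_neq0; rewrite addrC. Qed.

(** If the image t were real and <= 0 then z = (1 + t) / (1 - t) would be real and
<= 1. *)
Lemma slit_cayley z : slit_plane 1 z -> slit_plane 0 (cayley z).
Proof.
move=> zs; have z1 := slit1_addr_neq0 zs; move=> [ci cr]; apply: zs.
have cE : cayley z = (Re (cayley z))%:C by apply: complex_ext.
set t := Re _ in cr cE.
have t1 : 1 - t != 0 by rewrite gt_eqF//; lra.
have t1C : 1 - t%:C != 0 :> R[i].
  by apply: contra_neq t1 => h; apply: (@complexI R); rewrite rmorphB rmorph1 rmorph0.
have -> : z = ((1 + t) / (1 - t))%:C.
  rewrite !(rmorphM, fmorphV, rmorphD, rmorphN, rmorph1)/=.
  apply: (mulIf t1C); rewrite divfK// -cE /cayley; field; exact: z1.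
split=> //=; rewrite ler_pdivrMr ?subr_gt0; lra.
Qed.

Lemma cayley_sqrtK z : slit_plane 1 z -> cayley_sqrt z ^+ 2 = cayley z.
Proof.
move=> /slit_cayley/slit_neq0 c0.
by rewrite expr2 -cpowD (_ : 1 / 2 + 1 / 2 = 1) ?cpow1r//; field.
Qed.

Lemma Re_cayley_sqrt_gt0 z : slit_plane 1 z -> 0 < Re (cayley_sqrt z).
Proof.
move=> /slit_cayley/carg_slit/andP[c1 c2]; rewrite /cayley_sqrt cpowE /=.
rewrite mulr_gt0 ?expR_gt0// cos_gt0_pihalf//; apply/andP; split; lra.
Qed.

Lemma addr1_cayley_sqrt_neq0 z : slit_plane 1 z -> 1 + cayley_sqrt z != 0.
Proof.
move=> /Re_cayley_sqrt_gt0; move: (cayley_sqrt z) => [a b] /= a0.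
by apply/eqP => /(congr1 (@complex.Re R)) /= e; lra.
Qed.

Lemma normc_jouk z : slit_plane 1 z -> normc (jouk z) < 1.
Proof.
move=> zs; have r0 := Re_cayley_sqrt_gt0 zs.
have n0 : 0 < normc (1 + cayley_sqrt z) by rewrite normc_gt0 addr1_cayley_sqrt_neq0.
rewrite /jouk normcM normcV ltr_pdivrMr// mul1r -(@ltr_pXn2r _ 2)// ?nnegrE ?normc_ge0//.
move: (cayley_sqrt z) r0 => [a b] a0; rewrite !sqr_normcE !ReImE.
by move: a0 => /= a0; nra.
Qed.

(** The square root r satisfies r^2 (z + 1) = z - 1. *)
Lemma joukE z : slit_plane 1 z -> 2 * z * jouk z = 1 + jouk z ^+ 2.
Proof.
move=> zs; have r1 := addr1_cayley_sqrt_neq0 zs.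
have z1 := slit1_addr_neq0 zs.
have h := cayley_sqrtK zs.
have {}h : cayley_sqrt z ^+ 2 * (z + 1) = z - 1 by rewrite h /cayley divfK.
rewrite /jouk; move: (cayley_sqrt z) r1 h => r r1 h.
apply: (mulIf (x := (1 + r) ^+ 2)); first by rewrite expf_neq0.
transitivity (2 * z * (1 - r ^+ 2)); first by field.
transitivity (2 * (1 + r ^+ 2)); last by field.
have e : z * (1 - r ^+ 2) = 1 + r ^+ 2.
  have -> : z * (1 - r ^+ 2) = z - r ^+ 2 * (z + 1) + r ^+ 2 by ring.
  by rewrite h; ring.
by rewrite -mulrA e.
Qed.

Lemma jouk_neq0 z : slit_plane 1 z -> jouk z != 0.
Proof.
move=> /joukE; apply: contra_eq_neq => ->.
by rewrite mulr0 expr0n addr0 eq_sym oner_eq0.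
Qed.

Lemma addr1_jouk_neq0 z : slit_plane 1 z -> 1 + jouk z != 0.
Proof.
move=> /normc_jouk; apply: contraTneq => /eqP; rewrite addr_eq0 => /eqP h.
by rewrite -leNgt -normcN -h normc1.
Qed.

Lemma Re_addr1_jouk_gt0 z : slit_plane 1 z -> 0 < Re (1 + jouk z).
Proof.
move=> /normc_jouk; move: (jouk z) => w h.
have := le_lt_trans (ler_Re_normc w) h.
by case: w {h} => a b /=; rewrite ltr_norml => /andP[]; lra.
Qed.

Lemma gker_jouk z x : slit_plane 1 z ->
  gker x (jouk z) = (2 * jouk z) * (z - x%:C).
Proof. by move=> /joukE h; rewrite /gker addrAC -h; ring. Qed.

(** From 2 z = w + 1 / w and 1 / w = conj w / |w|^2. *)
Lemma jouk_ReIm z : slit_plane 1 z -> let n := normc (jouk z) ^+ 2 in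
  [/\ 0 < n, n < 1, 2 * Im z * n = Im (jouk z) * (n - 1) &
      2 * Re z * n = Re (jouk z) * (n + 1)].
Proof.
move=> zs n; have n0 : 0 < n by rewrite exprn_gt0// normc_gt0 jouk_neq0.
have n1 : n < 1 by rewrite exprn_ilt1 ?normc_ge0 ?normc_jouk.
have h := joukE zs; have nE : n = _ := sqr_normcE (jouk z).
have [hr hi] : 2 * (Re z * Re (jouk z) - Im z * Im (jouk z)) =
      1 + (Re (jouk z) ^+ 2 - Im (jouk z) ^+ 2) /\
    2 * (Re z * Im (jouk z) + Im z * Re (jouk z)) = 2 * Re (jouk z) * Im (jouk z).
  clearbody n; clear zs nE; move: h; move: (jouk z) => [a b]; case: z => x y h.
  have hr := congr1 (@complex.Re R) h; have hi := congr1 (@complex.Im R) h.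
  by move: hr hi => /= hr hi; split; lra.
move: hr hi nE; clearbody n.
move: (complex.Re z) (complex.Im z) (complex.Re (jouk z)) (complex.Im (jouk z)).
move=> x y a b hr hi nE; rewrite nE in n0 n1 *.
split; [exact: n0|exact: n1| |].
  transitivity (a * (2 * (x * b + y * a)) - b * (2 * (x * a - y * b))); first by ring.
  by rewrite hr hi; ring.
transitivity (a * (2 * (x * a - y * b)) + b * (2 * (x * b + y * a))); first by ring.
by rewrite hr hi; ring.
Qed.

(** Since |w| < 1, Im w and Im z have opposite signs; if z is real then z > 1
and w > 0. *)
Lemma jouk_opp_halves z x : -1 <= x <= 1 -> slit_plane 1 z ->
  opp_halves (2 * jouk z) (z - x%:C).
Proof.
move=> xI zs; have [n0 n1 hi hr] := jouk_ReIm zs.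
move: n0 n1 hi hr; set n := normc _ ^+ 2 => n0 n1 hi hr.
have Re1 : Im z = 0 -> 1 < Re z by move=> i0; rewrite ltNge; apply/negP => h; apply: zs.
clear zs; move: Re1 hi hr; clearbody n; move: (jouk z) => w Re1 hi hr.
have I2 : Im (2 * w) = 2 * Im w by case: (w) => a b /=; ring.
have R2 : Re (2 * w) = 2 * Re w by case: (w) => a b /=; ring.
rewrite /opp_halves I2 R2 !ReImE oppr0 addr0; clear I2 R2; move: Re1 hi hr.
move: (complex.Re z) (complex.Im z) (complex.Re w) (complex.Im w).
move=> X y a b Re1 hi hr.
have [y0|y0|y0] := ltgtP y 0.
- have : b * (1 - n) > 0 by rewrite -opprB mulrN -hi -mulNr mulr_gt0//; lra.
  by rewrite pmulr_lgt0 ?subr_gt0// => b0; apply: Or31; split=> //; lra.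
- have : - b * (1 - n) > 0 by rewrite mulNr -mulrN opprB -hi mulr_gt0//; lra.
  by rewrite pmulr_lgt0 ?subr_gt0// => b0; apply: Or32; split=> //; lra.
have X1 := Re1 y0; apply: Or33; split; [|exact: y0| |lra].
- have : b * (n - 1) = 0 by rewrite -hi y0 mulr0 mul0r.
  by move=> /eqP; rewrite mulf_eq0 => /orP[/eqP->|/eqP]; [rewrite mulr0|lra].
have : 0 < a * (n + 1) by rewrite -hr !mulr_gt0//; lra.
by rewrite pmulr_lgt0; [lra|lra].
Qed.

Lemma cpow_gker_jouk z x s : -1 <= x <= 1 -> slit_plane 1 z ->
  cpow (gker x (jouk z)) s = cpow (2 * jouk z) s * cpow (z - x%:C) s.
Proof.
by move=> xI zs; rewrite gker_jouk//; apply: cpowM_opp; exact: jouk_opp_halves.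
Qed.

(** The case x = -1 of cpow_gker_jouk, where the kernel is the square of 1 + w,
which has positive real part. *)
Lemma cpow_jouk_addr1 z k : slit_plane 1 z ->
  cpow (2 * jouk z) (k%:R / 2) * cpow (1 + z) (k%:R / 2) = (1 + jouk z) ^+ k.
Proof.
move=> zs.
have zE : 1 + z = z - (-1)%:C by rewrite rmorphN rmorph1 opprK addrC.
rewrite zE -cpow_gker_jouk//; last by lra.
have -> : gker (-1) (jouk z) = (1 + jouk z) ^+ 2.
  by rewrite /gker rmorphN rmorph1; ring.
rewrite cpow_sqr_half ?Re_addr1_jouk_gt0// cpow_nat//.
exact: addr1_jouk_neq0.
Qed.

End joukowski.

(** * The Stieltjes transforms *)
Section wigner_transform.
Context {R : realType}.
Local Notation mu := (@lebesgue_measure R).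
Local Notation I := (`]-1, 1[%classic : set R).
Local Notation W := (@jacobi_weight R).
Implicit Types (x : R) (z w : R[i]).

Lemma jacobi_weight_half x : -1 <= x <= 1 ->
  W (1 - 1 / 2) (1 - 1 / 2) x = Num.sqrt (1 - x ^+ 2).
Proof.
move=> /andP[x1 x2]; rewrite /jacobi_weight (_ : 1 - 1 / 2 = 2^-1); last by lra.
rewrite !powR12_sqrt ?subr_ge0//; last by rewrite addrC -lerBlDr sub0r.
by rewrite -sqrtrM ?subr_ge0//; congr Num.sqrt; ring.
Qed.

(** This is (t sqrt (1 - t^2) + arcsin t) / 2, a primitive of sqrt (1 - t^2).
The arcsine is written as 2 arctan (t / (1 + sqrt (1 - t^2))), which is
continuous at the end points 1 and -1 as well. *)
Definition half_disk (t : R) : R := 2^-1 * (t * Num.sqrt (1 - t ^+ 2) +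
  2 * atan (t * (1 + Num.sqrt (1 - t ^+ 2))^-1)).

Lemma is_derive_half_disk x : -1 < x < 1 ->
  is_derive x 1 half_disk (Num.sqrt (1 - x ^+ 2)).
Proof.
move=> /andP[x1 x2]; have p0 : 0 < 1 - x ^+ 2 by nra.
set s := Num.sqrt (1 - x ^+ 2).
have s0 : 0 < s by rewrite sqrtr_gt0.
have sE : s ^+ 2 = 1 - x ^+ 2 by rewrite sqr_sqrtr// ltW.
have dx := is_derive_id x (1 : R).
have dp : is_derive x 1 (fun t : R => 1 - t * t) (0 - (1 * x + x * 1)).
  exact: (is_derive1_add (is_derive_cst (1 : R) x 1) (is_derive1_opp (is_derive1_mul dx dx))).
have ds : is_derive x 1 (fun t : R => Num.sqrt (1 - t ^+ 2)) (- x / s).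
  have p0' : 0 < 1 - x * x by rewrite -expr2.
  have h := is_derive1_sqrt_comp (f := fun t : R => 1 - t * t) p0' dp.
  under eq_fun do rewrite expr2.
  apply: (is_derive1_eq h); rewrite -expr2 -/s; field; rewrite gt_eqF//.
have d1 : is_derive x 1 (fun t : R => 1 + Num.sqrt (1 - t ^+ 2)) (0 + - x / s).
  exact: (is_derive1_add (is_derive_cst (1 : R) x 1) ds).
have s1 : 1 + s != 0 by rewrite gt_eqF// addr_gt0.
have dv := is_derive1_inv (f := fun t : R => 1 + Num.sqrt (1 - t ^+ 2)) s1 d1.
have dq := is_derive1_mul dx dv.
have da := is_derive1_chain (g := fun t : R => t * (1 + Num.sqrt (1 - t ^+ 2))^-1)
  (is_derive1_atan (x * (1 + s)^-1)) dq.
have dF := is_derive1_scale 2^-1 (is_derive1_add (is_derive1_mul dx ds)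
  (is_derive1_scale 2 da)).
apply: (is_derive1_eq dF); rewrite -/s.
have h1 : 1 + (x * (1 + s)^-1) ^+ 2 = 2 / (1 + s).
  rewrite exprMn (_ : x ^+ 2 = 1 - s ^+ 2); last by rewrite sE; ring.
  by field.
have h2 : 1 * (1 + s)^-1 + x * (- (0 + - x / s) / (1 + s) ^+ 2) = (s * (1 + s))^-1.
  rewrite (_ : x * _ = x ^+ 2 / s / (1 + s) ^+ 2); last by field; rewrite s1 gt_eqF.
  rewrite (_ : x ^+ 2 = 1 - s ^+ 2); last by rewrite sE; ring.
  by field; rewrite s1 gt_eqF.
rewrite h1 h2 (_ : x * (- x / s) = - x ^+ 2 / s); last by field; rewrite gt_eqF.
rewrite (_ : x ^+ 2 = 1 - s ^+ 2); last by rewrite sE; ring.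
by field; rewrite s1 gt_eqF.
Qed.

Lemma continuous_half_disk : continuous half_disk.
Proof.
move=> x; have cs : {for x, continuous (fun t : R => Num.sqrt (1 - t ^+ 2))}.
  apply: (@continuous_comp _ _ _ (fun t : R => 1 - t ^+ 2)); last exact: sqrt_continuous.
  by apply: cvgB; [exact: cvg_cst|exact: exprn_continuous].
apply: cvgM; first exact: cvg_cst.
apply: cvgD; first by apply: cvgM; [exact: cvg_id|exact: cs].
apply: cvgM; first exact: cvg_cst.
apply: (@continuous_comp _ _ _ (fun t : R => t * (1 + Num.sqrt (1 - t ^+ 2))^-1));
  last exact: continuous_atan.
apply: cvgM; first exact: cvg_id.
apply: cvgV; first by rewrite gt_eqF// ltr_wpDr ?sqrtr_ge0.
by apply: cvgD; [exact: cvg_cst|exact: cs].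
Qed.

Lemma Rintegral_jacobi_weight_half :
  \int[mu]_(x in I) W (1 - 1 / 2) (1 - 1 / 2) x = pi / 2.
Proof.
have h : -1 < 1 - 1 / 2 :> R by lra.
have c1 (x : R) := @continuous_half_disk x.
have v1 : half_disk 1 = pi / 4.
  by rewrite /half_disk expr1n subrr sqrtr0 mulr0 add0r addr0 invr1 mulr1 atan1; field.
have vN1 : half_disk (-1) = - (pi / 4).
  by rewrite /half_disk sqrrN expr1n subrr sqrtr0 mulr0 add0r addr0 invr1 mulr1 atanN atan1; field.
have -> : pi / 2 = pi / 4 - - (pi / 4) :> R by field.
apply: (FTC_oo (f := W (1 - 1 / 2) (1 - 1 / 2)) (F := half_disk)).
- lra.
- exact: integrable_jacobi_weight.
- move=> x xI; rewrite jacobi_weight_half; first exact: is_derive_half_disk.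
  by move: xI => /andP[? ?]; lra.
- by move=> x; exact: continuous_jacobi_weight.
- by rewrite -vN1; exact: cvg_at_right_filter (c1 (-1)).
- by rewrite -v1; exact: cvg_at_left_filter (c1 1).
Qed.

(** The Wigner density is the ultraspherical weight for l = 1, and 1 / (z - x) is
2 w / gker x w; so the transform is 2 w times a constant, by gegen_const. *)
Lemma G_WE z : slit_plane 1 z -> G_W z = 2 * jouk z.
Proof.
move=> zs; have w1 := normc_jouk zs; have w0 := jouk_neq0 zs.
have h : -1 < 1 - 1 / 2 :> R by lra.
have invE (x : R) : -1 < x < 1 ->
    (W (1 - 1 / 2) (1 - 1 / 2) x)%:C * (z - x%:C)^-1 = (2 * jouk z) *
    ((W (1 - 1 / 2) (1 - 1 / 2) x)%:C * cpow (gker x (jouk z)) (- 1)).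
  move=> /andP[x1 x2].
  have zx : z - x%:C != 0 by apply/slit_neq0/slit1_shift => //; lra.
  have J : 2 * jouk z != 0 by apply: mulf_neq0 w0; rewrite pnatr_eq0.
  rewrite cpowN cpow1r gker_jouk//; last exact: mulf_neq0 J zx.
  by rewrite invfM mulrCA mulVKf.
have [mr mi] := measurable_inv_shift z.
have t0 : cintegrable (fun x => (W (1 - 1 / 2) (1 - 1 / 2) x)%:C *
    cpow (gker x (jouk z)) (- 1)) by apply: cintegrable_tame => //; exact: tame_cpow_gker.
have nuE A : measurable A -> (@wigner R A = \int[mu]_(x in A)
    (((fun x => 2 / pi * W (1 - 1 / 2) (1 - 1 / 2) x)%R \_ `[(-1)%R, 1%R]) x)%:E)%E.
  move=> _; apply: eq_integral => x _; congr EFin.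
  rewrite /wigner_pdf !patchE; case: ifPn => //; rewrite inE/= in_itv/= => xI.
  by rewrite jacobi_weight_half//; ring.
have p0 : 0 < pi :> R := pi_gt0 R.
have c0 : 0 <= 2 / pi :> R by rewrite divr_ge0// ltW.
have fI : cintegrable (fun x => (W (1 - 1 / 2) (1 - 1 / 2) x)%:C * (z - x%:C)^-1).
  by apply: eq_cintegrable (cintegrableZ _ t0) => x xI; exact/esym/invE.
transitivity ((2 / pi)%:C * cint (fun x => (W (1 - 1 / 2) (1 - 1 / 2) x)%:C * (z - x%:C)^-1)).
  by apply: (cintegral_density c0 _ mr mi fI).
have gc : cint (fun x => (W (1 - 1 / 2) (1 - 1 / 2) x)%:C *
    cpow (gker x (jouk z)) (- 1)) = _ := gegen_const (l := 1) ltac:(lra) w1.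
rewrite (eq_cint invE) cintZ// gc Rintegral_jacobi_weight_half mulrCA -rmorphM/= (_ : 2 / pi * _ = 1) ?mulr1//.
by rewrite mulrA divfK ?divff// ?pnatr_eq0//; exact: lt0r_neq0.
Qed.

End wigner_transform.

(** * The terminating series *)
Section hypergeometric_series.
Context {R : realType}.

Lemma pochhammerE (a : R) n : pochhammer a%:C n = (poch a n)%:C.
Proof.
rewrite /pochhammer /poch rmorph_prod/=; apply: eq_bigr => i _.
by rewrite rmorphD rmorph_nat.
Qed.

(** The partial sums are stationary beyond k + 1 terms. *)
Lemma hyp2F1E (k : nat) (c : R) (u : R[i]) :
  hyp2F1 (1 - k%:R) k%:R c%:C u = heval k c u.
Proof.
rewrite /hyp2F1; apply: (@cvg_lim (R[i]^o)) => //.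
have termE n : pochhammer (1 - k%:R) n * pochhammer k%:R n / pochhammer c%:C n *
    (u ^+ n / n`!%:R) = (hcoef k%:R c n)%:C * u ^+ n :> R[i].
  rewrite (_ : 1 - k%:R = (1 - k%:R)%:C); last by rewrite rmorphB rmorph1 rmorph_nat.
  rewrite (_ : k%:R = k%:R%:C :> R[i]); last by rewrite rmorph_nat.
  rewrite !pochhammerE /hcoef !(rmorphM, fmorphV) /= rmorph_nat invfM.
  by rewrite -!mulrA; do 3 congr (_ * _); rewrite mulrC.
apply: (@cvg_near_cst _ (R[i]^o)); near=> n.
have kn : (k.+1 <= n)%N by near: n; exact: nbhs_infty_ge.
rewrite /series/= hevalE (eq_bigr _ (fun n _ => termE n)).
rewrite (@big_cat_nat _ _ _ k.+1 0 n)//= [X in _ + X]big_nat_cond [X in _ + X]big1 ?addr0 ?big_mkord//.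
by move=> i /andP[/andP[ki _] _]; rewrite hcoef_eq0// mul0r.
Unshelve. all: by end_near. Qed.

End hypergeometric_series.

(** * Both sides in the Joukowski coordinate *)
Section transforms_on_slit_plane.
Context {R : realType}.
Local Notation mu := (@lebesgue_measure R).
Local Notation W := (@jacobi_weight R).
Implicit Types (k : nat) (lambda : R) (z : R[i]).

Lemma gstieltjes_betaE k lambda z : -1 < lambda - k%:R - 1 / 2 ->
  slit_plane 1 z ->
  gstieltjes lambda (betaN11 (lambda - 1 / 2) (lambda - 1 / 2 - k%:R)) z =
  cpow (2 * jouk z) lambda / (1 + jouk z) ^+ k *
    heval k (2 * lambda - k%:R + 1) (jouk z / (1 + jouk z)).
Proof.
move=> lk zs; have w1 := normc_jouk zs; have w0 := jouk_neq0 zs.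
have k0 : 0 <= k%:R :> R by [].
have a1 : -1 < lambda - 1 / 2 by clear -lk k0; lra.
have b1 : -1 < lambda - 1 / 2 - k%:R by clear -lk k0; lra.
move: a1 b1; set a := lambda - 1 / 2; set b := a - k%:R => a1 b1.
pose c := Gamma_fun (a + b + 2) / (2 `^ (a + b + 1) * Gamma_fun (a + 1) * Gamma_fun (b + 1)).
have mass : c * jmass lambda b = 1.
  have d0 : 2 `^ (a + b + 1) * Gamma_fun (a + 1) * Gamma_fun (b + 1) != 0 :> R.
    have ? : 0 < Gamma_fun (a + 1) by apply: Gamma_fun_gt0; lra.
    have ? : 0 < Gamma_fun (b + 1) by apply: Gamma_fun_gt0; lra.
    by rewrite lt0r_neq0// !mulr_gt0// powR_gt0.
  by rewrite /c /jmass -/a mulrAC Rintegral_jacobi_weight// divff.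
have J : 2 * jouk z != 0 by apply: mulf_neq0 w0; rewrite pnatr_eq0.
have invE (x : R) : -1 < x < 1 ->
    (W a b x)%:C * (cpow (z - x%:C) lambda)^-1 = cpow (2 * jouk z) lambda *
    ((W a b x)%:C * cpow (gker x (jouk z)) (- lambda)).
  move=> /andP[x1 x2].
  rewrite cpow_gker_jouk//; last by apply/andP; split; lra.
  rewrite -cpowN mulrCA; congr (_ * _); rewrite mulrA -cpowD subrr cpow0.
  by rewrite mul1r.
have t0 : cintegrable (fun x => (W a b x)%:C * cpow (gker x (jouk z)) (- lambda)).
  by apply: cintegrable_tame => //; exact: tame_cpow_gker.
have fI : cintegrable (fun x => (W a b x)%:C * (cpow (z - x%:C) lambda)^-1).
  by apply: eq_cintegrable (cintegrableZ _ t0) => x xI; exact/esym/invE.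
have c0 : 0 <= c.
  by rewrite divr_ge0 ?mulr_ge0 ?powR_ge0 ?Gamma_fun_ge0.
have nuE A : measurable A -> (betaN11 a b A = \int[mu]_(x in A)
    (((fun x => c * W a b x)%R \_ `[(-1)%R, 1%R]) x)%:E)%E.
  move=> _; apply: eq_integral => y _; congr EFin.
  by rewrite /betaN11_pdf !patchE; case: ifPn => // _; rewrite -!mulrA.
have [mr mi] : measurable_fun [set: measurableTypeR R]
      (fun x => Re (cpow (z - x%:C) lambda)^-1) /\
    measurable_fun [set: measurableTypeR R] (fun x => Im (cpow (z - x%:C) lambda)^-1).
  have fE (f : R[i] -> R) : (fun x : R => f (cpow (z - x%:C) lambda)^-1) =
      (fun x : R => f (cpow (z - x%:C) (- lambda))).
    by apply/funext => x; rewrite cpowN.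
  by rewrite (fE (@complex.Re R)) (fE (@complex.Im R)); exact: measurable_cpow_shift.
transitivity (c%:C * cint (fun x => (W a b x)%:C * (cpow (z - x%:C) lambda)^-1)).
  by apply: (cintegral_density c0 _ mr mi fI).
rewrite (eq_cint invE) cintZ// -/(jtrans lambda b (jouk z)) jtransE//.
rewrite mulrCA -!mulrA; congr (_ * _); rewrite !mulrA -rmorphM/= mass.
by rewrite mul1r.
Qed.

Lemma cpow_G_WE k lambda z : slit_plane 1 z ->
  cpow (G_W z) (lambda - k%:R / 2) / cpow (1 + z) (k%:R / 2) *
    hyp2F1 (1 - k%:R) k%:R (2 * lambda - k%:R + 1)%:C (G_W z / (G_W z + 2)) =
  cpow (2 * jouk z) lambda / (1 + jouk z) ^+ k *
    heval k (2 * lambda - k%:R + 1) (jouk z / (1 + jouk z)).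
Proof.
move=> zs; have w0 := jouk_neq0 zs; have w1 := addr1_jouk_neq0 zs.
rewrite hyp2F1E G_WE//; congr (_ * heval _ _ _).
  by rewrite cpowB -cpow_jouk_addr1// -mulrA invfM.
move: (jouk z) w0 w1 => w w0 w1.
have h : 2 * w + 2 = 2 * (1 + w) by ring.
by rewrite h -mulf_div divff ?mul1r// pnatr_eq0.
Qed.

End transforms_on_slit_plane.

(** * Holomorphy on the slit plane *)
Section holomorphy.
Context {R : realType}.
Local Notation C := (R[i]^o).
Implicit Types (k : nat) (z : R[i]) (f g : C -> C).

(** This and the following rules concern functions from R[i] to itself, seen as a
normed space over itself, which is what makes derivability complex. *)
Lemma derivable1_comp f g z : derivable g z 1 -> derivable f (g z) 1 ->
  derivable (fun t : C => f (g t)) z 1.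
Proof.
move=> /derivable1_diffP dg /derivable1_diffP df; apply/derivable1_diffP.
exact: (differentiable_comp dg df).
Qed.

Lemma derivable1_add f g z : derivable f z 1 -> derivable g z 1 ->
  derivable (fun t : C => f t + g t : C) z 1.
Proof. by move=> fz gz; exact (@derivableD _ C C f g z 1 fz gz). Qed.

Lemma derivable1_sub f g z : derivable f z 1 -> derivable g z 1 ->
  derivable (fun t : C => f t - g t : C) z 1.
Proof. by move=> fz gz; exact (@derivableB _ C C f g z 1 fz gz). Qed.

Lemma derivable1_mul f g z : derivable f z 1 -> derivable g z 1 ->
  derivable (fun t : C => f t * g t : C) z 1.
Proof. by move=> fz gz; exact (@derivableM _ C f g z 1 fz gz). Qed.

Lemma derivable1_inv f z : f z != 0 -> derivable f z 1 ->
  derivable (fun t : C => (f t)^-1 : C) z 1.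
Proof. by move=> f0 fz; exact (@derivableV _ C f z 1 f0 fz). Qed.

Lemma derivable1_exp f z n : derivable f z 1 ->
  derivable (fun t : C => f t ^+ n : C) z 1.
Proof.
move=> fz; elim: n => [|n ih]; first exact: derivable_cst.
under eq_fun do rewrite exprS.
exact: derivable1_mul fz ih.
Qed.

Lemma derivable_heval k (c : R) (u : R[i]) : derivable (heval k c : C -> C) u 1.
Proof.
rewrite /heval; move: (map_poly _ _) => p.
have d0 (a : C) := @derivable_cst _ C C a u 1.
elim/poly_ind: p => [|p a ih].
  rewrite (_ : (fun t => _) = fun=> 0 : C); first exact: d0.
  by apply/funext => t; exact: horner0.
rewrite (_ : (fun t => _) = fun t : C => p.[t] * t + a : C).
  exact (derivable1_add (derivable1_mul ih (@derivable_id _ C u 1)) (d0 a)).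
by apply/funext => t; exact: hornerMXaddC.
Qed.

Lemma derivable_jouk z : slit_plane 1 z -> derivable (jouk : C -> C) z 1.
Proof.
move=> zs; have z1 := slit1_addr_neq0 zs; have r1 := addr1_cayley_sqrt_neq0 zs.
have di := @derivable_id _ C z 1.
have d1 := @derivable_cst _ C C (1 : C) z 1.
have dc : derivable (cayley : C -> C) z 1.
  exact (derivable1_mul (derivable1_sub di d1)
    (@derivable1_inv (fun t : C => t + 1 : C) _ z1 (derivable1_add di d1))).
have dr : derivable (cayley_sqrt : C -> C) z 1.
  exact (@derivable1_comp (fun t => cpow t (1 / 2)) cayley z dc
    (derivable_cpow (slit_cayley zs))).
exact (derivable1_mul (derivable1_sub d1 dr)
  (@derivable1_inv (fun t : C => 1 + cayley_sqrt t : C) _ r1 (derivable1_add d1 dr))).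
Qed.

Lemma slit_jouk z : slit_plane 1 z -> slit_plane 0 (2 * jouk z).
Proof.
move=> zs; have := @jouk_opp_halves _ z 0 ltac:(lra) zs.
move: (2 * jouk z) => u h [i0 r0]; case: h => [[]|[]|[]]; rewrite ?i0 ?ltxx//.
by move=> _ _; rewrite ltNge r0.
Qed.

Lemma near_slit1 z : slit_plane 1 z -> \forall t \near (z : C), slit_plane 1 t.
Proof.
move=> /slit1E zs.
have c : {for (z : C), continuous (fun t : C => t - 1 : C)}.
  apply/differentiable_continuous/derivable1_diffP.
  exact (derivable1_sub (@derivable_id _ C z 1) (@derivable_cst _ C C (1 : C) z 1)).
have h := c _ (near_slit zs); rewrite nbhs_simpl/= in h.
by near=> t; apply/slit1E; near: t.
Unshelve. all: by end_near. Qed.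

Lemma derivable_jouk_formula k (lambda c : R) z : slit_plane 1 z ->
  derivable (fun t : C => cpow (2 * jouk t) lambda / (1 + jouk t) ^+ k *
    heval k c (jouk t / (1 + jouk t)) : C) z 1.
Proof.
move=> zs; have w1 := addr1_jouk_neq0 zs.
have dw := derivable_jouk zs.
have d1 (a : C) := @derivable_cst _ C C a z 1.
have dv := @derivable1_inv (fun t : C => 1 + jouk t : C) z w1 (derivable1_add (d1 1) dw).
have wk : (1 + jouk z) ^+ k != 0 by exact: expf_neq0.
have dk := @derivable1_inv (fun t : C => (1 + jouk t) ^+ k : C) z wk
  (@derivable1_exp (fun t : C => 1 + jouk t : C) z k (derivable1_add (d1 1) dw)).
have dp := @derivable1_comp (fun t => cpow t lambda) (fun t => 2 * jouk t) z
  (derivable1_mul (d1 2) dw) (derivable_cpow (slit_jouk zs)).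
have dh := @derivable1_comp (heval k c) (fun t => jouk t / (1 + jouk t)) z
  (derivable1_mul dw dv) (@derivable_heval k c _).
exact (derivable1_mul (derivable1_mul dp dk) dh).
Qed.

End holomorphy.

Theorem proposition3p3 (R : realType) (k : nat) (lambda : R) :
  (1 <= k)%N -> 0 < lambda -> -1 < lambda - k%:R - 1 / 2 ->
  let lhs : R[i] -> R[i] :=
    gstieltjes lambda (betaN11 (lambda - 1 / 2) (lambda - 1 / 2 - k%:R)) in
  let rhs : R[i] -> R[i] := fun z =>
    cpow (G_W z) (lambda - k%:R / 2) / cpow (1 + z) (k%:R / 2) *
    hyp2F1 (1 - k%:R) k%:R (2 * lambda - k%:R + 1)%:C (G_W z / (G_W z + 2)) in
  (forall x : R, 1 < x -> lhs x%:C = rhs x%:C) /\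
  [/\ holomorphic_on (slit_plane 1) lhs,
      holomorphic_on (slit_plane 1) rhs
    & forall z, slit_plane 1 z -> lhs z = rhs z].
Proof.
move=> k1 l0 lk lhs rhs.
(* The common expression of both sides in the Joukowski coordinate. *)
pose mid (z : R[i]) := cpow (2 * jouk z) lambda / (1 + jouk z) ^+ k *
  heval k (2 * lambda - k%:R + 1) (jouk z / (1 + jouk z)).
have lE z : slit_plane 1 z -> lhs z = mid z by exact: gstieltjes_betaE.
have rE z : slit_plane 1 z -> rhs z = mid z by exact: cpow_G_WE.
have hol (f : R[i] -> R[i]) : (forall z, slit_plane 1 z -> f z = mid z) ->
    holomorphic_on (slit_plane 1) f.
  move=> fE z zs; have dm := @derivable_jouk_formula _ k lambda
    (2 * lambda - k%:R + 1) z zs.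
  have nf : {near (z : R[i]^o), mid =1 f}.
    by near=> t; apply/esym/fE; near: t; exact: near_slit1.
  exact (@near_eq_derivable _ (R[i]^o) (R[i]^o) mid f z 1 nf dm).
have lr z : slit_plane 1 z -> lhs z = rhs z by move=> zs; rewrite lE// rE.
split; last by split; [exact: hol lE|exact: hol rE|exact: lr].
by move=> x x1; apply: lr => -[_ /=]; rewrite leNgt x1.
Unshelve. all: by end_near. Qed.
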